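(* Let $\mu_\hbar$ be the multiplication map of $\hbar$-adic quantum Minkowski space $\mathcal{X}_\hbar(\mathbb{R}^{1,3})$, let $\mu=\lim_{\hbar\to0}\mu_\hbar$ be its undeformed limit, the commutative multiplication of $\mathcal{X}=\mathbb{C}[a,b,c,d]$, where $\mathcal{X}_\hbar(\mathbb{R}^{1,3})$ is identified with $\mathcal{X}[[\hbar]]$ as $\mathbb{C}[[\hbar]]$-module by $\mathrm{det}_q^k\,T^{(j,j)}_{mm'}\leftrightarrow\mathrm{det}^k\,T'^{(j,j)}_{mm'}$, and let $\mathcal{F}_{\mathrm{s}}$ be the standard twist from $\mathcal{U}(\mathrm{su}_2)$ to $\mathcal{U}_\hbar(\mathrm{su}_2)$. Then $\mu_\hbar$ is the deformation of $\mu$ by $\mathcal{F}_{\mathrm{sl}_2(\mathbb{C})}:=\mathcal{R}^{-1}_{23}\,(\mathcal{F}_{\mathrm{s}})_{13}\,(\mathcal{F}_{\mathrm{s}})_{24}$: $$\mu_\hbar(x\otimes y)=\mu\big(\mathcal{F}_{\mathrm{sl}_2(\mathbb{C})}^{-1}\triangleright[x\otimes y]\big)\qquad\text{for all }x,y\in\mathcal{X}[[\hbar]].$$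
   Context: $\mathcal{U}(\mathrm{su}_2)$ is the complex enveloping algebra generated by $E,H,F$ with $[H,E]=2E$, $[H,F]=-2F$, $[E,F]=H$, canonical Hopf structure $\Delta(g)=g\otimes1+1\otimes g$, $\varepsilon(g)=0$, $S(g)=-g$ on generators, and $*$-structure $E^*=F$, $H^*=H$, $F^*=E$. $\mathcal{U}_\hbar(\mathrm{su}_2)$ is the complex $\hbar$-adic algebra generated by $E,H,F$ with $[H,E]=2E$, $[H,F]=-2F$, $[E,F]=\frac{e^{\hbar H}-e^{-\hbar H}}{e^\hbar-e^{-\hbar}}$, Hopf structure $\Delta'(E)=E\otimes e^{\hbar H}+1\otimes E$, $\Delta'(F)=F\otimes1+e^{-\hbar H}\otimes F$, $\Delta'(H)=H\otimes1+1\otimes H$, $S'(E)=-Ee^{-\hbar H}$, $S'(F)=-e^{\hbar H}F$, $S'(H)=-H$, $\varepsilon'(E)=\varepsilon'(F)=\varepsilon'(H)=0$, and involution $E^{*'}=Fe^{\hbar H}$, $F^{*'}=e^{-\hbar H}E$, $H^{*'}=H$. It has the universal $\mathcal{R}$-matrix $\mathcal{R}=e^{\hbar(H\otimes H)/2}\sum_{n\ge0}e^{\hbar n(n-1)/2}\frac{(e^\hbar-e^{-\hbar})^n}{[n]!}(E^n\otimes F^n)$. Put $q=e^\hbar$, $[n]=\frac{q^n-q^{-n}}{q-q^{-1}}$, $[n]!=[1]\cdots[n]$. For $j\in\frac12\mathbb{N}_0$, the spin-$j$ representation $\rho^j_\hbar$ of $\mathcal{U}_\hbar(\mathrm{su}_2)$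 acts on the free $\mathbb{C}[[\hbar]]$-module $V^j[[\hbar]]$ with orthonormal basis $|j,m\rangle$, $m=-j,\dots,j$, by $E|j,m\rangle=q^{m+1}\sqrt{[j+m+1][j-m]}\,|j,m+1\rangle$, $F|j,m\rangle=q^{-m}\sqrt{[j+m][j-m+1]}\,|j,m-1\rangle$, $H|j,m\rangle=2m|j,m\rangle$. $\rho^j$ is the undeformed ($\hbar=0$) spin-$j$ representation of $\mathcal{U}(\mathrm{su}_2)$ in the same basis, extended $\hbar$-adically. $\alpha:\mathcal{U}_\hbar(\mathrm{su}_2)\to\mathcal{U}(\mathrm{su}_2)[[\hbar]]$ is the $*$-algebra isomorphism with $\alpha=\mathrm{id}+O(\hbar)$, $\alpha(H)=H$ and $\rho_\hbar^j=\rho^j\circ\alpha$ for all $j$; $\Delta_\hbar:=(\alpha\otimes\alpha)\circ\Delta'\circ\alpha^{-1}$. In $\mathcal{F}_{\mathrm{sl}_2(\mathbb{C})}$, $\mathcal{R}$ is regarded as an element of $(\mathcal{U}(\mathrm{su}_2)\otimes\mathcal{U}(\mathrm{su}_2))[[\hbar]]$ via $\alpha\otimes\alpha$. A Drinfeld twist from $\mathcal{U}(\mathrm{su}_2)$ to $\mathcal{U}_\hbar(\mathrm{su}_2)$ is an invertible $\mathcal{F}\in(\mathcal{U}(\mathrm{su}_2)\otimes\mathcal{U}(\mathrm{su}_2))[[\hbar]]$ with $\Delta_\hbar(g)=\mathcal{F}\Delta(g)\mathcal{F}^{-1}$ for all $g$, assumed counital: $(\varepsilon\otimes\mathrm{id})(\mathcal{F})=1=(\mathrm{id}\otimes\varepsilon)(\mathcal{F})$.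 The $q$-Clebsch-Gordan coefficients $C_q(j_1,m_1;j_2,m_2|j,m)\in\mathbb{R}[[\hbar]]$ are the coefficients, for $|j_1-j_2|\le j\le j_1+j_2$ in integer steps, of the embedding $|j,m\rangle\mapsto\sum_{m_1,m_2}C_q(j_1,m_1;j_2,m_2|j,m)\,|j_1,m_1\rangle\otimes|j_2,m_2\rangle$ which intertwines $\rho^j_\hbar$ with $(\rho_\hbar^{j_1}\otimes\rho_\hbar^{j_2})\circ\Delta'$, normalized to form an orthogonal matrix (in the indices $(m_1,m_2)$ and $(j,m)$), with signs fixed so that for $\hbar\to0$ they become the ordinary (undeformed) Clebsch-Gordan coefficients $C(j_1,m_1;j_2,m_2|j,m)$. The standard twist $\mathcal{F}_{\mathrm{s}}$ is the unique Drinfeld twist from $\mathcal{U}(\mathrm{su}_2)$ to $\mathcal{U}_\hbar(\mathrm{su}_2)$ with $\langle j_1,m_1;j_2,m_2|(\rho^{j_1}\otimes\rho^{j_2})(\mathcal{F}_{\mathrm{s}})|j_1,m_1';j_2,m_2'\rangle=\sum_{j,m}C_q(j_1,m_1;j_2,m_2|j,m)\,C(j_1,m_1';j_2,m_2'|j,m)$ for all $j_1,j_2$. $\mathcal{U}_\hbar(\mathrm{so}_4):=\mathcal{U}_\hbar(\mathrm{su}_2)\otimes\mathcal{U}_\hbar(\mathrm{su}_2)$ with tensor product Hopf structure; the quantum Lorentz algebra $\mathcal{U}_\hbar(\mathrm{sl}_2(\mathbb{C}))$ is the same algebra with the coproduct twisted by $\mathcal{R}_{23}^{-1}=1\otimes\mathcal{R}^{-1}\otimes1$: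 $\Delta(u)=\mathcal{R}_{23}^{-1}\Delta^{\otimes2}(u)\mathcal{R}_{23}$, where $\Delta^{\otimes2}$ is the tensor product coproduct of $\mathcal{U}_\hbar(\mathrm{so}_4)$. Both have undeformed limit $\mathcal{U}(\mathrm{su}_2)\otimes\mathcal{U}(\mathrm{su}_2)$. Quantum Euclidean 4-space $M_\hbar(2)$ is the $\hbar$-adic algebra generated by $X_{mm'}$, $m,m'\in\{-\frac12,+\frac12\}=\{-,+\}$, written $a=X_{--}$, $b=X_{-+}$, $c=X_{+-}$, $d=X_{++}$, with relations $ab=qba$, $ac=qca$, $bd=qdb$, $cd=qdc$, $bc=cb$, $ad-da=(q-q^{-1})bc$. It is a $\mathcal{U}_\hbar(\mathrm{so}_4)$-module algebra by $(g\otimes g')\triangleright X_{mm'}=\sum_{n,n'}X_{nn'}\,\rho_\hbar^{1/2}(g)^{n}{}_m\,\rho_\hbar^{1/2}(g')^{n'}{}_{m'}$. The quantum determinant $\mathrm{det}_q:=ad-qbc$ is central and scalar (invariant). For $j\in\frac12\mathbb{N}_0$, $m,m'\in\{-j,\dots,j\}$, $T^{(j,j)}_{mm'}$ are the elements determined by $T^{(j,j)}_{jj}=d^{2j}$ (product of $M_\hbar(2)$) and $(g\otimes g')\triangleright T^{(j,j)}_{mm'}=\sum_{n,n'}T^{(j,j)}_{nn'}\,\rho^j_\hbar(g)^n{}_m\,\rho^j_\hbar(g')^{n'}{}_{m'}$; the elements $\mathrm{det}_q^k\,T^{(j,j)}_{mm'}$, $k\in\mathbb{N}_0$, form a ($\hbar$-adic)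 basis of $M_\hbar(2)$. In the limit $\hbar\to0$ one has $\mathrm{det}=ad-bc$, $T'^{(j,j)}_{mm'}=\lim_{\hbar\to0}T^{(j,j)}_{mm'}$ in $\mathcal{X}=\mathbb{C}[a,b,c,d]$. Quantum Minkowski space $\mathcal{X}_\hbar(\mathbb{R}^{1,3})$ is the $\mathcal{U}_\hbar(\mathrm{sl}_2(\mathbb{C}))$-module algebra obtained from $M_\hbar(2)$ by keeping the underlying module and action and twisting the product by $\mathcal{R}_{23}^{-1}$: $\mu_\hbar(x\otimes y)=\mu_{M_\hbar(2)}(\mathcal{R}_{23}\triangleright[x\otimes y])$, where $\mu_{M_\hbar(2)}$ is the product of $M_\hbar(2)$. $(\mathcal{U}(\mathrm{su}_2)\otimes\mathcal{U}(\mathrm{su}_2))[[\hbar]]$ acts on $\mathcal{X}[[\hbar]]$ by $(g\otimes g')\triangleright(\mathrm{det}^k\,T'^{(j,j)}_{mm'})=\sum_{n,n'}\mathrm{det}^k\,T'^{(j,j)}_{nn'}\,\rho^j(g)^n{}_m\,\rho^j(g')^{n'}{}_{m'}$ (Lie algebra elements act as derivations). Subscripts $13$, $24$, $23$ denote tensor legs in $\mathcal{U}(\mathrm{su}_2)^{\otimes4}[[\hbar]]$, which acts on $(\mathcal{X}\otimes\mathcal{X})[[\hbar]]$ with legs 1,2 on the first factor and legs 3,4 on the second. *)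

(* Defs.v *)
From HB Require Import structures.
From mathcomp Require Import all_boot all_order all_algebra.
From mathcomp Require Import boolp reals.
From mathcomp Require Import complex mpoly.

Set Implicit Arguments.
Unset Strict Implicit.
Unset Printing Implicit Defensive.

Import Order.TTheory GRing.Theory Num.Theory.
Local Open Scope ring_scope.

(* "The x such that P x": in every use below x is unique, and x0 is only the
   value when there is no such x. *)
Definition the (T : Type) (x0 : T) (P : T -> Prop) : T :=
  if pselect (exists x, P x) is left exP then projT1 (cid exP) else x0.

(* {series A} is A[[h]].  A wrapper is needed because nat -> A itself carries
   the pointwise product. *)
Record series (A : Type) := Series { cf : nat -> A }.
Add Printing Constructor series.
Notation "{ 'series' A }" := (series A) (format "{ 'series'  A }").

Lemma seriesP A (a b : {series A}) : (forall n, cf a n = cf b n) -> a = b.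
Proof.
by case: a b => a [b] /= eq_ab; congr Series; apply: functional_extensionality_dep.
Qed.

HB.instance Definition _ (A : Type) := gen_eqMixin {series A}.
HB.instance Definition _ (A : Type) := gen_choiceMixin {series A}.

Section SeriesZmod.
Context (V : zmodType).
Implicit Types a b : {series V}.

Definition series_zero : {series V} := Series (fun _ => 0).
Definition series_opp a : {series V} := Series (fun n => - cf a n).
Definition series_add a b : {series V} := Series (fun n => cf a n + cf b n).

Fact series_addA : associative series_add.
Proof. by move=> a b c; apply: seriesP => n /=; rewrite addrA. Qed.
Fact series_addC : commutative series_add.
Proof. by move=> a b; apply: seriesP => n /=; rewrite addrC. Qed.
Fact series_add0 : left_id series_zero series_add.
Proof. by move=> a; apply: seriesP => n /=; rewrite add0r. Qed.
Fact series_addN : left_inverse series_zero series_opp series_add.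
Proof. by move=> a; apply: seriesP => n /=; rewrite addNr. Qed.

HB.instance Definition _ := GRing.isZmodule.Build {series V}
  series_addA series_addC series_add0 series_addN.
End SeriesZmod.

Section SeriesRing.
Context (A : nzRingType).
Implicit Types a b c : {series A}.

Definition series_const (x : A) : {series A} :=
  Series (fun n => if n is 0 then x else 0).
Definition series_mul a b : {series A} :=
  Series (fun n => \sum_(i < n.+1) cf a i * cf b (n - i)%N).

Let tr n a : {poly A} := \poly_(i < n.+1) cf a i.

Let tr_coef n a i : (i <= n)%N -> (tr n a)`_i = cf a i.
Proof. by move=> le_in; rewrite coef_poly ltnS le_in. Qed.

Let tr_mul n a b i : (i <= n)%N -> (tr n a * tr n b)`_i = cf (series_mul a b) i.
Proof.
move=> le_in; rewrite coefM; apply: eq_bigr => j _.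
by rewrite !tr_coef ?(leq_trans (leq_subr _ _)) // (leq_trans _ le_in) -1?ltnS.
Qed.

Fact series_mulA : associative series_mul.
Proof.
move=> a b c; apply: seriesP => n.
transitivity ((tr n a * tr n b * tr n c)`_n); last first.
  rewrite coefM; apply: eq_bigr => j _.
  by rewrite tr_mul 1?tr_coef ?leq_subr // -ltnS.
rewrite -mulrA coefM; apply: eq_bigr => j _.
by rewrite tr_mul 1?tr_coef ?leq_subr // -ltnS.
Qed.

Fact series_mul1 : left_id (series_const 1) series_mul.
Proof.
move=> a; apply: seriesP => n /=; rewrite big_ord_recl /= mul1r subn0.
by rewrite big1 ?addr0 // => i _; rewrite mul0r.
Qed.

Fact series_mulr1 : right_id (series_const 1) series_mul.
Proof.
move=> a; apply: seriesP => n /=; rewrite big_ord_recr /= subnn mulr1.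
rewrite big1 ?add0r // => i _.
by have := ltn_ord i; rewrite -subn_gt0; case: (n - i)%N => // k; rewrite mulr0.
Qed.

Fact series_mulDl : left_distributive series_mul +%R.
Proof.
move=> a b c; apply: seriesP => n /=; rewrite -big_split /=.
by apply: eq_bigr => i _; rewrite mulrDl.
Qed.

Fact series_mulDr : right_distributive series_mul +%R.
Proof.
move=> a b c; apply: seriesP => n /=; rewrite -big_split /=.
by apply: eq_bigr => i _; rewrite mulrDr.
Qed.

Fact series_const1_neq0 : series_const 1 != 0.
Proof. by apply/eqP => /(congr1 (@cf A ^~ 0%N)) /eqP; rewrite /= oner_eq0. Qed.

HB.instance Definition _ := GRing.Zmodule_isNzRing.Build {series A}
  series_mulA series_mul1 series_mulr1 series_mulDl series_mulDr
  series_const1_neq0.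
End SeriesRing.

Section SeriesComRing.
Context (K : comNzRingType).

Fact series_mulC : commutative (@GRing.mul {series K}).
Proof.
move=> a b; apply: seriesP => n /=; rewrite (reindex_inj rev_ord_inj) /=.
apply: eq_bigr => i _; rewrite subSS mulrC subKn //; exact: ltn_ord i.
Qed.

HB.instance Definition _ :=
  GRing.PzRing_hasCommutativeMul.Build {series K} series_mulC.
End SeriesComRing.

Section SeriesAlg.
Context (K : comNzRingType) (A : algType K).
Implicit Types (c d : {series K}) (a b : {series A}).

Definition series_scale c a : {series A} :=
  Series (fun n => \sum_(i < n.+1) cf c i *: cf a (n - i)%N).

Let emb c : {series A} := Series (fun n => (cf c n)%:A).

Let scaleE c a : series_scale c a = emb c * a.
Proof. by apply: seriesP => n; apply: eq_bigr => i _; rewrite mulr_algl. Qed.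

Let embM c d : emb (c * d) = emb c * emb d.
Proof.
apply: seriesP => n /=; rewrite scaler_suml; apply: eq_bigr => i _.
by rewrite mulr_algl scalerA.
Qed.

Let emb_comm c a : emb c * a = a * emb c.
Proof.
apply: seriesP => n /=; rewrite (reindex_inj rev_ord_inj) /=.
apply: eq_bigr => i _.
rewrite subSS mulr_algl mulr_algr subKn //; exact: ltn_ord i.
Qed.

Fact series_scaleA c d a :
  series_scale c (series_scale d a) = series_scale (c * d) a.
Proof. by rewrite !scaleE embM mulrA. Qed.
Fact series_scale1 : left_id 1 series_scale.
Proof.
move=> a; rewrite scaleE -[RHS]mul1r; congr (_ * _); apply: seriesP => -[|n] /=.
  by rewrite scale1r.
by rewrite scale0r.
Qed.
Fact series_scaleDr : right_distributive series_scale +%R.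
Proof. by move=> c a b; rewrite !scaleE mulrDr. Qed.
Fact series_scaleDl a : {morph series_scale^~ a : c d / c + d}.
Proof.
move=> c d; rewrite !scaleE -mulrDl; congr (_ * _).
by apply: seriesP => n /=; rewrite scalerDl.
Qed.

HB.instance Definition _ := GRing.Zmodule_isLmodule.Build {series K} {series A}
  series_scaleA series_scale1 series_scaleDr series_scaleDl.

Fact series_scaleAl c a b : c *: (a * b) = (c *: a) * b.
Proof. by rewrite /GRing.scale /= !scaleE mulrA. Qed.
HB.instance Definition _ :=
  GRing.Lmodule_isLalgebra.Build {series K} {series A} series_scaleAl.

Fact series_scaleAr c a b : c *: (a * b) = a * (c *: b).
Proof. by rewrite /GRing.scale /= !scaleE !mulrA emb_comm. Qed.
HB.instance Definition _ :=
  GRing.Lalgebra_isAlgebra.Build {series K} {series A} series_scaleAr.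
End SeriesAlg.

Definition series_map (A B : Type) (f : A -> B) (a : {series A}) : {series B} :=
  Series (fun n => f (cf a n)).

Definition hvar (K : nzRingType) : {series K} := Series (fun n => (n == 1)%:R).

(* The quotient a / b, for b dividing a in K[[h]]; b need not be a unit. *)
Definition series_div (K : comNzRingType) (a b : {series K}) : {series K} :=
  the 0 (fun c => c * b = a).

(* For [a][b] with a, b > 0 the condition on the constant term picks the root
   that deforms the positive square root of a b. *)
Definition series_sqrt (K : numDomainType) (a : {series K}) : {series K} :=
  the 0 (fun s => s * s = a /\ 0 <= cf s 0).

(* q^r = e^(r h), where q = e^h. *)
Definition qpow (K : fieldType) (r : K) : {series K} :=
  Series (fun k => r ^+ k / k`!%:R).

Definition qdiff (K : fieldType) : {series K} := qpow 1 - qpow (- 1).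

Definition qint (K : fieldType) (n : nat) : {series K} :=
  series_div (qpow n%:R - qpow (- n%:R)) (qdiff K).

Definition qfact (K : fieldType) (n : nat) : {series K} :=
  \prod_(1 <= i < n.+1) qint K i.

Section Hadic.
Context (K : comNzRingType).
Implicit Types V : lmodType {series K}.

Definition hcong V (N : nat) (x y : V) : Prop :=
  exists z, x - y = hvar K ^+ N *: z.

Definition hcvg V (u : nat -> V) (s : V) : Prop :=
  forall N, exists n0, forall n, (n0 <= n)%N -> hcong N (u n) s.

Definition hcauchy V (u : nat -> V) : Prop :=
  forall N, exists n0, forall m n,
    (n0 <= m)%N -> (n0 <= n)%N -> hcong N (u m) (u n).

Definition hadic V : Prop :=
  (forall x : V, (forall N, hcong N x 0) -> x = 0) /\
  (forall u : nat -> V, hcauchy u -> exists s, hcvg u s).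

Definition hsum V (u : nat -> V) : V :=
  the 0 (hcvg (fun n => \sum_(k < n) u k)).

Definition bilin (U V W : lmodType {series K}) (f : U -> V -> W) : Prop :=
  (forall u, linear (f u)) /\ (forall v, linear (f^~ v)).
End Hadic.

Definition alg_hom (S : comNzRingType) (A B : algType S) (f : A -> B) : Prop :=
  linear f /\ monoid_morphism f.

(* e^(c h x), for h the formal variable. *)
Definition hexp (K : fieldType) (A : algType {series K}) (c : K) (x : A) : A :=
  hsum (fun k => (series_const (c ^+ k / k`!%:R) * hvar K ^+ k) *: x ^+ k).

Definition inverse (A : nzRingType) (x : A) : A :=
  the 0 (fun y => y * x = 1 /\ x * y = 1).

Definition invertible (A : nzRingType) (x : A) : Prop :=
  exists y, y * x = 1 /\ x * y = 1.

Definition inverse_map (A : Type) (B : nzRingType) (f : B -> A) (y : A) : B :=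
  the 0 (fun x => f x = y).

(* The completed tensor product of two h-adic algebras, given by its universal
   property among h-adic modules.  For complex algebras U and V, the completed
   tensor product of U[[h]] and V[[h]] is (U (x) V)[[h]]. *)
Record ctensor (K : comNzRingType) (A B : algType {series K}) := CTensor {
  ct_alg :> algType {series K};
  ct_hadic : hadic ct_alg;
  tens : A -> B -> ct_alg;
  tens_bilin : bilin tens;
  tens_one : tens 1 1 = 1;
  tens_mul : forall a a' b b', tens a b * tens a' b' = tens (a * a') (b * b');
  ct_universal : forall (Q : lmodType {series K}) (f : A -> B -> Q),
    hadic Q -> bilin f ->
    exists! phi : ct_alg -> Q,
      linear phi /\ forall a b, phi (tens a b) = f a b
}.
Arguments tens {K A B} c a b.

Section Tensor.
Context (K : comNzRingType).
Implicit Types A B V : algType {series K}.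

Definition ct_lift A B (AB : ctensor A B) (Q : lmodType {series K})
    (f : A -> B -> Q) : AB -> Q :=
  the (fun=> 0) (fun phi : AB -> Q =>
    linear phi /\ forall a b, phi (tens AB a b) = f a b).

Definition ct_map A B A' B' (AB : ctensor A B) (AB' : ctensor A' B')
    (f : A -> A') (g : B -> B') : AB -> AB' :=
  ct_lift (fun a b => tens AB' (f a) (g b)).

Definition ct_mult A (AA : ctensor A A) : AA -> A := ct_lift (fun x y => x * y).

(* The legs 13, 24, 23 of an element of A (x) A in
   A (x) A (x) A (x) A = (A (x) A) (x) (A (x) A). *)
Section Legs.
Context A (AA : ctensor A A) (A4 : ctensor AA AA).
Definition leg13 : AA -> A4 :=
  ct_lift (fun a b => tens A4 (tens AA a 1) (tens AA b 1)).
Definition leg24 : AA -> A4 :=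
  ct_lift (fun a b => tens A4 (tens AA 1 a) (tens AA 1 b)).
Definition leg23 : AA -> A4 :=
  ct_lift (fun a b => tens A4 (tens AA 1 a) (tens AA b 1)).
End Legs.

(* The action of A (x) A on V (x) V induced by an action of A on V. *)
Definition ct_act A V (AA : ctensor A A) (VV : ctensor V V)
    (act : A -> V -> V) (u : AA) (z : VV) : VV :=
  ct_lift (fun a b => ct_lift (fun x y => tens VV (act a x) (act b y)) z) u.
End Tensor.
Arguments ct_lift {K A B} AB {Q} f.
Arguments ct_map {K A B A' B'} AB AB' f g.
Arguments ct_mult {K A} AA.
Arguments leg13 {K A AA} A4.
Arguments leg24 {K A AA} A4.
Arguments leg23 {K A AA} A4.
Arguments ct_act {K A V AA VV} act u z.

Definition su2_rel (S : comNzRingType) (A : algType S) (e h f : A) : Prop :=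
  [/\ h * e - e * h = e *+ 2, h * f - f * h = - (f *+ 2) & e * f - f * e = h].

Record su2_env (K : comNzRingType) := Su2Env {
  su2_alg :> algType K;
  UE : su2_alg;
  UH : su2_alg;
  UF : su2_alg;
  su2_relations : su2_rel UE UH UF;
  su2_universal : forall (B : algType K) (e h f : B), su2_rel e h f ->
    exists! phi : su2_alg -> B,
      [/\ alg_hom phi, phi UE = e, phi UH = h & phi UF = f]
}.
Arguments UE {K} s.
Arguments UH {K} s.
Arguments UF {K} s.

(* The relation for [E,F] is stated after cancelling h from the numerator and
   from the denominator: (q - q^-1)/h is a unit of K[[h]], and
   (e^(hH) - e^(-hH))/h is the series in the last clause. *)
Definition qsu2_rel (K : fieldType) (A : algType {series K}) (e h f : A) : Prop :=
  [/\ h * e - e * h = e *+ 2, h * f - f * h = - (f *+ 2)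
    & series_div (qdiff K) (hvar K) *: (e * f - f * e) =
      hsum (fun k => (series_const k.+1`!%:R^-1 * hvar K ^+ k) *:
                     (h ^+ k.+1 - (- h) ^+ k.+1))].

Record qsu2_env (K : fieldType) := QSu2Env {
  qsu2_alg :> algType {series K};
  qsu2_hadic : hadic qsu2_alg;
  QE : qsu2_alg;
  QH : qsu2_alg;
  QF : qsu2_alg;
  qsu2_relations : qsu2_rel QE QH QF;
  qsu2_universal : forall (B : algType {series K}) (e h f : B),
    hadic B -> qsu2_rel e h f ->
    exists! phi : qsu2_alg -> B,
      [/\ alg_hom phi, phi QE = e, phi QH = h & phi QF = f]
}.
Arguments QE {K} q.
Arguments QH {K} q.
Arguments QF {K} q.

Section HopfStructures.
Context (K : fieldType).

Definition su2_hom (U : su2_env K) (B : algType K) (e h f : B) : U -> B :=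
  the (fun=> 0) (fun phi : U -> B =>
    [/\ alg_hom phi, phi (UE U) = e, phi (UH U) = h & phi (UF U) = f]).

Definition hsu2_hom (U : su2_env K) (B : algType {series K}) (e h f : B) :
    {series U} -> B :=
  the (fun=> 0) (fun phi : {series U} -> B =>
    [/\ alg_hom phi, phi (series_const (UE U)) = e,
        phi (series_const (UH U)) = h & phi (series_const (UF U)) = f]).

Definition qsu2_hom (Uh : qsu2_env K) (B : algType {series K}) (e h f : B) :
    Uh -> B :=
  the (fun=> 0) (fun phi : Uh -> B =>
    [/\ alg_hom phi, phi (QE Uh) = e, phi (QH Uh) = h & phi (QF Uh) = f]).

Definition su2_cop (U : su2_env K) (UU : ctensor {series U} {series U}) :
    {series U} -> UU :=
  let prim x := tens UU (series_const x) 1 + tens UU 1 (series_const x) in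
  hsu2_hom (prim (UE U)) (prim (UH U)) (prim (UF U)).

Definition su2_counit (U : su2_env K) : {series U} -> {series K} :=
  hsu2_hom (B := {series K}^o) 0 0 0.

Definition qsu2_cop (Uh : qsu2_env K) (UhUh : ctensor Uh Uh) : Uh -> UhUh :=
  qsu2_hom
    (tens UhUh (QE Uh) (hexp 1 (QH Uh)) + tens UhUh 1 (QE Uh))
    (tens UhUh (QH Uh) 1 + tens UhUh 1 (QH Uh))
    (tens UhUh (QF Uh) 1 + tens UhUh (hexp (- 1) (QH Uh)) (QF Uh)).

Definition qsu2_counit (Uh : qsu2_env K) : Uh -> {series K} :=
  qsu2_hom (B := {series K}^o) 0 0 0.

Definition Rmatrix (Uh : qsu2_env K) (UhUh : ctensor Uh Uh) : UhUh :=
  hexp 2^-1 (tens UhUh (QH Uh) (QH Uh)) *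
  hsum (fun n => (qpow (n%:R * (n%:R - 1) / 2) *
                  series_div (qdiff K ^+ n) (qfact K n)) *:
                 tens UhUh (QE Uh ^+ n) (QF Uh ^+ n)).

(* U_h(so4) is Uh (x) Uh; its tensor product coproduct sends g (x) g' to
   g1 (x) g'1 (x) g2 (x) g'2. *)
Definition so4_cop (Uh : qsu2_env K) (UhUh : ctensor Uh Uh)
    (Uh4 : ctensor UhUh UhUh) : UhUh -> Uh4 :=
  ct_lift UhUh
    (fun g g' => leg13 Uh4 (qsu2_cop UhUh g) * leg24 Uh4 (qsu2_cop UhUh g')).

Definition so4_counit (Uh : qsu2_env K) (UhUh : ctensor Uh Uh) :
    UhUh -> {series K} :=
  ct_lift UhUh (Q := {series K}^o)
    (fun g g' => qsu2_counit g * qsu2_counit g').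
End HopfStructures.

(* Spin j is encoded by n = 2 j, and the weight m in {-j, ..., j} by the
   ordinal i = j + m : 'I_n.+1, so that m = i - n/2 and j - m = n - i. *)

Section Spin.
Context (K : numFieldType).

Definition weight (n i : nat) : K := i%:R - n%:R / 2.

Definition spinE n : 'M[{series K}]_n.+1 :=
  \matrix_(k, i) if k == i.+1 :> nat
    then qpow (weight n i + 1) * series_sqrt (qint K i.+1 * qint K (n - i))
    else 0.

Definition spinF n : 'M[{series K}]_n.+1 :=
  \matrix_(k, i) if k.+1 == i :> nat
    then qpow (- weight n i) * series_sqrt (qint K i * qint K (n - i).+1)
    else 0.

Definition spinH n : 'M[{series K}]_n.+1 :=
  \matrix_(k, i) if k == i then series_const (2 * weight n i) else 0.

Definition qspin (Uh : qsu2_env K) n : Uh -> 'M[{series K}]_n.+1 :=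
  qsu2_hom (spinE n) (spinH n) (spinF n).

Definition at_h0 n (A : 'M[{series K}]_n) : 'M[K]_n :=
  map_mx (fun c => cf c 0) A.

Definition spin0 (U : su2_env K) n : U -> 'M[K]_n.+1 :=
  su2_hom (at_h0 (spinE n)) (at_h0 (spinH n)) (at_h0 (spinF n)).

Definition spin (U : su2_env K) n (x : {series U}) : 'M[{series K}]_n.+1 :=
  \matrix_(k, i) Series (fun t => spin0 n (cf x t) k i).
End Spin.
Arguments qspin {K Uh} n.
Arguments spin {K U} n.

(* The matrix coefficient <k1, k2| (rho_n1 (x) rho_n2)(u) |i1, i2>. *)
Definition tens_coef (K : comNzRingType) (A : algType {series K})
    (AA : ctensor A A) (rho : forall n, A -> 'M[{series K}]_n.+1) n1 n2
    (k1 : 'I_n1.+1) (k2 : 'I_n2.+1) (i1 : 'I_n1.+1) (i2 : 'I_n2.+1) :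
    AA -> {series K} :=
  ct_lift AA (Q := {series K}^o) (fun a b => rho n1 a k1 i1 * rho n2 b k2 i2).

Section ClebschGordan.

(* |j1 - j2| <= j <= j1 + j2 in integer steps. *)
Definition CG_admissible (n1 n2 n : nat) : bool :=
  [&& n1 <= n2 + n, n2 <= n1 + n, n <= n1 + n2 & ~~ odd (n1 + n2 + n)]%N.

(* C n1 n2 n i1 i2 i is C(j1,m1;j2,m2|j,m). *)
Definition CG_family (S : Type) :=
  forall n1 n2 n : nat, 'I_n1.+1 -> 'I_n2.+1 -> 'I_n.+1 -> S.

Definition CG_orthogonal (S : comNzRingType) (C : CG_family S) : Prop :=
  forall n1 n2,
  (forall n n' (i : 'I_n.+1) (i' : 'I_n'.+1),
     CG_admissible n1 n2 n -> CG_admissible n1 n2 n' ->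
     \sum_(i1 < n1.+1) \sum_(i2 < n2.+1) C n1 n2 n i1 i2 i * C n1 n2 n' i1 i2 i'
     = ((n == n') && (i == i' :> nat))%:R) /\
  (forall (i1 k1 : 'I_n1.+1) (i2 k2 : 'I_n2.+1),
     \sum_(n < (n1 + n2).+1 | CG_admissible n1 n2 n) \sum_(i < n.+1)
       C n1 n2 n i1 i2 i * C n1 n2 n k1 k2 i
     = ((i1 == k1) && (i2 == k2))%:R).

Definition CG_intertwines (K : comNzRingType) (A : algType {series K})
    (AA : ctensor A A) (rho : forall n, A -> 'M[{series K}]_n.+1)
    (cop : A -> AA) (C : CG_family {series K}) : Prop :=
  forall n1 n2 n, CG_admissible n1 n2 n ->
  forall (g : A) (k1 : 'I_n1.+1) (k2 : 'I_n2.+1) (i : 'I_n.+1),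
    \sum_(i1 < n1.+1) \sum_(i2 < n2.+1)
      tens_coef rho k1 k2 i1 i2 (cop g) * C n1 n2 n i1 i2 i
    = \sum_(k < n.+1) C n1 n2 n k1 k2 k * rho n g k i.

Context (R : realType) (U : su2_env R[i]) (UU : ctensor {series U} {series U}).

(* The last clause is the Condon-Shortley phase C(j1,j1;j2,j-j1|j,j) > 0. *)
Definition is_CG (C : CG_family R) : Prop :=
  [/\ CG_intertwines (@spin _ U) (su2_cop UU)
        (fun n1 n2 n i1 i2 i => series_const (real_complex R (C n1 n2 n i1 i2 i))),
      CG_orthogonal C
    & forall n1 n2 n, CG_admissible n1 n2 n ->
      forall i2 : 'I_n2.+1, (n1 + i2.*2 = n2 + n)%N ->
      0 < C n1 n2 n ord_max i2 ord_max].

Definition is_qCG (Uh : qsu2_env R[i]) (UhUh : ctensor Uh Uh)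
    (C : CG_family R) (Cq : CG_family {series R}) : Prop :=
  [/\ CG_intertwines (@qspin _ Uh) (qsu2_cop UhUh)
        (fun n1 n2 n i1 i2 i => series_map (real_complex R) (Cq n1 n2 n i1 i2 i)),
      CG_orthogonal Cq
    & forall n1 n2 n, CG_admissible n1 n2 n ->
      forall i1 i2 i, cf (Cq n1 n2 n i1 i2 i) 0 = C n1 n2 n i1 i2 i].
End ClebschGordan.

Section Twists.
Context (R : realType).
Local Notation K := R[i].
Context (U : su2_env K) (UU : ctensor {series U} {series U}).
Context (Uh : qsu2_env K) (UhUh : ctensor Uh Uh).

(* An involution of an h-adic algebra, with h real, taking the given values on
   the generators e, h, f. *)
Definition is_star (A : algType {series K}) (e h f e' h' f' : A)
    (s : A -> A) : Prop :=
  [/\ forall c x y, s (c *: x + y) = series_map Num.conj c *: s x + s y,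
      forall x y, s (x * y) = s y * s x,
      forall x, s (s x) = x
    & [/\ s e = e', s h = h' & s f = f']].

Definition su2_star : {series U} -> {series U} :=
  let: (e, h, f) :=
    (series_const (UE U), series_const (UH U), series_const (UF U)) in
  the id (is_star e h f f h e).

Definition qsu2_star : Uh -> Uh :=
  the id (is_star (QE Uh) (QH Uh) (QF Uh)
    (QF Uh * hexp 1 (QH Uh)) (QH Uh) (hexp (- 1) (QH Uh) * QE Uh)).

(* [alpha = id + O(h)] refers to the identification of Uh / h Uh with U given
   by the generators; alpha being a homomorphism, it is a condition on them. *)
Definition is_alpha (alpha : Uh -> {series U}) : Prop :=
  [/\ alg_hom alpha /\ bijective alpha,
      forall x, alpha (qsu2_star x) = su2_star (alpha x),
      hcong 1 (alpha (QE Uh)) (series_const (UE U)) /\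
      hcong 1 (alpha (QF Uh)) (series_const (UF U)),
      alpha (QH Uh) = series_const (UH U)
    & forall n x, qspin n x = spin n (alpha x)].

Definition cop_h (alpha : Uh -> {series U}) (g : {series U}) : UU :=
  ct_map UhUh UU alpha alpha (qsu2_cop UhUh (inverse_map alpha g)).

Definition is_Drinfeld_twist (alpha : Uh -> {series U}) (F : UU) : Prop :=
  [/\ invertible F,
      forall g, cop_h alpha g = F * su2_cop UU g * inverse F,
      ct_lift UU (fun a b => su2_counit a *: b) F = 1
    & ct_lift UU (fun a b => su2_counit b *: a) F = 1].

Definition is_standard_twist (alpha : Uh -> {series U}) (C : CG_family R)
    (Cq : CG_family {series R}) (F : UU) : Prop :=
  is_Drinfeld_twist alpha F /\
  forall n1 n2 (k1 i1 : 'I_n1.+1) (k2 i2 : 'I_n2.+1),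
    tens_coef (@spin _ U) k1 k2 i1 i2 F =
    \sum_(n < (n1 + n2).+1 | CG_admissible n1 n2 n) \sum_(i < n.+1)
      series_map (real_complex R) (Cq n1 n2 n k1 k2 i) *
      series_const (real_complex R (C n1 n2 n i1 i2 i)).

(* R as an element of (U (x) U)[[h]]. *)
Definition Rmatrix_U (alpha : Uh -> {series U}) : UU :=
  ct_map UhUh UU alpha alpha (Rmatrix UhUh).

Definition F_sl2 (U4 : ctensor UU UU) (alpha : Uh -> {series U}) (Fs : UU) : U4 :=
  leg23 U4 (inverse (Rmatrix_U alpha)) * leg13 U4 Fs * leg24 U4 Fs.
End Twists.
Arguments F_sl2 {R U UU Uh} UhUh U4 alpha Fs.

(* The generator X m m' is X_{mm'}, with index 0 for - and 1 for +. *)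
Definition M2_rel (K : fieldType) (A : algType {series K})
    (X : 'I_2 -> 'I_2 -> A) : Prop :=
  let: (a, b, c, d) := (X 0 0, X 0 1, X 1 0, X 1 1) in
  let q : {series K} := qpow 1 in
  [/\ a * b = q *: (b * a) /\ a * c = q *: (c * a),
      b * d = q *: (d * b) /\ c * d = q *: (d * c),
      b * c = c * b
    & a * d - d * a = qdiff K *: (b * c)].

Record M2_space (K : fieldType) := M2Space {
  M2_alg :> algType {series K};
  M2_hadic : hadic M2_alg;
  MX : 'I_2 -> 'I_2 -> M2_alg;
  M2_relations : M2_rel MX;
  M2_universal : forall (B : algType {series K}) (X : 'I_2 -> 'I_2 -> B),
    hadic B -> M2_rel X ->
    exists! phi : M2_alg -> B,
      alg_hom phi /\ forall m m', phi (MX m m') = X m m'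
}.
Arguments MX {K} m _ _.

Section Minkowski.
Context (R : realType).
Local Notation K := R[i].
Local Notation X := {mpoly K[4]}.
Context (U : su2_env K) (UU : ctensor {series U} {series U}).
Context (Uh : qsu2_env K) (UhUh : ctensor Uh Uh) (Uh4 : ctensor UhUh UhUh).
Context (M : M2_space K) (MM : ctensor M M).

Definition det_q : M :=
  MX M 0 0 * MX M 1 1 - (qpow 1 : {series K}) *: (MX M 0 1 * MX M 1 0).

(* 'X_0, 'X_1, 'X_2, 'X_3 are a, b, c, d. *)
Definition Xgen (m m' : 'I_2) : X := 'X_(inord (2 * m + m')%N).

Definition det0 : X := Xgen 0 0 * Xgen 1 1 - Xgen 0 1 * Xgen 1 0.

Definition is_M2_action (act : UhUh -> M -> M) : Prop :=
  [/\ bilin act,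
      forall u v x, act (u * v) x = act u (act v x),
      forall x, act 1 x = x,
      forall u, act u 1 = so4_counit u *: 1 /\
        forall x y, act u (x * y) =
          ct_mult MM (ct_act act (so4_cop Uh4 u) (tens MM x y))
    & forall g g' m m', act (tens UhUh g g') (MX M m m') =
        \sum_(k < 2) \sum_(k' < 2)
          (qspin 1 g k m * qspin 1 g' k' m') *: MX M k k'].

(* T n i i' is T^(j,j)_{mm'}. *)
Definition is_T (act : UhUh -> M -> M)
    (T : forall n, 'I_n.+1 -> 'I_n.+1 -> M) : Prop :=
  forall n,
  T n ord_max ord_max = MX M 1 1 ^+ n /\
  forall g g' (i i' : 'I_n.+1), act (tens UhUh g g') (T n i i') =
    \sum_(k < n.+1) \sum_(k' < n.+1)
      (qspin n g k i * qspin n g' k' i') *: T n k k'.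

(* The limit h -> 0, i.e. the quotient map of M onto M / h M = C[a,b,c,d]. *)
Definition h_limit : M -> X :=
  the (fun=> 0) (fun p : M -> X =>
    [/\ forall c x y, p (c *: x + y) = cf c 0 *: p x + p y,
        monoid_morphism p
      & forall m m', p (MX M m m') = Xgen m m']).

Definition is_X_action (T : forall n, 'I_n.+1 -> 'I_n.+1 -> M)
    (act : UU -> {series X} -> {series X}) : Prop :=
  let T' n (i i' : 'I_n.+1) : X := h_limit (T n i i') in
  bilin act /\
  forall (g g' : {series U}) k n (i i' : 'I_n.+1),
    act (tens UU g g') (series_const (det0 ^+ k * T' n i i')) =
    \sum_(p < n.+1) \sum_(p' < n.+1)
      (spin n g p i * spin n g' p' i') *: series_const (det0 ^+ k * T' n p p').

(* The identification of X[[h]] with the module underlying quantum Minkowski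
   space, that is, with M. *)
Definition is_identification (T : forall n, 'I_n.+1 -> 'I_n.+1 -> M)
    (Phi : {series X} -> M) : Prop :=
  [/\ linear Phi, bijective Phi
    & forall k n (i i' : 'I_n.+1),
        Phi (series_const (det0 ^+ k * h_limit (T n i i'))) =
        det_q ^+ k * T n i i'].

Definition Minkowski_mult (act : UhUh -> M -> M) (z : MM) : M :=
  ct_mult MM (ct_act act (leg23 Uh4 (Rmatrix UhUh)) z).

Definition mu_h (act : UhUh -> M -> M) (Phi : {series X} -> M)
    (XX : ctensor {series X} {series X}) (z : XX) : {series X} :=
  inverse_map Phi (Minkowski_mult act (ct_map XX MM Phi Phi z)).
End Minkowski.
Arguments is_M2_action {R Uh UhUh} Uh4 {M} MM act.
Arguments mu_h {R Uh UhUh} Uh4 {M} MM act Phi {XX} z.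

(* Main.v *)
(** Evaluation at the generic scalar matrix, a = d = X and b = c = 0, is an algebra
    homomorphism eps from M_h(2), and it maps T^(j,j)_{mm'} to X^{2j} delta_{mm'}:
    eps exchanges the two commuting actions up to the anti-automorphism of
    U_h(su2) whose effect in the spin representations is transposition.  An
    element w of M_h(2) is determined by the values eps((g (x) 1) w): modulo h,
    their vanishing says that the polynomial w has zero jets, first in the sl2
    directions along the scalar matrices, then, by the Euler field and Cramer's
    rule, in all directions.

    Orthogonality of the q-Clebsch-Gordan coefficients then gives
      T^(j1) T^(j2) = sum_j C_q C_q det_q^(j1+j2-j) T^(j)
    exactly, without any multiplicity or normalization constants, as both sides
    have the same values under eps.  Its limit h -> 0 shows that the elements
    det^k T'^(j) span C[a,b,c,d].  Comparing the deformed and the undeformed product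
    formula on this basis, the standard twist, whose matrix elements are
    sum C_q C, turns the product of X into the product of M_h(2); the R-matrix
    enters both sides in the same way. *)

Require Import Defs.
From HB Require Import structures.
From mathcomp Require Import all_boot all_order all_algebra.
From mathcomp Require Import boolp reals.
From mathcomp Require Import complex mpoly.
From mathcomp Require Import ring.

Set Implicit Arguments.
Unset Strict Implicit.
Unset Printing Implicit Defensive.

Import GRing.Theory.
Local Open Scope ring_scope.

(** * h-adic modules and formal power series *)

(** All algebras are given by universal properties only, so no basis is at hand and h-torsion could
    a priori occur. Torsion-freeness of U_h(su2) and of M_h(2) is imported along [alpha] and [Phi],
    and identities are proved by density: a closed subalgebra containing the generators is itself
    h-adic, so the universal property applies to it. The coproduct, the spin representations and the
    limit are descriptions with default 0. Each is shown to exist because the default would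
    contradict a hypothesis, for instance that 1 acts as the identity. The square roots in the spin
    representations are not evaluated either: that the coefficients of E and F do not vanish modulo
    h is read off from [E,F] = H.

    The order of the deductions avoids a circle. Vanishing under eps first gives the product formula
    only modulo h. This yields the spanning statement, hence that the limit of [Phi s] is the
    constant coefficient of [s]. Only then can an element with vanishing values be divided by h,
    again and again, so that it is 0. *)

Lemma theP (T : Type) (x0 : T) (P : T -> Prop) : (exists x, P x) -> P (the x0 P).
Proof. by rewrite /the => exP; case: pselect => // e; case: cid. Qed.

Lemma the_eq (T : Type) (x0 x : T) (P : T -> Prop) :
  P x -> (forall y, P y -> y = x) -> the x0 P = x.
Proof. by move=> Px uP; apply: uP; apply: theP; exists x. Qed.

(** Existence proofs below go through this dichotomy: the second case is refuted, as the default
    value contradicts a hypothesis. *)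
Lemma the_or (T : Type) (x0 : T) (P : T -> Prop) : P (the x0 P) \/ the x0 P = x0.
Proof. by rewrite /the; case: pselect => [e|]; [left; case: cid | right]. Qed.

Section LinearProp.
Context (S : pzRingType) (V W : lmodType S) (f : V -> W).
Hypothesis Hf : linear f.

Lemma lin0 : f 0 = 0.
Proof.
have := Hf (-1) 0 0.
by rewrite scaleN1r oppr0 addr0 scaleN1r addNr.
Qed.
Lemma linD x y : f (x + y) = f x + f y.
Proof. by have := Hf 1 x y; rewrite !scale1r. Qed.
Lemma linZ c x : f (c *: x) = c *: f x.
Proof. by have := Hf c x 0; rewrite lin0 !addr0. Qed.
Lemma linN x : f (- x) = - f x.
Proof. by rewrite -scaleN1r linZ scaleN1r. Qed.
Lemma linB x y : f (x - y) = f x - f y.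
Proof. by rewrite linD linN. Qed.
Lemma lin_sum I r (P : pred I) F :
  f (\sum_(i <- r | P i) F i) = \sum_(i <- r | P i) f (F i).
Proof. exact: (big_morph f linD lin0). Qed.
Lemma linMn x n : f (x *+ n) = f x *+ n.
Proof. by elim: n => [|n IH]; rewrite ?mulr0n ?lin0 // !mulrS linD IH. Qed.
End LinearProp.

Section Linears.
Context (S : pzRingType).
Implicit Types U V W : lmodType S.

Lemma lin_id V : linear (@id V). Proof. by []. Qed.
Lemma lin_zero V W : linear (fun _ : V => 0 : W).
Proof. by move=> c x y; rewrite scaler0 addr0. Qed.
Lemma lin_comp U V W (f : V -> W) (g : U -> V) :
  linear f -> linear g -> linear (fun x => f (g x)).
Proof. by move=> Hf Hg c x y; rewrite Hg Hf. Qed.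
Lemma lin_add V W (f g : V -> W) :
  linear f -> linear g -> linear (fun x => f x + g x).
Proof. by move=> Hf Hg c x y; rewrite Hf Hg scalerDr addrACA. Qed.
Lemma lin_bigsum V W I (r : seq I) (P : pred I) (F : I -> V -> W) :
  (forall i, linear (F i)) -> linear (fun x => \sum_(i <- r | P i) F i x).
Proof.
move=> HF c x y; rewrite scaler_sumr -big_split /=; apply: eq_bigr => i _.
exact: HF.
Qed.
End Linears.

Section LinearsCom.
Context (S : comPzRingType).
Lemma lin_scale (V W : lmodType S) c (f : V -> W) :
  linear f -> linear (fun x => c *: f x).
Proof. by move=> Hf d x y; rewrite Hf scalerDr !scalerA mulrC. Qed.
Lemma lin_scalel (V W : lmodType S) (f : V -> S^o) (w : W) :
  linear f -> linear (fun x => f x *: w).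
Proof. by move=> Hf d x y; rewrite Hf scalerDl scalerA. Qed.
Lemma lin_mull (V : lmodType S) (A : algType S) (a : A) (f : V -> A) :
  linear f -> linear (fun x => a * f x).
Proof. by move=> Hf c x y; rewrite Hf mulrDr scalerAr. Qed.
Lemma lin_mulr (V : lmodType S) (A : algType S) (a : A) (f : V -> A) :
  linear f -> linear (fun x => f x * a).
Proof. by move=> Hf c x y; rewrite Hf mulrDl scalerAl. Qed.
End LinearsCom.

Section Hcong.
Context (K : comNzRingType).
Implicit Types V W : lmodType {series K}.

Lemma hcong_refl V N (x : V) : hcong N x x.
Proof. by exists 0; rewrite subrr scaler0. Qed.

Lemma hcong_sym V N (x y : V) : hcong N x y -> hcong N y x.
Proof. by case=> z E; exists (- z); rewrite scalerN -E opprB. Qed.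

Lemma hcong_trans V N (y x z : V) : hcong N x y -> hcong N y z -> hcong N x z.
Proof.
by case=> a Ea [b Eb]; exists (a + b); rewrite scalerDr -Ea -Eb addrA subrK.
Qed.

Lemma hcongD V N (x y x' y' : V) :
  hcong N x y -> hcong N x' y' -> hcong N (x + x') (y + y').
Proof.
case=> a Ea [b Eb]; exists (a + b).
by rewrite scalerDr -Ea -Eb opprD addrACA.
Qed.

Lemma hcongZ V N c (x y : V) : hcong N x y -> hcong N (c *: x) (c *: y).
Proof.
by case=> a Ea; exists (c *: a); rewrite -scalerBr Ea !scalerA mulrC.
Qed.

Lemma hcong_sum V N I r (P : pred I) (F G : I -> V) :
  (forall i, hcong N (F i) (G i)) ->
  hcong N (\sum_(i <- r | P i) F i) (\sum_(i <- r | P i) G i).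
Proof.
move=> H; elim/big_rec2: _ => [|i x y _]; first exact: hcong_refl.
by move=> h; apply: hcongD.
Qed.

Lemma hcongW V M N (x y : V) : (M <= N)%N -> hcong N x y -> hcong M x y.
Proof.
move=> le_MN [z E]; exists (hvar K ^+ (N - M) *: z).
by rewrite scalerA -exprD subnKC.
Qed.

Lemma hcong_lin V W (f : V -> W) N x y :
  linear f -> hcong N x y -> hcong N (f x) (f y).
Proof. by move=> Hf [z E]; exists (f z); rewrite -(linB Hf) E (linZ Hf). Qed.

Lemma hcong_mul (A : algType {series K}) N (x y x' y' : A) :
  hcong N x y -> hcong N x' y' -> hcong N (x * x') (y * y').
Proof.
move=> hx hx'; apply: (@hcong_trans _ _ (y * x')).
  exact: (hcong_lin (lin_mulr x' (@lin_id _ A)) hx).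
exact: (hcong_lin (lin_mull y (@lin_id _ A)) hx').
Qed.

Lemma hcong0 V (x y : V) : hcong 0 x y.
Proof. by exists (x - y); rewrite expr0 scale1r. Qed.

Definition hsep V := forall x y : V, (forall N, hcong N x y) -> x = y.

Lemma hadic_sep V : hadic V -> hsep V.
Proof.
move=> [sep _] x y H; apply/eqP; rewrite -subr_eq0; apply/eqP/sep => N.
by have [z E] := H N; exists z; rewrite subr0.
Qed.

Lemma hcvg_ext V (u v : nat -> V) s : (forall n, u n = v n) -> hcvg u s -> hcvg v s.
Proof. by move=> uv us N; have [n0 H] := us N; exists n0 => n; rewrite -uv; apply: H. Qed.

Lemma hcvg_uniq V (u : nat -> V) s t : hadic V -> hcvg u s -> hcvg u t -> s = t.
Proof.
move=> /hadic_sep sep us ut; apply: sep => N.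
have [n1 H1] := us N; have [n2 H2] := ut N.
apply: (@hcong_trans _ _ (u (maxn n1 n2))).
  by apply/hcong_sym/H1; rewrite leq_maxl.
by apply/H2; rewrite leq_maxr.
Qed.

Lemma hcvg_lin V W (f : V -> W) u s :
  linear f -> hcvg u s -> hcvg (fun n => f (u n)) (f s).
Proof.
by move=> Hf us N; have [n0 H] := us N; exists n0 => n /H; apply: hcong_lin.
Qed.

Lemma hsumP V (u : nat -> V) : hadic V -> (forall k, hcong k (u k) 0) ->
  hcvg (fun n => \sum_(k < n) u k) (hsum u).
Proof.
move=> [_ cpl] small; apply: theP; apply: cpl => N; exists N => m n.
have {}small p : (N <= p)%N -> hcong N (\sum_(k < p) u k) (\sum_(k < N) u k).
  move=> le_Np; rewrite -(subnKC le_Np) big_split_ord /=.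
  rewrite -[X in hcong _ _ X]addr0; apply: hcongD; first exact: hcong_refl.
  have {2}<- : \sum_(i < p - N) (0 : V) = 0 by rewrite big1.
  apply: hcong_sum => i; apply: hcongW (small _); exact: leq_addr.
by move=> /small hm /small hn; apply: hcong_trans hm (hcong_sym hn).
Qed.

Lemma hsum_eq V (u : nat -> V) s : hadic V ->
  hcvg (fun n => \sum_(k < n) u k) s -> hsum u = s.
Proof. by move=> hV us; apply: the_eq => // t ut; apply: hcvg_uniq ut us. Qed.

Definition htorsionfree V := forall x : V, hvar K *: x = 0 -> x = 0.

Lemma htorsionfreeN V N : htorsionfree V ->
  forall x : V, hvar K ^+ N *: x = 0 -> x = 0.
Proof.
move=> tf; elim: N => [|N IH] x; first by rewrite expr0 scale1r.
by rewrite exprSr -scalerA => /IH /tf.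
Qed.

Lemma htorsionfreeI V N : htorsionfree V ->
  injective (fun x : V => hvar K ^+ N *: x).
Proof.
move=> tf x y /= /eqP; rewrite -subr_eq0 -scalerBr => /eqP /(htorsionfreeN tf).
by move/eqP; rewrite subr_eq0 => /eqP.
Qed.

(** Closed submodules for the h-adic topology. Linear maps are automatically continuous for it, so
    the locus where two of them agree is of this kind as soon as the target is separated. *)
Definition hclosed V (P : V -> Prop) :=
  [/\ P 0, forall c x y, P x -> P y -> P (c *: x + y) &
     forall x, (forall N, exists2 y, P y & hcong N x y) -> P x].

Lemma hclosed_eq V W (f g : V -> W) : hadic W -> linear f -> linear g ->
  hclosed (fun x => f x = g x).
Proof.
move=> hW Hf Hg; split; first by rewrite (lin0 Hf) (lin0 Hg).
  by move=> c x y fx fy; rewrite Hf Hg fx fy.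
move=> x H; apply: (hadic_sep hW) => N; have [y fy xy] := H N.
apply: (hcong_trans (hcong_lin Hf xy)); rewrite fy.
exact: (hcong_lin Hg (hcong_sym xy)).
Qed.

(** Closed submodules are stable under intersection; this lets the inductions below run over
    statements with universally quantified parameters. *)
Lemma hclosed_all V I (P : I -> V -> Prop) (Q : I -> Prop) :
  (forall i, Q i -> hclosed (P i)) -> hclosed (fun x => forall i, Q i -> P i x).
Proof.
move=> H; split=> [i /H[] //|c x y Px Py i Qi|x Hx i Qi].
  by have [_ PL _] := H i Qi; apply: PL; [apply: Px | apply: Py].
have [_ _ PC] := H i Qi; apply: PC => N; have [y Py xy] := Hx N.
by exists y => //; apply: Py.
Qed.
End Hcong.

Section SeriesHadic.
Definition hshift (V : zmodType) N (z : {series V}) : {series V} :=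
  Series (fun n => if (n < N)%N then 0 else cf z (n - N)).

Lemma cfD (V : zmodType) (a b : {series V}) n : cf (a + b) n = cf a n + cf b n.
Proof. by []. Qed.
Lemma cfN (V : zmodType) (a : {series V}) n : cf (- a) n = - cf a n.
Proof. by []. Qed.
Lemma cf_sum (V : zmodType) I r (P : pred I) (F : I -> {series V}) n :
  cf (\sum_(i <- r | P i) F i) n = \sum_(i <- r | P i) cf (F i) n.
Proof. exact: (big_morph (fun a => cf a n)). Qed.
Lemma cfM0 (A : nzRingType) (a b : {series A}) : cf (a * b) 0 = cf a 0 * cf b 0.
Proof. by rewrite /GRing.mul /= big_ord_recl big_ord0 addr0. Qed.

Lemma hvar_mulE (A : nzRingType) N (z : {series A}) : hvar A ^+ N * z = hshift N z.
Proof.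
elim: N z => [|N IH] z.
  by rewrite expr0 mul1r; apply: seriesP => n /=; rewrite subn0.
rewrite exprSr -mulrA IH; apply: seriesP => n /=.
case: ltngtP => [ltnN | ltNn | ->]; first by rewrite ltnS (ltnW ltnN).
  rewrite ltnS leqNgt ltNn /= -(subnSK ltNn).
  by rewrite big_ord_recl big_ord_recl big1 /= ?mul0r ?add0r ?mul1r ?addr0
     // => [|i _]; rewrite ?subSS ?subn0 ?mul0r.
by rewrite ltnSn subnn big_ord_recl big_ord0 mul0r addr0.
Qed.

Context (K : comNzRingType).

Lemma series_scaleE (A : algType K) (c : {series K}) (a : {series A}) :
  c *: a = Series (fun n => (cf c n)%:A) * a.
Proof. by apply: seriesP => n; apply: eq_bigr => i _; rewrite mulr_algl. Qed.

Lemma hvar_scaleE (A : algType K) N (z : {series A}) :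
  hvar K ^+ N *: z = hshift N z.
Proof.
rewrite -hvar_mulE; elim: N z => [|N IH] z; first by rewrite !expr0 scale1r mul1r.
rewrite !exprSr -scalerA IH -mulrA; congr (_ * _); rewrite series_scaleE.
by congr (_ * _); apply: seriesP => n /=; case: eqP => _; rewrite ?scale1r ?scale0r.
Qed.

(** Multiplication by h shifts coefficients both in A[[h]] and in K[[h]] as a module over itself.
    These are different module structures in the formalization, so the argument is made once for any
    module on which h acts as the shift. *)
Lemma hadic_of_shift (V : zmodType) (Q : lmodType {series K})
    (c : Q -> {series V}) (d : {series V} -> Q) :
  {morph c : x y / x - y} -> cancel c d -> cancel d c ->
  (forall N z, c (hvar K ^+ N *: z) = hshift N (c z)) ->
  [/\ hadic Q, htorsionfree Q &
  forall N x y, hcong N x y <-> forall n, (n < N)%N -> cf (c x) n = cf (c y) n].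
Proof.
move=> cB cK dK cZ.
have congP N x y : hcong N x y <-> forall n, (n < N)%N -> cf (c x) n = cf (c y) n.
  split=> [[z E] n ltn|H].
    apply/eqP; rewrite -subr_eq0 -cfN -cfD -cB E cZ /= ltn; exact: eqxx.
  exists (d (Series (fun n => cf (c x) (n + N)%N - cf (c y) (n + N)%N))).
  apply: (can_inj cK); rewrite cZ cB dK; apply: seriesP => n /=.
  by case: ltnP => [/H ->|le_Nn]; rewrite ?subrr // subnK.
split=> //.
  split=> [x H|u cau].
    apply: (can_inj cK); apply: seriesP => n.
    by have /congP Hn := H n.+1; rewrite Hn.
  have [n0 Hn0] : exists n0 : nat -> nat, forall N m n, (n0 N <= m)%N ->
      (n0 N <= n)%N -> hcong N (u m) (u n).
    by exists (fun N => projT1 (cid (cau N))) => N; case: cid.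
  (* The n-th coefficient is read from a member of the sequence beyond which all members agree
     modulo h^(n+1). *)
  exists (d (Series (fun n => cf (c (u (n0 n.+1))) n))) => N; exists (\max_(k < N.+1) n0 k).
  move=> n le_n; apply/congP => k ltkN; rewrite dK /=.
  have ltk : (k.+1 < N.+1)%N by rewrite ltnS.
  have /congP Hk : hcong k.+1 (u n) (u (n0 k.+1)).
    apply: Hn0 => //; apply: leq_trans le_n.
    exact: (leq_bigmax (Ordinal ltk)).
  exact: Hk.
move=> x /(congr1 c) E; apply: (can_inj cK); apply: seriesP => n.
have c0 : c 0 = 0 by rewrite -[0 in LHS](subrr 0) cB subrr.
have := congr1 (fun s => cf s n.+1) E; rewrite -[hvar K]expr1 cZ c0 /=.
by rewrite subn1.
Qed.

Lemma series_shift (A : algType K) :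
  [/\ hadic {series A}, htorsionfree {series A} &
  forall N (x y : {series A}),
    hcong N x y <-> forall n, (n < N)%N -> cf x n = cf y n].
Proof. by apply: (@hadic_of_shift A _ id id) => // N z; apply: hvar_scaleE. Qed.

Lemma hadic_series (A : algType K) : hadic {series A}.
Proof. by case: (series_shift A). Qed.
Lemma series_torsionfree (A : algType K) : htorsionfree {series A}.
Proof. by case: (series_shift A). Qed.
Lemma series_congP (A : algType K) N (x y : {series A}) :
  hcong N x y <-> forall n, (n < N)%N -> cf x n = cf y n.
Proof. by case: (series_shift A). Qed.

Lemma scalar_shift :
  [/\ hadic {series K}^o, htorsionfree {series K}^o &
  forall N (x y : {series K}^o),
    hcong N x y <-> forall n, (n < N)%N -> cf x n = cf y n].
Proof.
by apply: (@hadic_of_shift K ({series K}^o) id id) => // N z; apply: hvar_mulE.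
Qed.
Lemma hadic_scalar : hadic {series K}^o.
Proof. by case: scalar_shift. Qed.
Lemma scalar_congP N (x y : {series K}^o) :
  hcong N x y <-> forall n, (n < N)%N -> cf x n = cf y n.
Proof. by case: scalar_shift. Qed.

Lemma series_constD (V : nzRingType) (x y : V) :
  series_const (x + y) = series_const x + series_const y.
Proof. by apply: seriesP => -[|n] /=; rewrite ?addr0. Qed.
Lemma series_constM (V : nzRingType) (x y : V) :
  series_const (x * y) = series_const x * series_const y.
Proof.
apply: seriesP => -[|n]; first by rewrite cfM0.
rewrite /= big1 // => i _; case: i => -[|i] /= lti; last by rewrite mul0r.
by rewrite mulr0.
Qed.
Lemma series_const_scale (A : algType K) (c : K) (x : A) :
  series_const (c *: x) = series_const c *: series_const x.
Proof.
rewrite series_scaleE -mulr_algl series_constM; congr (_ * _).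
by apply: seriesP => -[|n] /=; rewrite ?scale0r.
Qed.
Lemma series_const0 (V : nzRingType) : series_const (0 : V) = 0.
Proof. by apply: seriesP => -[]. Qed.
Lemma series_const_sum (V : nzRingType) I r (P : pred I) (F : I -> V) :
  series_const (\sum_(i <- r | P i) F i) = \sum_(i <- r | P i) series_const (F i).
Proof. exact: (big_morph _ (@series_constD V) (series_const0 V)). Qed.

Lemma series_trunc (A : algType K) N (x : {series A}) :
  hcong N x (\sum_(k < N) hvar K ^+ k *: series_const (cf x k)).
Proof.
apply/series_congP => n ltnN; rewrite cf_sum (bigD1 (Ordinal ltnN)) //.
rewrite hvar_scaleE big1 => [|i ne_in].
  by apply: etrans (esym (addr0 _)); rewrite /= ltnn subnn.
rewrite hvar_scaleE /=; case: ltngtP => // [ltin | E].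
  by rewrite -subn_gt0 in ltin; case: (n - i)%N ltin.
by case/eqP: ne_in; apply: val_inj.
Qed.

(** Modulo h^N a series is a finite combination of constants, and linear maps respect
    congruences. *)
Lemma series_lin_ext (A : algType K) (W : lmodType {series K})
    (f g : {series A} -> W) :
  hadic W -> linear f -> linear g ->
  (forall x, f (series_const x) = g (series_const x)) -> forall x, f x = g x.
Proof.
move=> hW Hf Hg fg x; have [_ _] := hclosed_eq hW Hf Hg; apply => N.
exists (\sum_(k < N) hvar K ^+ k *: series_const (cf x k)); last exact: series_trunc.
rewrite (lin_sum Hf) (lin_sum Hg); apply: eq_bigr => k _.
by rewrite (linZ Hf) (linZ Hg) fg.
Qed.
End SeriesHadic.

(** * Completed tensor products *)

Section Tensors.
Context (K : comNzRingType).
Implicit Types A B V : algType {series K}.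

Section Basic.
Context A B (AB : ctensor A B).

Lemma ct_liftP (Q : lmodType {series K}) (f : A -> B -> Q) :
  hadic Q -> bilin f ->
  linear (ct_lift AB f) /\ forall a b, ct_lift AB f (tens AB a b) = f a b.
Proof.
move=> hQ bf; pose P phi := linear phi /\ forall a b, phi (tens AB a b) = f a b.
apply: (@theP _ _ P).
by have [phi [? _]] := @ct_universal _ _ _ AB _ _ hQ bf; exists phi.
Qed.

Lemma ct_lift_lin (Q : lmodType {series K}) (f : A -> B -> Q) :
  hadic Q -> bilin f -> linear (ct_lift AB f).
Proof. by move=> hQ /(ct_liftP hQ)[]. Qed.
Lemma ct_liftE (Q : lmodType {series K}) (f : A -> B -> Q) :
  hadic Q -> bilin f -> forall a b, ct_lift AB f (tens AB a b) = f a b.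
Proof. by move=> hQ /(ct_liftP hQ)[]. Qed.
Arguments ct_lift_lin {Q f}.
Arguments ct_liftE {Q f}.

Lemma tens_linl b : linear (fun a => tens AB a b).
Proof. by have [_] := tens_bilin AB; apply. Qed.
Lemma tens_linr a : linear (tens AB a).
Proof. by have [+ _] := tens_bilin AB; apply. Qed.

Lemma ct_ext (Q : lmodType {series K}) (f g : AB -> Q) :
  hadic Q -> linear f -> linear g ->
  (forall a b, f (tens AB a b) = g (tens AB a b)) -> forall x, f x = g x.
Proof.
move=> hQ Hf Hg fg x.
have bf : bilin (fun a b => f (tens AB a b)).
  split=> [a|b].
    exact: (lin_comp Hf (tens_linr a)).
  exact: (lin_comp Hf (tens_linl b)).
have [phi [_ uniq]] := @ct_universal _ _ _ AB _ _ hQ bf.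
have <- : phi = f by apply: uniq.
have <- // : phi = g by apply: uniq; split=> // a b; rewrite fg.
Qed.

Lemma ct_liftM (C : algType {series K}) (f : A -> B -> C) :
  hadic C -> bilin f ->
  (forall a a' b b', f (a * a') (b * b') = f a b * f a' b') ->
  {morph ct_lift AB f : x y / x * y}.
Proof.
move=> hC bf fM x y; have [Lf fE] := ct_liftP hC bf.
move: x; apply: (ct_ext hC).
- exact: (lin_comp Lf (lin_mulr y (@lin_id _ _))).
- exact: lin_mulr.
move=> a b; move: y; apply: (ct_ext hC).
- exact: (lin_comp Lf (lin_mull _ (@lin_id _ _))).
- exact: lin_mull.
by move=> a' b'; rewrite tens_mul !fE fM.
Qed.
End Basic.
Arguments ct_lift_lin {A B} AB {Q f}.
Arguments ct_liftE {A B} AB {Q f}.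

Lemma tens_bilin_comp A B A' B' (AB : ctensor A B) (f : A' -> A) (g : B' -> B) :
  linear f -> linear g -> bilin (fun a b => tens AB (f a) (g b)).
Proof.
move=> Hf Hg; split=> [a|b].
  exact: (lin_comp (tens_linr AB (f a)) Hg).
exact: (lin_comp (tens_linl AB (g b)) Hf).
Qed.

Section Map.
Context A B A' B' (AB : ctensor A B) (AB' : ctensor A' B').
Context (f : A -> A') (g : B -> B').
Hypotheses (Hf : linear f) (Hg : linear g).

Lemma ct_map_lin : linear (ct_map AB AB' f g).
Proof. apply: ct_lift_lin; [exact: ct_hadic | exact: tens_bilin_comp]. Qed.
Lemma ct_mapE a b : ct_map AB AB' f g (tens AB a b) = tens AB' (f a) (g b).
Proof. apply: ct_liftE; [exact: ct_hadic | exact: tens_bilin_comp]. Qed.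
Lemma ct_mapM : {morph f : x y / x * y} -> {morph g : x y / x * y} ->
  {morph ct_map AB AB' f g : x y / x * y}.
Proof.
move=> fM gM; apply: ct_liftM; [exact: ct_hadic | exact: tens_bilin_comp |].
by move=> a a' b b'; rewrite tens_mul fM gM.
Qed.
End Map.

Lemma bilin_mul A : bilin (fun x y : A => x * y).
Proof.
by split=> [a|b]; [exact: (lin_mull a (@lin_id _ _)) | exact: (lin_mulr b (@lin_id _ _))].
Qed.

Lemma ct_mult_lin A (AA : ctensor A A) : hadic A -> linear (ct_mult AA).
Proof. by move=> hA; apply: ct_lift_lin => //; exact: bilin_mul. Qed.
Lemma ct_multE A (AA : ctensor A A) x y :
  hadic A -> ct_mult AA (tens AA x y) = x * y.
Proof. by move=> hA; apply: (ct_liftE _ hA); exact: bilin_mul. Qed.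

Section Legs.
Context A (AA : ctensor A A) (A4 : ctensor AA AA).

Let bilin13 : bilin (fun a b : A => tens A4 (tens AA a 1) (tens AA b 1)).
Proof. by apply: tens_bilin_comp; exact: tens_linl. Qed.
Let bilin24 : bilin (fun a b : A => tens A4 (tens AA 1 a) (tens AA 1 b)).
Proof. by apply: tens_bilin_comp; exact: tens_linr. Qed.
Let bilin23 : bilin (fun a b : A => tens A4 (tens AA 1 a) (tens AA b 1)).
Proof. by apply: tens_bilin_comp; [exact: tens_linr | exact: tens_linl]. Qed.

Lemma leg13_lin : linear (leg13 A4).
Proof. exact: (ct_lift_lin _ (@ct_hadic _ _ _ _)). Qed.
Lemma leg24_lin : linear (leg24 A4).
Proof. exact: (ct_lift_lin _ (@ct_hadic _ _ _ _)). Qed.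
Lemma leg23_lin : linear (leg23 A4).
Proof. exact: (ct_lift_lin _ (@ct_hadic _ _ _ _)). Qed.
Lemma leg13E a b : leg13 A4 (tens AA a b) = tens A4 (tens AA a 1) (tens AA b 1).
Proof. exact: (ct_liftE _ (@ct_hadic _ _ _ _)). Qed.
Lemma leg24E a b : leg24 A4 (tens AA a b) = tens A4 (tens AA 1 a) (tens AA 1 b).
Proof. exact: (ct_liftE _ (@ct_hadic _ _ _ _)). Qed.
Lemma leg23E a b : leg23 A4 (tens AA a b) = tens A4 (tens AA 1 a) (tens AA b 1).
Proof. exact: (ct_liftE _ (@ct_hadic _ _ _ _)). Qed.
Lemma leg13M : {morph leg13 A4 : x y / x * y}.
Proof.
by apply: ct_liftM => //; [exact: ct_hadic|] => *; rewrite !tens_mul !mulr1.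
Qed.
Lemma leg24M : {morph leg24 A4 : x y / x * y}.
Proof.
by apply: ct_liftM => //; [exact: ct_hadic|] => *; rewrite !tens_mul !mulr1.
Qed.
Lemma leg23M : {morph leg23 A4 : x y / x * y}.
Proof.
by apply: ct_liftM => //; [exact: ct_hadic|] => *; rewrite !tens_mul !mulr1.
Qed.
Lemma leg13_1 : leg13 A4 1 = 1.
Proof. by rewrite -(tens_one AA) leg13E !tens_one. Qed.
Lemma leg24_1 : leg24 A4 1 = 1.
Proof. by rewrite -(tens_one AA) leg24E !tens_one. Qed.
Lemma leg23_1 : leg23 A4 1 = 1.
Proof. by rewrite -(tens_one AA) leg23E !tens_one. Qed.
End Legs.

Section Act.
Context A V (AA : ctensor A A) (VV : ctensor V V) (act : A -> V -> V).
Hypothesis Hact : bilin act.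

Let actl x : linear (fun a => act a x). Proof. by have [_] := Hact; apply. Qed.
Let actr a : linear (act a). Proof. by have [+ _] := Hact; apply. Qed.

Let inner a b : bilin (fun x y => tens VV (act a x) (act b y)).
Proof. by apply: tens_bilin_comp; exact: actr. Qed.

Let outer z : bilin
  (fun a b => ct_lift VV (fun x y => tens VV (act a x) (act b y)) z).
Proof.
have hVV := @ct_hadic _ _ _ VV.
have L a b := ct_lift_lin VV hVV (inner a b).
split=> [a|b] c a1 a2; move: z; apply: (ct_ext hVV) => //.
- by apply: lin_add => //; apply: lin_scale.
- move=> x y; rewrite !(ct_liftE VV hVV (inner _ _)).
  by rewrite actl; exact: tens_linr.
- by apply: lin_add => //; apply: lin_scale.
- move=> x y; rewrite !(ct_liftE VV hVV (inner _ _)).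
  by rewrite actl; exact: tens_linl.
Qed.

Lemma ct_act_linl (z : VV) : linear (fun u : AA => ct_act act u z : VV).
Proof. exact: (ct_lift_lin AA (@ct_hadic _ _ _ VV) (outer z)). Qed.
Lemma ct_act_tens a b (z : VV) : @ct_act _ _ _ AA VV act (tens AA a b) z =
  ct_lift VV (fun x y => tens VV (act a x) (act b y)) z.
Proof. exact: (ct_liftE AA (@ct_hadic _ _ _ VV) (outer z)). Qed.
Lemma ct_actE a b x y : @ct_act _ _ _ AA VV act (tens AA a b) (tens VV x y) =
  tens VV (act a x) (act b y).
Proof. by rewrite ct_act_tens (ct_liftE VV (@ct_hadic _ _ _ VV) (inner a b)). Qed.
Lemma ct_act_linr (u : AA) : linear (fun z : VV => ct_act act u z : VV).
Proof.
move=> c z1 z2; move: u; apply: (ct_ext (@ct_hadic _ _ _ VV)).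
- exact: ct_act_linl.
- by apply: lin_add; [apply: lin_scale|]; exact: ct_act_linl.
by move=> a b; rewrite !ct_act_tens; apply: (ct_lift_lin VV (@ct_hadic _ _ _ VV)).
Qed.
Lemma ct_act1 (z : VV) : (forall x, act 1 x = x) -> @ct_act _ _ _ AA VV act 1 z = z.
Proof.
move=> act1; rewrite -(tens_one AA); move: z.
apply: (ct_ext (@ct_hadic _ _ _ VV)) => //; first exact: ct_act_linr.
by move=> x y; rewrite ct_actE !act1.
Qed.
Lemma ct_actM (u v : AA) (z : VV) : (forall a b x, act (a * b) x = act a (act b x)) ->
  @ct_act _ _ _ AA VV act (u * v) z = ct_act act u (ct_act act v z).
Proof.
move=> aM; have hVV := @ct_hadic _ _ _ VV.
move: u; apply: (ct_ext hVV).
- exact: (lin_comp (ct_act_linl z) (lin_mulr v (@lin_id _ _))).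
- exact: ct_act_linl.
move=> a b; move: v; apply: (ct_ext hVV).
- exact: (lin_comp (ct_act_linl z) (lin_mull _ (@lin_id _ _))).
- exact: (lin_comp (ct_act_linr (tens AA a b)) (ct_act_linl z)).
move=> a' b'; rewrite tens_mul; move: z; apply: (ct_ext hVV).
- exact: ct_act_linr.
- exact: (lin_comp (ct_act_linr _) (ct_act_linr _)).
by move=> x y; rewrite !ct_actE !aM.
Qed.
End Act.
End Tensors.
Arguments ct_lift_lin {K A B} AB {Q f}.
Arguments ct_liftE {K A B} AB {Q f}.
Arguments ct_ext {K A B AB Q}.
Arguments ct_mult_lin {K A} AA.
Arguments ct_multE {K A} AA x y.
Arguments ct_act_linl {K A V AA VV act}.
Arguments ct_act_linr {K A V AA VV act}.
Arguments ct_actE {K A V AA VV act}.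
Arguments leg13_lin {K A AA} A4.
Arguments leg24_lin {K A AA} A4.
Arguments leg23_lin {K A AA} A4.
Arguments tens_linl {K A B} AB b.
Arguments tens_linr {K A B} AB a.

(** * Closed subalgebras of h-adic algebras *)

Section ClosedSubalgebra.
Context (K : comNzRingType) (A : algType {series K}).

Record closed_subalg := ClosedSubalg {
  csa_pred :> A -> Prop;
  csa_closed : hclosed csa_pred;
  csa1 : csa_pred 1;
  csaM : forall x y, csa_pred x -> csa_pred y -> csa_pred (x * y) }.

Definition csa_mem (P : closed_subalg) : {pred A} := fun x => `[< P x >].

Lemma csa_memP (P : closed_subalg) x : reflect (P x) (x \in csa_mem P).
Proof. exact: asboolP. Qed.

Fact csa_subalg_closed (P : closed_subalg) : subalg_closed (csa_mem P).
Proof.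
have [P0 PL _] := csa_closed P; split.
- exact/csa_memP/csa1.
- by move=> c x y /csa_memP Px /csa_memP Py; apply/csa_memP/PL.
- by move=> x y /csa_memP Px /csa_memP Py; apply/csa_memP/csaM.
Qed.
HB.instance Definition _ (P : closed_subalg) :=
  GRing.isSubalgClosed.Build {series K} A (csa_mem P) (csa_subalg_closed P).

Definition csa_type (P : closed_subalg) := {x | x \in csa_mem P}.
HB.instance Definition _ (P : closed_subalg) := SubChoice.on (csa_type P).
HB.instance Definition _ (P : closed_subalg) :=
  [SubChoice_isSubAlgebra of csa_type P by <:].

Lemma csa_val_lin (P : closed_subalg) : linear (val : csa_type P -> A).
Proof. by move=> c x y; rewrite linearP. Qed.
Lemma csa_val1 (P : closed_subalg) : val (1 : csa_type P) = 1.
Proof. exact: rmorph1. Qed.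
Lemma csa_valM (P : closed_subalg) (x y : csa_type P) : val (x * y) = val x * val y.
Proof. exact: rmorphM. Qed.
Lemma csa_valX (P : closed_subalg) (x : csa_type P) n : val (x ^+ n) = val x ^+ n.
Proof. exact: rmorphXn. Qed.
End ClosedSubalgebra.

Section Density.
Context (K : comNzRingType) (A : algType {series K}).
Hypotheses (hA : hadic A) (tfA : htorsionfree A).
Context (P : closed_subalg A).

(** The limit of a Cauchy sequence lies in the subalgebra by closedness. The delicate point is
    convergence inside the subalgebra: a congruence there asks for a quotient by h^N that lies in it
    as well, and this is where torsion-freeness enters. *)
Lemma csa_hadic : hadic (csa_type P).
Proof.
have valL := @csa_val_lin _ _ P.
have [_ cpl] := hA; have [_ _ PC] := csa_closed P.
split=> [x H|u cau].
  apply: val_inj; apply: (hadic_sep hA) => N; rewrite raddf0.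
  by have := hcong_lin valL (H N); rewrite raddf0.
have [s us] : exists s, hcvg (fun n => val (u n)) s.
  apply: cpl => N; have [n0 H] := cau N; exists n0 => m n hm hn.
  exact: hcong_lin valL (H m n hm hn).
have Ps : s \in csa_mem P.
  apply/csa_memP/PC => N; have [n0 H] := us N.
  by exists (val (u n0)); [exact/csa_memP/(valP (u n0)) | exact/hcong_sym/H].
exists (Sub s Ps : csa_type P) => N; have [n0 H] := cau N; exists n0 => n le_n.
have [n1 H1] := us N; have [z Ez] := H1 _ (leq_maxr n0 n1).
have [y Ey] := H n (maxn n0 n1) le_n (leq_maxl _ _).
(* [val y + z] is the quotient of [u n - s] by h^N. Torsion-freeness makes it the limit of the
   quotients of [u n - u m], which are in P because the sequence is Cauchy there. *)
have Pw : val y + z \in csa_mem P.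
  apply/csa_memP/PC => k; have [n2 H2] := us (N + k)%N.
  have [t Et] := H2 _ (leq_maxr n0 n2).
  have [y' Ey'] := H n (maxn n0 n2) le_n (leq_maxl _ _).
  exists (val y'); first exact/csa_memP/(valP y').
  exists t; apply: (htorsionfreeI (N := N) tfA) => /=.
  rewrite scalerA -exprD -Et scalerBr scalerDr -Ez -!(linZ valL) -Ey -Ey'.
  by rewrite !(linB valL) subrKA opprB addrC subrKA.
exists (Sub (val y + z) Pw : csa_type P); apply: val_inj; rewrite (linB valL) (linZ valL) !SubK.
by rewrite scalerDr -Ez -(linZ valL) -Ey (linB valL) subrKA.
Qed.
End Density.

(** * Density of the generators *)

Lemma hterm_small (K : comNzRingType) (V : lmodType {series K}) c (x : V) k :
  hcong k ((c * hvar K ^+ k) *: x) 0.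
Proof. by exists (c *: x); rewrite subr0 scalerA mulrC. Qed.

Section Generation.
Context (K : fieldType).

(** The universal property maps [Uh] to the subalgebra; followed by the inclusion this is an
    endomorphism fixing the generators, hence the identity. *)
Lemma qsu2_density (Uh : qsu2_env K) (P : closed_subalg Uh) :
  htorsionfree Uh -> P (QE Uh) -> P (QH Uh) -> P (QF Uh) -> forall x, P x.
Proof.
move=> tf PE PH PF.
have hU := qsu2_hadic Uh; have hB := csa_hadic hU tf P.
have [RHE RHF REF] := qsu2_relations Uh.
pose e : csa_type P := Sub (QE Uh) (introT (csa_memP P _) PE).
pose h : csa_type P := Sub (QH Uh) (introT (csa_memP P _) PH).
pose f : csa_type P := Sub (QF Uh) (introT (csa_memP P _) PF).
have vE : val e = QE Uh by rewrite SubK.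
have vH : val h = QH Uh by rewrite SubK.
have vF : val f = QF Uh by rewrite SubK.
have valL := @csa_val_lin _ _ P.
have rel : qsu2_rel e h f.
  split; apply: val_inj.
  - by rewrite (linB valL) (linMn valL) !csa_valM vE vH.
  - by rewrite (linB valL) (linN valL) (linMn valL) !csa_valM vF vH.
   (* The right side of the relation for [E,F] is an infinite sum, so the inclusion has to be
      carried through a limit. *)
   rewrite (linZ valL) (linB valL) !csa_valM vE vF REF; apply: hsum_eq => //.
  apply: hcvg_ext (hcvg_lin valL (hsumP hB (fun k => hterm_small _ _ _))) => n.
  rewrite (lin_sum valL).
  apply: eq_bigr => k _; rewrite (linZ valL) (linB valL) !csa_valX.
  by rewrite (linN valL) vH.
have [phi [[[phiL [phi1 phiM]] phiE phiH phiF] _]] := @qsu2_universal _ Uh _ _ _ _ hB rel.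
have [psi [_ uniq]] := @qsu2_universal _ Uh _ _ _ _ hU (qsu2_relations Uh).
move=> x; suff -> : x = val (phi x) by apply/csa_memP/(valP (phi x)).
have Ei : psi = id by apply: uniq; do !split.
rewrite -[LHS]/(id x) -Ei.
have -> // : psi = (fun x => val (phi x)).
apply: uniq; split; rewrite ?phiE ?phiH ?phiF //; split.
  exact: (lin_comp valL phiL).
by split=> [|a b]; rewrite ?phi1 ?phiM ?csa_val1 ?csa_valM.
Qed.

Lemma M2_density (M : M2_space K) (P : closed_subalg M) :
  htorsionfree M -> (forall m m', P (MX M m m')) -> forall x, P x.
Proof.
move=> tf PX; have hM := M2_hadic M; have hB := csa_hadic hM tf P.
pose X m m' : csa_type P := Sub (MX M m m') (introT (csa_memP P _) (PX m m')).
have vX m m' : val (X m m') = MX M m m' by rewrite SubK.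
have valL := @csa_val_lin _ _ P.
have rel : M2_rel X.
  have [[r1 r2] [r3 r4] r5 r6] := M2_relations M.
  by do !split; apply: val_inj; rewrite ?(linB valL) ?(linZ valL) ?csa_valM !vX.
have [phi [[[phiL [phi1 phiM]] phiX] _]] := @M2_universal _ M _ _ hB rel.
have [psi [_ uniq]] := @M2_universal _ M _ _ hM (M2_relations M).
move=> x; suff -> : x = val (phi x) by apply/csa_memP/(valP (phi x)).
have Ei : psi = id by apply: uniq; do !split.
rewrite -[LHS]/(id x) -Ei.
have -> // : psi = (fun x => val (phi x)).
apply: uniq; split=> [|m m']; last by rewrite phiX vX.
split; first exact: (lin_comp valL phiL).
by split=> [|a b]; rewrite ?phi1 ?phiM ?csa_val1 ?csa_valM.
Qed.

(* The elements y such that y x is in P for all x in P form a closed subalgebra. *)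
Lemma M2_ind (M : M2_space K) (P : M -> Prop) : htorsionfree M -> hclosed P ->
  P 1 -> (forall m m' x, P x -> P (MX M m m' * x)) -> forall x, P x.
Proof.
move=> tf PC P1 PX.
have QC : hclosed (fun y => forall x, P x -> P (y * x)).
  apply: hclosed_all => x Px; split; first by rewrite mul0r; case: PC.
    move=> c y z Py Pz; rewrite mulrDl -scalerAl.
    by have [_ PL _] := PC; apply: PL.
  have [_ _ Pcl] := PC; move=> y Hy; apply: Pcl => N; have [z Pz yz] := Hy N.
  by exists (z * x) => //; apply: hcong_mul yz (hcong_refl _ _).
have Q1 x : P x -> P (1 * x) by rewrite mul1r.
have QM y z : (forall x, P x -> P (y * x)) -> (forall x, P x -> P (z * x)) ->
    forall x, P x -> P (y * z * x).
  by move=> Hy Hz x Px; rewrite -mulrA; apply/Hy/Hz.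
move=> x; rewrite -[x]mulr1.
exact: (M2_density (P := ClosedSubalg QC Q1 QM) tf PX).
Qed.
End Generation.

(** * Powers of q and exponentials of h-multiples *)

Section Exponential.
Context (K : numFieldType).

Lemma qpow0 : qpow (0 : K) = 1.
Proof.
by apply: seriesP => -[|n] /=; rewrite ?expr0 ?divr1 // expr0n mul0r.
Qed.

Lemma qpowD (a b : K) : qpow (a + b) = qpow a * qpow b.
Proof.
apply: seriesP => n /=; rewrite addrC exprDn mulr_suml; apply: eq_bigr => i _.
have lei : (i <= n)%N by rewrite -ltnS.
rewrite -(bin_fact lei) -[_ *+ _]mulr_natr !natrM.
have nz k : (k`!%:R : K) != 0 by rewrite Num.Theory.pnatr_eq0 -lt0n fact_gt0.
have nzC : ('C(n, i)%:R : K) != 0 by rewrite Num.Theory.pnatr_eq0 -lt0n bin_gt0.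
by field; rewrite nzC !nz.
Qed.

Lemma qpow_cvg (a d : K) :
  @hcvg K {series K}^o
    (fun n => \sum_(k < n) series_const (a ^+ k / k`!%:R) * hvar K ^+ k *
                series_const (d ^+ k))
    (qpow (a * d)).
Proof.
move=> N; exists N => n le_Nn; apply/scalar_congP => m ltm.
have lt_mn := leq_trans ltm le_Nn.
rewrite cf_sum (bigD1 (Ordinal lt_mn)) // big1 => [|i ne_im].
  apply: etrans (addr0 _) _; rewrite mulrAC mulrC hvar_mulE -series_constM /=.
  by rewrite ltnn subnn exprMn mulrAC.
rewrite mulrAC mulrC hvar_mulE -series_constM /=; case: ltngtP => // [ltim | E].
  by rewrite -subn_gt0 in ltim; case: (m - i)%N ltim.
by case/eqP: ne_im; apply: val_inj.
Qed.

Section Hexp.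
Context (A : algType {series K}) (hA : hadic A).

Lemma hexp_cvg (c : K) (x : A) : hcvg (fun n => \sum_(k < n)
  (series_const (c ^+ k / k`!%:R) * hvar K ^+ k) *: x ^+ k) (hexp c x).
Proof. exact: (hsumP hA (fun k => hterm_small _ _ _)). Qed.

(** [phi] is only linear so that it can be the map from g to g acting on a fixed eigenvector. *)
Lemma hexp_eigen (V : lmodType {series K}) (phi : A -> V) c d x v :
  hadic V -> linear phi -> (forall k, phi (x ^+ k) = series_const (d ^+ k) *: v) ->
  phi (hexp c x) = qpow (c * d) *: v.
Proof.
move=> hV phiL phiX; apply: (hcvg_uniq hV (hcvg_lin phiL (hexp_cvg c x))).
have cv := hcvg_lin (@lin_scalel _ {series K}^o V id v (@lin_id _ _)) (qpow_cvg c d).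
apply: hcvg_ext cv => n; rewrite (lin_sum phiL) scaler_suml.
by apply: eq_bigr => k _; rewrite (linZ phiL) phiX scalerA.
Qed.

Lemma hcong1_sum (V : lmodType {series K}) (hV : hadic V) (u : nat -> V) :
  (forall k, hcong k (u k) 0) -> hcong 1 (hsum u) (u 0).
Proof.
move=> small; have [n0 H] := hsumP hV small 1%N.
apply: hcong_trans (hcong_sym (H n0.+1 (leqnSn n0))) _.
rewrite big_ord_recl /= -[X in hcong _ _ X]addr0.
apply: hcongD; first exact: hcong_refl.
have {2}<- : \sum_(i < n0) (0 : V) = 0 by rewrite big1.
by apply: hcong_sum => i; apply: hcongW (small _).
Qed.

(** Makes the factors e^(hH) and e^(-hH) of the coproduct disappear in the limit. *)
Lemma hexp_mod (c : K) (x : A) : hcong 1 (hexp c x) 1.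
Proof.
have := hcong1_sum hA (fun k => hterm_small
  (series_const (c ^+ k / k`!%:R)) (x ^+ k) k).
have -> : series_const (c ^+ 0 / 0`!%:R) * hvar K ^+ 0 = 1.
  by rewrite !expr0 mulr1 divr1.
by rewrite scale1r.
Qed.
End Hexp.
End Exponential.
Arguments hexp_eigen {K A} hA {V phi c d x v}.

(** * Module algebra structures and evaluation at scalar matrices *)

Section OneSided.
Context (K : numFieldType) (Uh : qsu2_env K) (M : M2_space K).
Hypothesis tfM : htorsionfree M.

Definition weight_vector (a : Uh -> M -> M) c x := a (QH Uh) x = series_const c *: x.

(** Treats the two commuting actions, on the left and on the right index, alike. The function w
    gives the H-weight of X_{mm'}, which depends on m for the one action and on m' for the other. *)
Record one_sided (a : Uh -> M -> M) (w : 'I_2 -> 'I_2 -> K) : Prop := OneSided {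
  os_bilin : bilin a;
  osM : forall g h x, a (g * h) x = a g (a h x);
  os1 : forall x, a 1 x = x;
  osE : forall x y, a (QE Uh) (x * y) =
    a (QE Uh) x * a (hexp 1 (QH Uh)) y + x * a (QE Uh) y;
  osF : forall x y, a (QF Uh) (x * y) =
    a (QF Uh) x * y + a (hexp (- 1) (QH Uh)) x * a (QF Uh) y;
  osH : forall x y, a (QH Uh) (x * y) = a (QH Uh) x * y + x * a (QH Uh) y;
  osX : forall m m', weight_vector a (w m m') (MX M m m')
}.

Context (a : Uh -> M -> M) (w : 'I_2 -> 'I_2 -> K) (os : one_sided a w).

Lemma os_linl x : linear (fun g => a g x).
Proof. by have [_] := os_bilin os; apply. Qed.
Lemma os_linr g : linear (a g).
Proof. by have [+ _] := os_bilin os; apply. Qed.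

Lemma osH1 : a (QH Uh) 1 = 0.
Proof.
have := osH os 1 1; rewrite !mulr1 mul1r => E.
by apply/eqP; rewrite -(inj_eq (addrI (a (QH Uh) 1))) addr0 -E.
Qed.

Lemma weight_one : weight_vector a 0 1.
Proof. by rewrite /weight_vector osH1 series_const0 scale0r. Qed.

Lemma weight_mul c d x y : weight_vector a c x -> weight_vector a d y ->
  weight_vector a (c + d) (x * y).
Proof.
move=> wx wy; rewrite /weight_vector (osH os) wx wy series_constD scalerDl.
by rewrite scalerAl scalerAr.
Qed.

Lemma weight_hexp s c x :
  weight_vector a c x -> a (hexp s (QH Uh)) x = qpow (s * c) *: x.
Proof.
move=> wx; apply: (hexp_eigen (qsu2_hadic Uh) (phi := fun g => a g x) (M2_hadic M)).
  exact: os_linl.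
elim=> [|k IH]; first by rewrite !expr0 (os1 os) scale1r.
rewrite exprS (osM os) IH (linZ (os_linr _)) wx scalerA -series_constM.
by rewrite exprSr.
Qed.

(** Serves as the group-like property of e^(shH), for a weight vector as first factor. The induction
    on y keeps x arbitrary because each generator is moved from y into x, where it changes the
    weight. *)
Lemma hexp_mul_weight s c x y : weight_vector a c x ->
  a (hexp s (QH Uh)) (x * y) = qpow (s * c) *: (x * a (hexp s (QH Uh)) y).
Proof.
move: y c x; apply: (M2_ind tfM).
- have cl (i : K * M) : weight_vector a i.1 i.2 -> hclosed (fun y =>
      a (hexp s (QH Uh)) (i.2 * y) = qpow (s * i.1) *: (i.2 * a (hexp s (QH Uh)) y)).
    move=> _; apply: (hclosed_eq (M2_hadic M)).
      exact: (lin_comp (os_linr _) (lin_mull i.2 (@lin_id _ _))).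
    exact (@lin_scale _ M M _ _ (lin_mull i.2 (os_linr _))).
  have [P0 PL PC] := hclosed_all cl; split=> [c x wx|c x y Px Py d z wz|x Px c z wz].
  + exact: (P0 (c, x) wx).
  + by apply: (PL _ _ _ _ _ (d, z)) => // -[d' z'] /=; [apply: Px | apply: Py].
  + apply: (PC _ _ (c, z)) => // N; have [y Py xy] := Px N.
    by exists y => // -[d' z'] /=; apply: Py.
- by move=> c x wx; rewrite !mulr1 (weight_hexp s wx) (weight_hexp s weight_one)
    mulr0 qpow0 scale1r mulr1.
move=> m m' y IH c x wx; rewrite mulrA (IH _ _ (weight_mul wx (osX os m m'))).
by rewrite (IH _ _ (osX os m m')) -scalerAr scalerA -qpowD -mulrDr mulrA.
Qed.

Lemma osF_weight c x y : weight_vector a c x ->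
  a (QF Uh) (x * y) = a (QF Uh) x * y + (qpow (- c) *: x) * a (QF Uh) y.
Proof. by move=> wx; rewrite (osF os) (weight_hexp _ wx) mulN1r. Qed.

Lemma osE1 : a (QE Uh) 1 = 0.
Proof.
have := osE os 1 1; rewrite !mulr1 (weight_hexp _ weight_one).
rewrite mulr0 qpow0 scale1r mulr1 mul1r => /eqP.
by rewrite -subr_eq0 opprD addrA subrr add0r oppr_eq0 => /eqP ->.
Qed.

Lemma osF1 : a (QF Uh) 1 = 0.
Proof.
have := osF_weight 1 weight_one; rewrite !mulr1 oppr0 qpow0 scale1r mul1r => /eqP.
by rewrite -subr_eq0 opprD addrA subrr add0r oppr_eq0 => /eqP ->.
Qed.

Lemma hexp_mod1 s x : hcong 1 (a (hexp s (QH Uh)) x) x.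
Proof.
rewrite -[X in hcong _ _ X](os1 os x).
exact: (hcong_lin (os_linl x) (hexp_mod (qsu2_hadic Uh) s (QH Uh))).
Qed.
End OneSided.

Section Epsilon.
Context (K : fieldType).

(* The generic scalar matrix. *)
Definition diagX (m m' : 'I_2) : {series {poly K}} :=
  if m == m' then series_const 'X else 0.

Lemma diag_rel : M2_rel (K := K) diagX.
Proof.
by rewrite /M2_rel /diagX /=; do !split; rewrite ?(mulr0, mul0r, scaler0) ?subrr.
Qed.

Definition is_eps (M : M2_space K) (eps : M -> {series {poly K}}) :=
  alg_hom eps /\ forall m m', eps (MX M m m') = diagX m m'.

Lemma eps_exists (M : M2_space K) : exists eps, @is_eps M eps.
Proof.
have [eps [? _]] := @M2_universal _ M _ _ (hadic_series _) diag_rel.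
by exists eps.
Qed.
End Epsilon.

Section TwoSided.
Context (K : numFieldType) (Uh : qsu2_env K) (M : M2_space K).
Hypothesis tfM : htorsionfree M.
Context (aL aR : Uh -> M -> M) (v : 'I_2 -> K).
Hypotheses (osL : one_sided aL (fun m _ => v m)) (osR : one_sided aR (fun _ m => v m)).
Context (eps : M -> {series {poly K}}) (Heps : is_eps eps).

Lemma eps_lin : linear eps. Proof. by case: Heps => -[]. Qed.
Lemma eps1 : eps 1 = 1. Proof. by case: Heps => -[_ []]. Qed.
Lemma epsM x y : eps (x * y) = eps x * eps y. Proof. by case: Heps => -[_ [_ ->]]. Qed.
Lemma epsX m m' : eps (MX M m m') = diagX K m m'. Proof. by case: Heps. Qed.

Let hS : hadic {series {poly K}} := @hadic_series _ _.

(** On the diagonal the indices coincide, and elsewhere evaluation gives 0; hence after eps left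
    weights can be exchanged for right ones. *)
Lemma scale_diagX (c : 'I_2 -> {series K}) m m' :
  c m *: diagX K m m' = c m' *: diagX K m m'.
Proof. by rewrite /diagX; case: eqP => [->|_] //; rewrite !scaler0. Qed.

Lemma eps_H x : eps (aL (QH Uh) x) = eps (aR (QH Uh) x).
Proof.
move: x; apply: (M2_ind tfM).
- apply: (hclosed_eq hS); apply: (lin_comp eps_lin); [exact: os_linr osL _|].
  exact: os_linr osR _.
- by rewrite (osH1 osL) (osH1 osR).
move=> m m' x IH; rewrite (osH osL) (osH osR) (osX osL) (osX osR).
rewrite !(linD eps_lin) !epsM !(linZ eps_lin) epsX IH.
exact (congr1 (fun z => z * _ + _) (scale_diagX (fun m => series_const (v m)) m m')).
Qed.

Lemma eps_hexp s x : eps (aL (hexp s (QH Uh)) x) = eps (aR (hexp s (QH Uh)) x).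
Proof.
move: x; apply: (M2_ind tfM).
- apply: (hclosed_eq hS); apply: (lin_comp eps_lin); [exact: os_linr osL _|].
  exact: os_linr osR _.
- by rewrite (weight_hexp osL _ (weight_one osL)) (weight_hexp osR _ (weight_one osR)).
move=> m m' x IH; rewrite (hexp_mul_weight tfM osL s _ (osX osL m m')).
rewrite (hexp_mul_weight tfM osR s _ (osX osR m m')).
rewrite !(linZ eps_lin) !epsM IH epsX !scalerAl.
exact (congr1 (fun z => z * _) (scale_diagX (fun m => qpow (s * v m)) m m')).
Qed.

(* In the spin representations the transpose of E is F e^(hH), so evaluation at
   scalar matrices exchanges the two actions up to this anti-automorphism. *)
Lemma eps_E : (forall m m', eps (aL (QE Uh) (MX M m m')) =
    qpow (v m') *: eps (aR (QF Uh) (MX M m m'))) ->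
  forall x, eps (aL (QE Uh) x) = eps (aR (QF Uh) (aR (hexp 1 (QH Uh)) x)).
Proof.
move=> genE; apply: (M2_ind tfM).
- apply: (hclosed_eq hS); apply: (lin_comp eps_lin); first exact: os_linr osL _.
  exact (lin_comp (os_linr osR _) (os_linr osR _)).
- rewrite (weight_hexp osR _ (weight_one osR)) mulr0 qpow0 scale1r.
  by rewrite (osE1 osL) (osF1 osR).
move=> m m' x IH; rewrite (osE osL) (hexp_mul_weight tfM osR 1 _ (osX osR m m')).
rewrite (linZ (os_linr osR _)) (osF_weight osR _ (osX osR m m')) mul1r.
rewrite (linZ eps_lin) !(linD eps_lin) !epsM (linZ eps_lin) scalerDr.
rewrite !scalerAl scalerA -qpowD subrr qpow0 scale1r IH genE eps_hexp.
by [].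
Qed.
End TwoSided.

Section Action.
Context (R : realType).
Local Notation K := R[i].
Context (Uh : qsu2_env K) (UhUh : ctensor Uh Uh) (Uh4 : ctensor UhUh UhUh).
Context (M : M2_space K) (MM : ctensor M M) (actM : UhUh -> M -> M).
Hypothesis HactM : is_M2_action Uh4 MM actM.

Definition actL g x := actM (tens UhUh g 1) x.
Definition actR g x := actM (tens UhUh 1 g) x.

Let hM : hadic M := M2_hadic M.
Let hMM : hadic MM := @ct_hadic _ _ _ MM.
Let hUU : hadic UhUh := @ct_hadic _ _ _ UhUh.
Let hU4 : hadic Uh4 := @ct_hadic _ _ _ Uh4.

Lemma actM_bilin : bilin actM. Proof. by case: HactM. Qed.
Lemma actM_linl x : linear (fun u => actM u x).
Proof. by have [_] := actM_bilin; apply. Qed.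
Lemma actM_linr u : linear (actM u).
Proof. by have [+ _] := actM_bilin; apply. Qed.
Lemma actMM u v x : actM (u * v) x = actM u (actM v x).
Proof. by case: HactM. Qed.
Lemma actM1 x : actM 1 x = x.
Proof. by case: HactM. Qed.
Lemma actM_prod u x y :
  actM u (x * y) = ct_mult MM (ct_act actM (so4_cop Uh4 u) (tens MM x y)).
Proof. by case: HactM => _ _ _ H _; case: (H u). Qed.
Lemma actM_X g g' m m' : actM (tens UhUh g g') (MX M m m') =
  \sum_(k < 2) \sum_(k' < 2) (qspin 1 g k m * qspin 1 g' k' m') *: MX M k k'.
Proof. by case: HactM. Qed.

Lemma so4_cop_tens g g' : linear (qsu2_cop UhUh) ->
  so4_cop Uh4 (tens UhUh g g') =
  leg13 Uh4 (qsu2_cop UhUh g) * leg24 Uh4 (qsu2_cop UhUh g').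
Proof.
move=> copL; apply: (ct_liftE UhUh hU4); split=> [u|u].
  exact (lin_mull _ (lin_comp (leg24_lin Uh4) copL)).
exact (lin_mulr _ (lin_comp (leg13_lin Uh4) copL)).
Qed.

Definition cop_spec (cop : Uh -> UhUh) := [/\ alg_hom cop,
  cop (QE Uh) = tens UhUh (QE Uh) (hexp 1 (QH Uh)) + tens UhUh 1 (QE Uh),
  cop (QH Uh) = tens UhUh (QH Uh) 1 + tens UhUh 1 (QH Uh) &
  cop (QF Uh) = tens UhUh (QF Uh) 1 + tens UhUh (hexp (- 1) (QH Uh)) (QF Uh)].

(* Were Delta' not to respect the relations, [qsu2_cop] would be 0, and 1 would
   act on the product 1 * 1 by 0. *)
Lemma copP : cop_spec (qsu2_cop UhUh).
Proof.
have [//|E] := the_or (fun=> 0) cop_spec.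
have {E} cop0 : qsu2_cop UhUh = fun=> 0 by [].
have copL : linear (qsu2_cop UhUh).
  by rewrite cop0; exact: lin_zero.
have /eqP := actM_prod 1 1 1; rewrite actM1 mulr1 -(tens_one UhUh).
rewrite so4_cop_tens // cop0 (lin0 (leg13_lin Uh4)) mul0r.
rewrite (lin0 (ct_act_linl actM_bilin _)) (lin0 (ct_mult_lin MM hM)).
by rewrite oner_eq0.
Qed.

Lemma cop_lin : linear (qsu2_cop UhUh).
Proof. by case: copP => -[]. Qed.
Lemma cop1 : qsu2_cop UhUh 1 = 1.
Proof. by case: copP => -[_ []]. Qed.

Lemma actL_prod g x y : actL g (x * y) =
  ct_mult MM (ct_act actM (leg13 Uh4 (qsu2_cop UhUh g)) (tens MM x y)).
Proof.
rewrite /actL actM_prod so4_cop_tens; last exact: cop_lin.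
by rewrite cop1 leg24_1 mulr1.
Qed.

Lemma actR_prod g x y : actR g (x * y) =
  ct_mult MM (ct_act actM (leg24 Uh4 (qsu2_cop UhUh g)) (tens MM x y)).
Proof.
rewrite /actR actM_prod so4_cop_tens; last exact: cop_lin.
by rewrite cop1 leg13_1 mul1r.
Qed.

Lemma leg13_act (a b : Uh) (x y : M) :
  ct_mult MM (ct_act actM (leg13 Uh4 (tens UhUh a b)) (tens MM x y)) =
  actL a x * actL b y.
Proof. by rewrite leg13E (ct_actE actM_bilin) ct_multE. Qed.

Lemma leg24_act (a b : Uh) (x y : M) :
  ct_mult MM (ct_act actM (leg24 Uh4 (tens UhUh a b)) (tens MM x y)) =
  actR a x * actR b y.
Proof. by rewrite leg24E (ct_actE actM_bilin) ct_multE. Qed.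

Lemma leg13_act_lin (x y : M) : linear (fun u : UhUh =>
  ct_mult MM (ct_act actM (leg13 Uh4 u) (tens MM x y))).
Proof.
exact (lin_comp (ct_mult_lin MM hM)
  (lin_comp (ct_act_linl actM_bilin _) (leg13_lin Uh4))).
Qed.

Lemma leg24_act_lin (x y : M) : linear (fun u : UhUh =>
  ct_mult MM (ct_act actM (leg24 Uh4 u) (tens MM x y))).
Proof.
exact (lin_comp (ct_mult_lin MM hM)
  (lin_comp (ct_act_linl actM_bilin _) (leg24_lin Uh4))).
Qed.

Lemma actLM g h x : actL (g * h) x = actL g (actL h x).
Proof. by rewrite /actL -actMM tens_mul mulr1. Qed.
Lemma actRM g h x : actR (g * h) x = actR g (actR h x).
Proof. by rewrite /actR -actMM tens_mul mulr1. Qed.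
Lemma actLR g h x : actL g (actR h x) = actM (tens UhUh g h) x.
Proof. by rewrite /actL /actR -actMM tens_mul mulr1 mul1r. Qed.
Lemma actL_bilin : bilin actL.
Proof.
split=> [g|x]; first exact: actM_linr.
exact (lin_comp (actM_linl x) (tens_linl UhUh 1)).
Qed.
Lemma actR_bilin : bilin actR.
Proof.
split=> [g|x]; first exact: actM_linr.
exact (lin_comp (actM_linl x) (tens_linr UhUh 1)).
Qed.

Context (T : forall n, 'I_n.+1 -> 'I_n.+1 -> M).
Hypothesis HT : is_T actM T.

Lemma T_max n : T (n := n) ord_max ord_max = MX M 1 1 ^+ n.
Proof. by case: (HT n). Qed.

(** Evaluation at scalar matrices sends d^n to X^n. The nonvanishing rules out the default value in
    [qspinP]. *)
Lemma MX_neq0 n : MX M 1 1 ^+ n <> 0.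
Proof.
have [eps [[epsL [eps1 epsM]] epsX]] := eps_exists M.
move/(congr1 eps); rewrite (lin0 epsL).
have -> : eps (MX M 1 1 ^+ n) = series_const ('X ^+ n).
  elim: n => [|n IH]; first by rewrite !expr0 eps1.
  by rewrite !exprS epsM IH epsX /diagX eqxx series_constM.
move/(congr1 (fun s : {series {poly K}} => cf s 0)) => /= /eqP.
by rewrite -size_poly_eq0 size_polyXn.
Qed.

Definition qspin_spec n (rho : Uh -> 'M[{series K}]_n.+1) := [/\ alg_hom rho,
  rho (QE Uh) = spinE _ n, rho (QH Uh) = spinH _ n & rho (QF Uh) = spinF _ n].

(** If the spin representation were its default 0, then 1 would annihilate the highest element
    d^(2j) of the family T. *)
Lemma qspinP n : @qspin_spec n (qspin n).
Proof.
have [//|E] := the_or (fun=> 0) (@qspin_spec n).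
have {E} rho0 : qspin (Uh := Uh) n = fun=> 0 by [].
case: (MX_neq0 (n := n)); rewrite -T_max.
have [_ /(_ 1 1)] := HT n; rewrite tens_one => HT1.
rewrite -[LHS]actM1 HT1 big1 // => k _; rewrite big1 // => k' _.
by rewrite rho0 mxE mul0r scale0r.
Qed.

Lemma qspin1 n : qspin (Uh := Uh) n 1 = 1.
Proof. by case: (qspinP n) => -[_ []]. Qed.

Lemma sum_delta_r n m (c : 'I_n -> {series K}) (V : lmodType {series K})
    (W : 'I_n -> 'I_m.+1 -> V) i' :
  \sum_k \sum_k' (c k * (1 : 'M[{series K}]_m.+1) k' i') *: W k k' =
  \sum_k c k *: W k i'.
Proof.
apply: eq_bigr => k _; rewrite (bigD1 i') //= mxE eqxx mulr1 big1 ?addr0 //.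
by move=> k' /negPf ne; rewrite mxE ne mulr0 scale0r.
Qed.

Lemma sum_delta_l n m (c : 'I_n -> {series K}) (V : lmodType {series K})
    (W : 'I_m.+1 -> 'I_n -> V) i :
  \sum_k \sum_k' ((1 : 'M[{series K}]_m.+1) k i * c k') *: W k k' =
  \sum_k' c k' *: W i k'.
Proof.
rewrite (bigD1 i) //= [X in _ + X]big1 ?addr0.
  by apply: eq_bigr => k' _; rewrite mxE eqxx mul1r.
by move=> k /negPf ne; rewrite big1 // => k' _; rewrite mxE ne mul0r scale0r.
Qed.

Lemma actL_X g m m' : actL g (MX M m m') = \sum_k qspin 1 g k m *: MX M k m'.
Proof. by rewrite /actL actM_X qspin1 sum_delta_r. Qed.
Lemma actR_X g m m' : actR g (MX M m m') = \sum_k qspin 1 g k m' *: MX M m k.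
Proof. by rewrite /actR actM_X qspin1 sum_delta_l. Qed.
Lemma actL_T n g (i i' : 'I_n.+1) :
  actL g (T i i') = \sum_k qspin n g k i *: T k i'.
Proof.
have [_ H] := HT n.
by rewrite /actL H qspin1 sum_delta_r.
Qed.
Lemma actR_T n g (i i' : 'I_n.+1) :
  actR g (T i i') = \sum_k qspin n g k i' *: T i k.
Proof.
have [_ H] := HT n.
by rewrite /actR H qspin1 sum_delta_l.
Qed.

Lemma sum_diag n (c : K) i (V : lmodType {series K}) (W : 'I_n -> V) (d : 'I_n -> K) :
  d i = c ->
  \sum_k (if k == i then series_const (d i) else 0) *: W k = series_const c *: W i.
Proof.
move=> dc; rewrite (bigD1 i) //= eqxx dc big1 ?addr0 // => k /negPf ->.
by rewrite scale0r.
Qed.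

Definition wt (m : 'I_2) : K := 2 * weight _ 1 m.

Lemma actL_one_sided : one_sided actL (fun m _ => wt m).
Proof.
have [_ cE cH cF] := copP.
split.
- exact: actL_bilin.
- exact: actLM.
- by move=> x; rewrite /actL tens_one actM1.
- move=> x y; rewrite actL_prod cE (linD (leg13_act_lin x y)) !leg13_act.
  by rewrite /actL tens_one actM1.
- move=> x y; rewrite actL_prod cF (linD (leg13_act_lin x y)) !leg13_act.
  by rewrite /actL tens_one actM1.
- move=> x y; rewrite actL_prod cH (linD (leg13_act_lin x y)) !leg13_act.
  by rewrite /actL tens_one !actM1.
move=> m m'; rewrite /weight_vector actL_X; have [_ _ -> _] := qspinP 1.
under eq_bigr do rewrite mxE.
exact: (@sum_diag _ _ _ _ _ (fun m : 'I_2 => 2 * weight _ 1 m)).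
Qed.

Lemma actR_one_sided : one_sided actR (fun _ m => wt m).
Proof.
have [_ cE cH cF] := copP.
split.
- exact: actR_bilin.
- exact: actRM.
- by move=> x; rewrite /actR tens_one actM1.
- move=> x y; rewrite actR_prod cE (linD (leg24_act_lin x y)) !leg24_act.
  by rewrite /actR tens_one actM1.
- move=> x y; rewrite actR_prod cF (linD (leg24_act_lin x y)) !leg24_act.
  by rewrite /actR tens_one actM1.
- move=> x y; rewrite actR_prod cH (linD (leg24_act_lin x y)) !leg24_act.
  by rewrite /actR tens_one !actM1.
move=> m m'; rewrite /weight_vector actR_X; have [_ _ -> _] := qspinP 1.
under eq_bigr do rewrite mxE.
exact: (@sum_diag _ _ _ _ _ (fun m : 'I_2 => 2 * weight _ 1 m)).
Qed.
End Action.

(** * The quantum determinant *)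

Section Invariant.
Context (K : numFieldType) (Uh : qsu2_env K) (M : M2_space K).
Hypotheses (tfU : htorsionfree Uh) (tfM : htorsionfree M).
Context (a : Uh -> M -> M) (w : 'I_2 -> 'I_2 -> K) (os : one_sided a w).

(** The g that commute with multiplication by z form a closed subalgebra. It contains the
    generators: one term of each twisted Leibniz rule vanishes, and e^(-hH) fixes z. *)
Lemma os_invariant z : a (QE Uh) z = 0 -> a (QF Uh) z = 0 ->
  weight_vector a 0 z -> forall g x, a g (z * x) = z * a g x.
Proof.
move=> Ez Fz Hz.
have PC : hclosed (fun g => forall x, True -> a g (z * x) = z * a g x).
  apply: hclosed_all => x _; apply: (hclosed_eq (M2_hadic M)).
    exact: (os_linl os).
  exact (lin_mull z (os_linl os x)).
have P1 x : True -> a 1 (z * x) = z * a 1 x by rewrite !(os1 os).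
have PM g h : (forall x, True -> a g (z * x) = z * a g x) ->
    (forall x, True -> a h (z * x) = z * a h x) ->
    forall x, True -> a (g * h) (z * x) = z * a (g * h) x.
  by move=> Hg Hh x _; rewrite !(osM os) Hh // Hg.
move=> g x; apply: (qsu2_density (P := ClosedSubalg PC P1 PM) tfU) => // {g}x _.
- by rewrite (osE os) Ez mul0r add0r.
- by rewrite (osH os) Hz series_const0 scale0r mul0r add0r.
- by rewrite (osF os) Fz mul0r add0r (weight_hexp os _ Hz) mulr0 qpow0 scale1r.
Qed.
End Invariant.

Section QuantumDeterminant.
Context (S : comNzRingType) (A : algType S) (q q' : S) (a b c d : A).
Hypotheses (q'q : q' * q = 1) (ab : a * b = q *: (b * a)) (ac : a * c = q *: (c * a))
  (bd : b * d = q *: (d * b)) (cd : c * d = q *: (d * c)) (bc : b * c = c * b)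
  (ad : a * d - d * a = (q - q') *: (b * c)).
Let D := a * d - q *: (b * c).

Let db : d * b = q' *: (b * d).
Proof. by rewrite bd scalerA q'q scale1r. Qed.
Let dc : d * c = q' *: (c * d).
Proof. by rewrite cd scalerA q'q scale1r. Qed.
Let abc : a * (b * c) = (q * q) *: (b * c * a).
Proof. by rewrite mulrA ab -scalerAl -[b * a * c]mulrA ac -scalerAr scalerA mulrA. Qed.
Let bcd : b * c * d = (q * q) *: (d * (b * c)).
Proof. by rewrite -mulrA cd -scalerAr [b * (d * c)]mulrA bd -scalerAl scalerA mulrA. Qed.

(** Here [q'] is the inverse of q. Moving a to the right of bc costs q^2 and the commutator [a,d]
    contributes (q - q^-1) q^2; the sides agree since (q - q^-1) q^2 + q = q^3. *)
Lemma qdet_a : D * a = a * D.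
Proof.
rewrite /D mulrBl mulrBr -scalerAl -scalerAr abc -[a * d * a]mulrA.
have -> : d * a = a * d - (q - q') *: (b * c) by rewrite -ad subKr.
rewrite mulrBr -scalerAr abc -addrA !scalerA -opprD -scalerDl.
have -> // : (q - q') * (q * q) + q = q * (q * q).
by rewrite mulrBl [q' * _]mulrA q'q mul1r subrK.
Qed.

Lemma qdet_b : D * b = b * D.
Proof.
rewrite /D mulrBl mulrBr -scalerAl -scalerAr.
have -> : b * c * b = b * (b * c) by rewrite -mulrA bc.
have -> // : a * d * b = b * (a * d).
by rewrite -mulrA db -scalerAr [a * (b * d)]mulrA ab -scalerAl scalerA q'q scale1r mulrA.
Qed.

Lemma qdet_c : D * c = c * D.
Proof.
rewrite /D mulrBl mulrBr -scalerAl -scalerAr.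
have -> : b * c * c = c * (b * c) by rewrite mulrA -bc.
have -> // : a * d * c = c * (a * d).
by rewrite -mulrA dc -scalerAr [a * (c * d)]mulrA ac -scalerAl scalerA q'q scale1r mulrA.
Qed.

Lemma qdet_d : D * d = d * D.
Proof.
(* In the opposite order of a and d the determinant is da - q^-1 bc; with one side written in each
   order, the commutator does not come up again. *)
have DE : D = d * a - q' *: (b * c).
  have adE : a * d = d * a + (q - q') *: (b * c) by rewrite -ad addrC subrK.
  by rewrite /D adE -addrA -scalerBl addrAC subrr add0r scaleNr.
rewrite {1}DE /D mulrBl mulrBr -scalerAl -scalerAr bcd scalerA.
by rewrite [q' * _]mulrA q'q mul1r -[d * a * d]mulrA.
Qed.
End QuantumDeterminant.

Section Determinant.
Context (R : realType).
Local Notation K := R[i].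
Context (M : M2_space K).
Hypothesis tfM : htorsionfree M.

Lemma qpowVK (x : K) : qpow (- x) * qpow x = 1.
Proof. by rewrite -qpowD addNr qpow0. Qed.

Lemma det_q_central (x : M) : det_q M * x = x * det_q M.
Proof.
have [[ab ac] [bd cd] bc ad] := M2_relations M.
pose P := fun y => det_q M * y = y * det_q M.
have PC : hclosed P.
  apply: (hclosed_eq (M2_hadic M)).
    exact (lin_mull _ (@lin_id _ _)).
  exact (lin_mulr _ (@lin_id _ _)).
have P1 : P 1 by rewrite /P mulr1 mul1r.
have PM y z : P y -> P z -> P (y * z).
  by rewrite /P => Py Pz; rewrite mulrA Py -!mulrA Pz.
apply: (M2_density (P := ClosedSubalg PC P1 PM) tfM) => /=.
have Pa := qdet_a (qpowVK 1) ab ac ad.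
have Pb := qdet_b (qpowVK 1) ab bd bc.
have Pc := qdet_c (qpowVK 1) ac cd bc.
have Pd := qdet_d (qpowVK 1) bd cd ad.
have two (i : 'I_2) : i = 0 \/ i = 1.
  by case: i => -[|[|//]] ?; [left | right]; apply: val_inj.
by move=> m m'; case: (two m) => ->; case: (two m') => ->.
Qed.

Context (Uh : qsu2_env K) (UhUh : ctensor Uh Uh) (Uh4 : ctensor UhUh UhUh).
Context (MM : ctensor M M) (actM : UhUh -> M -> M).
Hypothesis HactM : is_M2_action Uh4 MM actM.
Context (T : forall n, 'I_n.+1 -> 'I_n.+1 -> M).
Hypothesis HT : is_T actM T.
Hypothesis tfU : htorsionfree Uh.
Let osL := actL_one_sided HactM HT.
Let osR := actR_one_sided HactM HT.

Definition spin1E : {series K} := spinE K 1 1 0.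
Definition spin1F : {series K} := spinF K 1 0 1.

Lemma actL_EX m' : actL actM (QE Uh) (MX M 0 m') = spin1E *: MX M 1 m' /\
  actL actM (QE Uh) (MX M 1 m') = 0.
Proof.
rewrite !(actL_X HactM HT); have [_ -> _ _] := qspinP HactM HT 1.
rewrite !big_ord_recl !big_ord0 !mxE /= !scale0r !addr0 add0r; split=> //.
by rewrite /spin1E mxE /=; congr (_ *: MX M _ _); apply: val_inj.
Qed.
Lemma actL_FX m' : actL actM (QF Uh) (MX M 1 m') = spin1F *: MX M 0 m' /\
  actL actM (QF Uh) (MX M 0 m') = 0.
Proof.
rewrite !(actL_X HactM HT); have [_ _ _ ->] := qspinP HactM HT 1.
rewrite !big_ord_recl !big_ord0 !mxE /= !scale0r !addr0; split=> //.
by rewrite /spin1F mxE /=; congr (_ *: MX M _ _); apply: val_inj.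
Qed.
Lemma actR_EX m : actR actM (QE Uh) (MX M m 0) = spin1E *: MX M m 1 /\
  actR actM (QE Uh) (MX M m 1) = 0.
Proof.
rewrite !(actR_X HactM HT); have [_ -> _ _] := qspinP HactM HT 1.
rewrite !big_ord_recl !big_ord0 !mxE /= !scale0r !addr0 add0r; split=> //.
by rewrite /spin1E mxE /=; congr (_ *: MX M _ _); apply: val_inj.
Qed.
Lemma actR_FX m : actR actM (QF Uh) (MX M m 1) = spin1F *: MX M m 0 /\
  actR actM (QF Uh) (MX M m 0) = 0.
Proof.
rewrite !(actR_X HactM HT); have [_ _ _ ->] := qspinP HactM HT 1.
rewrite !big_ord_recl !big_ord0 !mxE /= !scale0r !addr0; split=> //.
by rewrite /spin1F mxE /=; congr (_ *: MX M _ _); apply: val_inj.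
Qed.

Lemma wt0 : wt R 0 = -1.
Proof. by rewrite /wt /weight /=; field. Qed.
Lemma wt1 : wt R 1 = 1.
Proof. by rewrite /wt /weight /= modn_small //; field. Qed.

Lemma det_weight (act : Uh -> M -> M) w : one_sided act w ->
  w 0 0 + w 1 1 = 0 -> w 0 1 + w 1 0 = 0 -> weight_vector act 0 (det_q M).
Proof.
move=> os w1 w2; have H := os_linr os (QH Uh).
have := weight_mul os (osX os 0 0) (osX os 1 1); rewrite w1 => Had.
have := weight_mul os (osX os 0 1) (osX os 1 0); rewrite w2 => Hbc.
rewrite /weight_vector /det_q (linB H) (linZ H) Had Hbc.
by rewrite series_const0 !scale0r scaler0 subr0.
Qed.

(** E and F annihilate det_q because what remains is a multiple of cd - q dc, respectively of ab - q
    ba. *)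
Lemma actL_det g x : actL actM g (det_q M * x) = det_q M * actL actM g x.
Proof.
have [[ab ac] [bd cd] bc ad] := M2_relations M.
move: g x; apply: (os_invariant tfU osL).
- rewrite /det_q (linB (os_linr osL _)) (linZ (os_linr osL _)) !(osE osL).
  rewrite !(proj1 (actL_EX _)) !(proj2 (actL_EX _)) !mulr0 !addr0.
  rewrite !(weight_hexp osL _ (osX osL _ _)) wt1 mul1r -!scalerAl -!scalerAr.
  by rewrite cd !scalerA [spin1E * qpow 1]mulrC subrr.
- rewrite /det_q (linB (os_linr osL _)) (linZ (os_linr osL _)) !(osF osL).
  rewrite !(proj1 (actL_FX _)) !(proj2 (actL_FX _)) !mul0r !add0r.
  rewrite !(weight_hexp osL _ (osX osL _ _)) wt0 mulrNN mul1r -!scalerAl -!scalerAr.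
  by rewrite ab !scalerA mulrAC subrr.
by apply: (det_weight osL); rewrite wt0 wt1 ?addNr ?subrr.
Qed.

Lemma actR_det g x : actR actM g (det_q M * x) = det_q M * actR actM g x.
Proof.
have [[ab ac] [bd cd] bc ad] := M2_relations M.
move: g x; apply: (os_invariant tfU osR).
- rewrite /det_q (linB (os_linr osR _)) (linZ (os_linr osR _)) !(osE osR).
  rewrite !(proj1 (actR_EX _)) !(proj2 (actR_EX _)) !mulr0 mul0r addr0 add0r.
  rewrite !(weight_hexp osR _ (osX osR _ _)) wt1 mul1r -!scalerAl -!scalerAr.
  by rewrite !scalerA mulrC subrr.
- rewrite /det_q (linB (os_linr osR _)) (linZ (os_linr osR _)) !(osF osR).
  rewrite !(proj1 (actR_FX _)) !(proj2 (actR_FX _)) !mul0r mulr0 add0r addr0.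
  rewrite !(weight_hexp osR _ (osX osR _ _)) wt0 mulrNN mul1r -!scalerAl -!scalerAr.
  by rewrite !scalerA mulrC subrr.
by apply: (det_weight osR); rewrite wt0 wt1 ?addNr ?subrr.
Qed.

Lemma actM_det k g g' x : actM (tens UhUh g g') (det_q M ^+ k * x) =
  det_q M ^+ k * actM (tens UhUh g g') x.
Proof.
elim: k x => [|k IH] x; first by rewrite expr0 !mul1r.
by rewrite exprS -!mulrA -(actLR HactM) actR_det actL_det (actLR HactM) IH.
Qed.
End Determinant.

(** * Spin representations *)

Section Units.
Context (K : comNzRingType).

(** Geometric series in 1 - x, whose k-th power is divisible by h^k. *)
Lemma hadic_unit (A : algType {series K}) (x : A) :
  hadic A -> hcong 1 x 1 -> invertible x.
Proof.
move=> hA [z Ez]; rewrite expr1 in Ez.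
pose y := - (hvar K *: z).
have xE : x = 1 - y by rewrite opprK addrC -Ez subrK.
have yX k : y ^+ k = hvar K ^+ k *: (- z) ^+ k.
  rewrite /y -scalerN; elim: k => [|k IH]; first by rewrite !expr0 scale1r.
  by rewrite !exprS IH -scalerAl -scalerAr scalerA.
have small k : hcong k (y ^+ k) 0.
  by exists ((- z) ^+ k); rewrite subr0.
have cv := hsumP hA small; exists (hsum (fun k => y ^+ k)).
have sumE n : x * (\sum_(k < n) y ^+ k) = 1 - y ^+ n.
  by rewrite xE -opprB mulNr -subrX1 opprB.
have comm n : (\sum_(k < n) y ^+ k) * x = x * (\sum_(k < n) y ^+ k).
  rewrite mulr_suml mulr_sumr; apply: eq_bigr => k _.
  by rewrite xE mulrBr mulrBl mulr1 mul1r -exprS -exprSr.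
have cv1 : hcvg (fun n => x * \sum_(k < n) y ^+ k) 1.
  move=> N; exists N => n le_Nn; rewrite sumE -[X in hcong _ _ X]subr0.
  apply: hcongD; first exact: hcong_refl.
  by rewrite -scaleN1r -[- 0]scaleN1r; apply/hcongZ/(hcongW le_Nn).
split; apply: hcvg_uniq hA _ cv1.
  apply: (hcvg_ext comm).
  exact: (hcvg_lin (lin_mulr x (@lin_id _ A)) cv).
exact: (hcvg_lin (lin_mull x (@lin_id _ A)) cv).
Qed.
End Units.

Lemma series_unit (K : fieldType) (c : {series K}) : cf c 0 != 0 ->
  exists d, d * c = 1.
Proof.
move=> c0; pose e := series_const (cf c 0)^-1 * c : {series K}^o.
have /hadic_unit [] : hcong 1 e 1.
- by apply/scalar_congP => -[|//] _; rewrite cfM0 /= mulVf.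
- exact: hadic_scalar.
by move=> d [+ _]; rewrite mulrA; exists (d * series_const (cf c 0)^-1).
Qed.

Lemma scale_unit_inj (K : fieldType) (V : lmodType {series K}) (c : {series K}) :
  cf c 0 != 0 -> injective (fun x : V => c *: x).
Proof.
move=> /series_unit[d dc] x y /= E.
by rewrite -[x]scale1r -dc -scalerA E scalerA dc scale1r.
Qed.

Section Ladder.
Context (K : numFieldType) (n : nat) (e h f : 'M[K]_n.+1).
Hypothesis rel : su2_rel e h f.
Hypothesis e0 : forall k i : 'I_n.+1, k != i.+1 :> nat -> e k i = 0.
Hypothesis hE : forall i : 'I_n.+1, h i i = i%:R *+ 2 - n%:R.

(** The diagonal entries of [E,F] = H form a recursion for the product of the coefficient of E from
    i to i+1 with that of F back; its solution is the classical (j+m+1)(j-m). Thus the coefficients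
    are controlled without evaluating the square roots that define them. *)
Lemma ladder_coef i (lti : (i < n)%N) :
  e (inord i.+1) (inord i) * f (inord i) (inord i.+1) = i.+1%:R * (n - i)%:R.
Proof.
have [_ _ rEF] := rel.
have diag k : (k <= n)%N -> (\sum_j e (inord k) j * f j (inord k)) -
    (\sum_j f (inord k) j * e j (inord k)) = k%:R *+ 2 - n%:R.
  move=> lek; have := congr1 (fun A : 'M_n.+1 => A (inord k) (inord k)) rEF.
  by rewrite hE !mxE inordK.
have fe k : (k < n)%N -> \sum_j f (inord k) j * e j (inord k) =
    e (inord k.+1) (inord k) * f (inord k) (inord k.+1).
  move=> ltk; rewrite (bigD1 (inord k.+1)) //= big1 ?addr0 1?mulrC // => j ne.
  rewrite e0 ?mulr0 // inordK ?ltnS ?(ltnW ltk) //.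
  by apply: contra ne => /eqP E; apply/eqP/val_inj; rewrite /= E inordK.
have ef k : (k < n)%N -> \sum_j e (inord k.+1) j * f j (inord k.+1) =
    e (inord k.+1) (inord k) * f (inord k) (inord k.+1).
  move=> ltk; rewrite (bigD1 (inord k)) //= big1 ?addr0 // => j ne.
  rewrite e0 ?mul0r // inordK //.
  apply: contra ne => /eqP [E]; apply/eqP/val_inj; rewrite /= -E inordK //.
  exact: ltnW.
elim: i lti => [|i IH] lti.
  have := diag 0 (leq0n n); rewrite fe // big1 => [E|j _].
    by rewrite subn0 mul1r; apply: oppr_inj; rewrite -[LHS]add0r E mul0rn add0r.
  by rewrite e0 ?mul0r // inordK.
have lti' := ltnW lti.
have := diag i.+1 lti'; rewrite fe // ef // IH // => E.
rewrite -[LHS](subKr (i.+1%:R * (n - i)%:R)) E.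
by rewrite !natrB // ?(ltnW lti') // -!natr1; ring.
Qed.
End Ladder.

Section SpinCoefficients.
Context (K : numFieldType).
Hypothesis rel0 : forall n,
  su2_rel (at_h0 (spinE K n)) (at_h0 (spinH K n)) (at_h0 (spinF K n)).

Lemma spinEF_unit n (i j : 'I_n.+1) : j = i.+1 :> nat ->
  cf (spinE K n j i) 0 != 0 /\ cf (spinF K n i j) 0 != 0.
Proof.
move=> ji; have lti : (i < n)%N by rewrite -ltnS -ji.
have E0 (k l : 'I_n.+1) : k != l.+1 :> nat -> at_h0 (spinE K n) k l = 0.
  by move=> /negPf ne; rewrite !mxE ne.
have H0 (k : 'I_n.+1) : at_h0 (spinH K n) k k = k%:R *+ 2 - n%:R.
  by rewrite !mxE eqxx /weight /= -mulr_natl; field.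
have := ladder_coef (rel0 n) E0 H0 lti.
have -> : inord i = i by apply: val_inj; rewrite /= inordK.
have -> : inord i.+1 = j by apply: val_inj; rewrite /= inordK ?ji.
rewrite [at_h0 _ j i]mxE [at_h0 _ i j]mxE => E.
apply/andP; rewrite -negb_or -mulf_eq0 E mulf_eq0.
by rewrite !Num.Theory.pnatr_eq0 subn_eq0 -ltnNge lti.
Qed.

(** E is the transpose of F e^(hH): both coefficients between neighbouring weights contain the same
    root, with the factors q^m and q^(-m) for the upper weight m. *)
Lemma spinEF_ratio n (i j : 'I_n.+1) : j = i.+1 :> nat ->
  spinE K n j i = qpow (2 * weight K n j) * spinF K n i j.
Proof.
move=> ji; have lti : (i < n)%N by rewrite -ltnS -ji.
rewrite !mxE ji !eqxx mulrA -qpowD subnSK //; congr (qpow _ * _).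
by rewrite /weight -natr1; ring.
Qed.
End SpinCoefficients.

(** * Values of the spin matrix elements at scalar matrices *)

Section EpsilonValues.
Context (R : realType).
Local Notation K := R[i].
Context (Uh : qsu2_env K) (UhUh : ctensor Uh Uh) (Uh4 : ctensor UhUh UhUh).
Context (M : M2_space K) (MM : ctensor M M) (actM : UhUh -> M -> M).
Hypothesis HactM : is_M2_action Uh4 MM actM.
Context (T : forall n, 'I_n.+1 -> 'I_n.+1 -> M).
Hypothesis HT : is_T actM T.
Hypotheses (tfU : htorsionfree Uh) (tfM : htorsionfree M).
Hypothesis rel0 : forall n,
  su2_rel (at_h0 (spinE K n)) (at_h0 (spinH K n)) (at_h0 (spinF K n)).
Context (eps : M -> {series {poly K}}) (Heps : is_eps eps).
Let osL := actL_one_sided HactM HT.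
Let osR := actR_one_sided HactM HT.
Local Notation aL := (actL actM).
Local Notation aR := (actR actM).

Let epsL := eps_lin Heps.

Lemma eps_genE m m' : eps (aL (QE Uh) (MX M m m')) =
  qpow (wt R m') *: eps (aR (QF Uh) (MX M m m')).
Proof.
have two (i : 'I_2) : i = 0 \/ i = 1.
  by case: i => -[|[|//]] ?; [left | right]; apply: val_inj.
case: (two m) => ->; case: (two m') => ->.
- by rewrite (proj1 (actL_EX HactM HT _)) (proj2 (actR_FX HactM HT _)) (linZ epsL)
    (epsX Heps) (lin0 epsL) !scaler0.
- rewrite (proj1 (actL_EX HactM HT _)) (proj1 (actR_FX HactM HT _)) !(linZ epsL).
  rewrite !(epsX Heps) /diagX !eqxx scalerA.
  have E : spin1E R = qpow (wt R 1) * spin1F R by exact: (@spinEF_ratio _ 1 0 1).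
  by rewrite E.
- by rewrite (proj2 (actL_EX HactM HT _)) (proj2 (actR_FX HactM HT _)) (lin0 epsL)
    scaler0.
by rewrite (proj2 (actL_EX HactM HT _)) (proj1 (actR_FX HactM HT _)) (linZ epsL)
    (epsX Heps) (lin0 epsL) !scaler0.
Qed.

Lemma T_weightL n (i i' : 'I_n.+1) :
  weight_vector aL (2 * weight K n i) (T i i').
Proof.
rewrite /weight_vector (actL_T HactM HT); have [_ _ -> _] := qspinP HactM HT n.
under eq_bigr do rewrite mxE.
exact: (@sum_diag _ _ _ _ _ (fun k => T k i') (fun m : 'I_n.+1 => 2 * weight _ n m)).
Qed.

Lemma T_weightR n (i i' : 'I_n.+1) :
  weight_vector aR (2 * weight K n i') (T i i').
Proof.
rewrite /weight_vector (actR_T HactM HT); have [_ _ -> _] := qspinP HactM HT n.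
under eq_bigr do rewrite mxE.
exact: (@sum_diag _ _ _ _ _ (fun k => T i k) (fun m : 'I_n.+1 => 2 * weight _ n m)).
Qed.

Lemma eps_Xn n : eps (MX M 1 1 ^+ n) = series_const ('X ^+ n).
Proof.
elim: n => [|n IH]; first by rewrite !expr0 (eps1 Heps).
by rewrite !exprS (epsM Heps) IH (epsX Heps) /diagX eqxx series_constM.
Qed.

(** For i different from i' the left and the right weight differ, yet eps exchanges them, so the
    value is 0. On the diagonal, neighbouring values agree by the exchange of E with F e^(hH), and
    the last one is that of d^(2j). *)
Lemma eps_T n (i i' : 'I_n.+1) :
  eps (T i i') = if i == i' then series_const ('X ^+ n) else 0.
Proof.
case: eqVneq => [<-{i'}|ne]; last first.
  have := eps_H tfM osL osR Heps (T i i'); rewrite T_weightL T_weightR !(linZ epsL).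
  move/eqP; rewrite -subr_eq0 -scalerBl => /eqP E.
  apply: (@scale_unit_inj _ _ (series_const (2 * weight K n i) -
    series_const (2 * weight K n i'))); last by rewrite E scaler0.
  rewrite /= subr_eq0 /weight; apply: contra ne => /eqP.
  move/mulfI => H; apply/eqP/val_inj/eqP => /=.
  rewrite -(Num.Theory.eqr_nat K); apply/eqP/(addIr (- (n%:R / 2))).
  by apply: H; rewrite Num.Theory.pnatr_eq0.
(* The exchange is applied to [T k j]: E on the left raises k to j, F on the right lowers j to k,
   and the two coefficients are the same unit. *)
have step (k j : 'I_n.+1) : j = k.+1 :> nat -> eps (T k k) = eps (T j j).
  move=> jk; have [eu _] := spinEF_unit rel0 jk.
  apply: (scale_unit_inj eu) => /=; have := eps_E tfM osL osR Heps eps_genE (T k j).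
  rewrite (weight_hexp osR _ (T_weightR k j)) (linZ (os_linr osR _)).
  rewrite (actL_T HactM HT) (actR_T HactM HT).
  have [_ -> _ ->] := qspinP HactM HT n.
  have -> : \sum_l spinE K n l k *: T l j = spinE K n j k *: T j j.
    rewrite (bigD1 j) //= big1 ?addr0 // => l /negPf ne.
    by rewrite mxE -jk (inj_eq val_inj) ne scale0r.
  have -> : \sum_l spinF K n l j *: T k l = spinF K n k j *: T k k.
    rewrite (bigD1 k) //= big1 ?addr0 // => l /negPf ne.
    by rewrite mxE jk eqSS (inj_eq val_inj) ne scale0r.
  by rewrite scalerA mul1r -(spinEF_ratio _ jk) !(linZ epsL).
rewrite -eps_Xn -(T_max HT).
(* Downward induction on i, from the highest weight where T is known. *)
move E : (n - i)%N => p; elim: p i E => [|p IH] i E.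
  have <- // : i = ord_max.
  by apply: val_inj => /=; apply/eqP; rewrite eqn_leq -[(i <= n)%N]ltnS ltn_ord -subn_eq0 E.
have lti : (i < n)%N by rewrite -subn_gt0 E.
have Ej : (inord i.+1 : 'I_n.+1) = i.+1 :> nat by rewrite inordK.
by rewrite (step i (inord i.+1)) // IH // Ej subnS E.
Qed.

Lemma eps_det : eps (det_q M) = series_const ('X ^+ 2).
Proof.
rewrite /det_q (linB epsL) (linZ epsL) !(epsM Heps) !(epsX Heps) /diagX /=.
by rewrite mul0r scaler0 subr0 -series_constM.
Qed.

Lemma eps_detX k x : eps (det_q M ^+ k * x) = series_const ('X ^+ (2 * k)) * eps x.
Proof.
rewrite (epsM Heps); congr (_ * _); elim: k => [|k IH]; first by rewrite !expr0 (eps1 Heps).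
by rewrite exprS (epsM Heps) IH eps_det -series_constM -exprD mulnS.
Qed.
End EpsilonValues.

(** * Functions on matrices with vanishing jets along the scalar matrices *)

Section PolynomialJets.
Context (K : numFieldType).
Local Notation X := {mpoly K[4]}.
Local Notation "''x_' k" := ('X_(inord k : 'I_4) : X) (at level 8, k at level 2).

Lemma mpoly_alg_ind (P : X -> Prop) : (forall c, P c%:MP) -> (forall i, P 'X_i) ->
  (forall f g, P f -> P g -> P (f + g)) -> (forall f g, P f -> P g -> P (f * g)) ->
  forall f, P f.
Proof.
move=> PC PX PD PM f; have P0 : P 0 by rewrite -(mpolyC0 4 K).
rewrite (mpolyE f); elim/big_ind: _ => // m _; rewrite -mul_mpolyC; apply: (PM) => //.
rewrite mpolyXE_id; elim/big_ind: _ => // [|i _]; first by rewrite -(mpolyC1 4 K).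
by elim: (m i) => [|k IH]; rewrite ?expr0 -?(mpolyC1 4 K) // exprS; apply: PM.
Qed.

Lemma mderivXU (i j : 'I_4) : ('X_i : X)^`M(j) = (i == j)%:R.
Proof.
rewrite mderivX mnm1E; case: eqP => [->|_]; last by rewrite scale0r.
by rewrite scale1r -mpolyX0; congr 'X_[_]; apply/mnmP => k; rewrite mnmBE subnn mnm0E.
Qed.

Definition diag_var (i : 'I_4) : {poly K} :=
  if (i == inord 0) || (i == inord 3) then 'X else 0.

(* The restriction of a function on matrices to the scalar matrices. *)
Definition diag_res (f : X) : {poly K} := mmap (@polyC K) diag_var f.

Lemma diag_resC c : diag_res c%:MP = c%:P.
Proof. exact: mmapC. Qed.
Lemma diag_resX i : diag_res 'X_i = diag_var i.
Proof. by rewrite /diag_res mmapX mmap1U. Qed.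
Lemma diag_resD f g : diag_res (f + g) = diag_res f + diag_res g.
Proof. exact: raddfD. Qed.
Lemma diag_resN f : diag_res (- f) = - diag_res f.
Proof. exact: raddfN. Qed.
Lemma diag_resM f g : diag_res (f * g) = diag_res f * diag_res g.
Proof. exact: rmorphM. Qed.
Lemma diag_resZ c f : diag_res (c *: f) = c *: diag_res f.
Proof. by rewrite -mul_mpolyC diag_resM diag_resC mul_polyC. Qed.

Lemma diag_res_coef0 f : (diag_res f)`_0 = f@_0%MM.
Proof.
move: f; apply: mpoly_alg_ind => [c|i|f g Hf Hg|f g Hf Hg].
- by rewrite diag_resC coefC eqxx mpolyCK.
- by rewrite diag_resX /diag_var mcoeffX mnm1_eq0; case: ifP; rewrite ?coefX ?coef0.
- by rewrite diag_resD coefD Hf Hg mcoeffD.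
by rewrite diag_resM coef0M Hf Hg rmorphM.
Qed.

Inductive sl2_gen := GenE | GenF | GenH.

(** The vector fields of sl2 acting on the left index m of X_{mm'}: E = c d/da + d d/db, F = a d/dc
    + b d/dd, and H has weight -1 on a, b and weight 1 on c, d. *)
Definition der_coef (s : sl2_gen) (k : nat) : X :=
  match s, k with
  | GenE, 0 => 'x_2 | GenE, 1 => 'x_3
  | GenF, 2 => 'x_0 | GenF, 3 => 'x_1
  | GenH, 0 => - 'x_0 | GenH, 1 => - 'x_1 | GenH, 2 => 'x_2 | GenH, 3 => 'x_3
  | _, _ => 0
  end.

Definition vfield (v : nat -> X) (f : X) : X := \sum_(k < 4) v k * f^`M(k).
Definition der s := vfield (der_coef s).
Definition euler := vfield (fun k => 'x_k).

Lemma vfieldD v f g : vfield v (f + g) = vfield v f + vfield v g.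
Proof. by rewrite -big_split; apply: eq_bigr => k _; rewrite mderivD mulrDr. Qed.
Lemma vfieldZ v c f : vfield v (c *: f) = c *: vfield v f.
Proof. by rewrite scaler_sumr; apply: eq_bigr => k _; rewrite mderivZ scalerAr. Qed.
Lemma vfieldM v f g : vfield v (f * g) = vfield v f * g + f * vfield v g.
Proof.
rewrite mulr_suml mulr_sumr -big_split; apply: eq_bigr => k _ /=.
by rewrite mderivM; ring.
Qed.
Lemma vfieldC v c : vfield v c%:MP = 0.
Proof. by rewrite /vfield big1 // => k _; rewrite mderivC mulr0. Qed.
Lemma vfield0 v : vfield v 0 = 0.
Proof. by rewrite /vfield big1 // => k _; rewrite mderiv0 mulr0. Qed.
Lemma vfieldX v i : vfield v 'X_i = v i.
Proof.
rewrite /vfield (bigD1 i) //= mderivXU eqxx mulr1 big1 ?addr0 // => k /negPf ne.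
by rewrite mderivXU eq_sym ne mulr0.
Qed.
Lemma vfieldN v f : vfield v (- f) = - vfield v f.
Proof. by rewrite -scaleN1r vfieldZ scaleN1r. Qed.

Lemma vfieldx v k : (k < 4)%N -> vfield v 'x_k = v k.
Proof. by move=> ltk; rewrite vfieldX inordK. Qed.

Lemma ord4_ind (P : 'I_4 -> Prop) :
  P (inord 0) -> P (inord 1) -> P (inord 2) -> P (inord 3) -> forall i, P i.
Proof.
move=> P0 P1 P2 P3 [k ltk].
have -> : Ordinal ltk = inord k by apply: val_inj; rewrite /= inordK.
by case: k ltk => [|[|[|[|k]]]].
Qed.

Lemma euler_der s f : euler (der s f) = der s (euler f).
Proof.
move: f; apply: mpoly_alg_ind => [c|i|f g Hf Hg|f g Hf Hg].
- by rewrite /euler /der !vfieldC ?vfield0.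
- rewrite /der /euler !vfieldX; move: i; apply: ord4_ind; rewrite !inordK //;
    by case: s => /=; rewrite ?vfieldN ?vfieldx // ?vfield0.
- by rewrite /euler /der !vfieldD -/euler -/der Hf Hg.
rewrite /euler /der !(vfieldM, vfieldD) -/(euler _) -/(der _ _).
by move: Hf Hg; rewrite /euler /der => -> ->; ring.
Qed.

(** The Euler field is tangent to the line of scalar matrices, so it preserves vanishing along this
    line. *)
Lemma diag_res_euler f : diag_res (euler f) = 'X * (diag_res f)^`().
Proof.
move: f; apply: mpoly_alg_ind => [c|i|f g Hf Hg|f g Hf Hg].
- by rewrite /euler vfieldC diag_resC derivC mulr0 -(mpolyC0 4 K) diag_resC.
- rewrite /euler vfieldX inord_val diag_resX /diag_var.
  by case: ifP; rewrite ?derivX ?mulr1 // derivC mulr0.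
- by rewrite /euler vfieldD !diag_resD Hf Hg derivD mulrDr.
by rewrite /euler vfieldM diag_resD !diag_resM Hf Hg derivM; ring.
Qed.

Definition det4 : X := 'x_0 * 'x_3 - 'x_1 * 'x_2.

Lemma diag_res_det4 : diag_res det4 = 'X ^+ 2.
Proof.
rewrite /det4 diag_resD diag_resN !diag_resM !diag_resX /diag_var.
by rewrite -!val_eqE /= !inordK // mul0r subr0 expr2.
Qed.

Lemma der_det4 s : der s det4 = 0.
Proof.
rewrite /der /det4 vfieldD vfieldN !vfieldM !vfieldx //.
by case: s => /=; ring.
Qed.

Definition iter_der (ws : seq sl2_gen) (f : X) := foldl (fun g s => der s g) f ws.

Lemma iter_derD ws f g : iter_der ws (f + g) = iter_der ws f + iter_der ws g.
Proof. by elim: ws f g => //= s ws IH f g; rewrite /der vfieldD IH. Qed.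
Lemma iter_derZ ws c f : iter_der ws (c *: f) = c *: iter_der ws f.
Proof. by elim: ws f => //= s ws IH f; rewrite /der vfieldZ IH. Qed.
Lemma iter_der_euler ws f : iter_der ws (euler f) = euler (iter_der ws f).
Proof. by elim: ws f => //= s ws IH f; rewrite -euler_der IH. Qed.
Lemma iter_der_det4 ws f : iter_der ws (det4 * f) = det4 * iter_der ws f.
Proof.
elim: ws f => //= s ws IH f.
by rewrite [der s _]vfieldM -/(der s det4) der_det4 mul0r add0r IH.
Qed.

Definition flat (f : X) := forall ws, diag_res (iter_der ws f) = 0.

Lemma flatD f g : flat f -> flat g -> flat (f + g).
Proof. by move=> Hf Hg ws; rewrite iter_derD diag_resD Hf Hg addr0. Qed.
Lemma flatZ c f : flat f -> flat (c *: f).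
Proof. by move=> Hf ws; rewrite iter_derZ diag_resZ Hf scaler0. Qed.
Lemma flat_der s f : flat f -> flat (der s f).
Proof. by move=> Hf ws; apply: (Hf (s :: ws)). Qed.
Lemma flat_euler f : flat f -> flat (euler f).
Proof. by move=> Hf ws; rewrite iter_der_euler diag_res_euler Hf deriv0 mulr0. Qed.
(** By the Leibniz rule a derivative of g f is a sum of products with a derivative of f, again flat;
    hence g and f stay general in the induction. *)
Lemma flatM g f : flat f -> flat (g * f).
Proof.
move=> Hf ws; elim: ws f Hf g => [|s ws IH] f Hf g /=.
  by rewrite diag_resM (Hf [::]) mulr0.
rewrite [der s _]vfieldM iter_derD diag_resD IH // IH ?addr0 //.
exact: flat_der.
Qed.
Lemma flat_det4 f : flat (det4 * f) -> flat f.
Proof.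
move=> Hf ws; have /eqP := Hf ws; rewrite iter_der_det4 diag_resM diag_res_det4.
by rewrite mulf_eq0 expf_eq0 polyX_eq0 => /eqP.
Qed.

(** The Euler field minus H is twice a d/da + b d/db, and plus H twice c d/dc + d d/dd. With E and F
    these are two linear systems of determinant ad - bc for the partial derivatives, which explains
    the factor 2 det. *)
Lemma flat_mderiv i f : flat f -> flat f^`M(i).
Proof.
move=> Hf; apply: flat_det4.
suff : flat ((2 : K) *: (det4 * f^`M(i))).
  by move/(flatZ 2^-1); rewrite scalerA mulVf ?scale1r // Num.Theory.pnatr_eq0.
have sumE v : vfield v f = v 0 * f^`M(inord 0) + v 1 * f^`M(inord 1) +
    v 2 * f^`M(inord 2) + v 3 * f^`M(inord 3).
  rewrite /vfield !big_ord_recr big_ord0 /= add0r.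
  by do !congr (_ + _); congr (_ * _^`M(_)); apply: val_inj; rewrite /= inordK.
have FE := flat_der GenE Hf; have FF := flat_der GenF Hf; have FH := flat_der GenH Hf.
have Fe := flat_euler Hf.
have FB g h : flat g -> flat h -> flat (g - h).
  by move=> Hg Hh; apply: flatD => //; rewrite -scaleN1r; apply: flatZ.
move: i; apply: ord4_ind.
- have -> : 2 *: (det4 * f^`M(inord 0)) =
      'x_3 * (euler f - der GenH f) - (2 *: 'x_1) * der GenE f.
    by rewrite /euler /der !sumE /= /det4 -!mul_mpolyC; ring.
  by apply: (FB); apply: flatM => //; apply: FB.
- have -> : 2 *: (det4 * f^`M(inord 1)) =
      (2 *: 'x_0) * der GenE f - 'x_2 * (euler f - der GenH f).
    by rewrite /euler /der !sumE /= /det4 -!mul_mpolyC; ring.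
  by apply: (FB); apply: flatM => //; apply: FB.
- have -> : 2 *: (det4 * f^`M(inord 2)) =
      (2 *: 'x_3) * der GenF f - 'x_1 * (euler f + der GenH f).
    by rewrite /euler /der !sumE /= /det4 -!mul_mpolyC; ring.
  by apply: FB; apply: flatM => //; apply: flatD.
have -> : 2 *: (det4 * f^`M(inord 3)) =
    'x_0 * (euler f + der GenH f) - (2 *: 'x_2) * der GenF f.
  by rewrite /euler /der !sumE /= /det4 -!mul_mpolyC; ring.
by apply: FB; apply: flatM => //; apply: flatD.
Qed.

(* Flat functions form an ideal stable under sl2 and the Euler field, hence, by
   Cramer's rule, under det times each partial derivative. *)
Lemma flat_eq0 f : flat f -> f = 0.
Proof.
move=> Hf; apply/mpolyP => m.
have flatm : flat f^`M[m].
  rewrite mderivm_foldr; elim: (flatten _) => //= i s IH; exact: flat_mderiv.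
have := flatm [::]; rewrite /= => /(congr1 (fun p : {poly K} => p`_0)).
rewrite diag_res_coef0 mcoeff_mderivm addm0 coef0 mcoeff0 => /eqP.
rewrite Num.Theory.mulrn_eq0 => /orP[/eqP E|/eqP //].
have : (0 < \prod_(i < 4) (m i) ^_ (m i))%N.
  by apply: prodn_gt0 => i; rewrite ffactnn fact_gt0.
by rewrite E.
Qed.
End PolynomialJets.

(** * The limit h to 0 and its sl2 action *)

Definition xgen (K : nzRingType) (m m' : 'I_2) : {mpoly K[4]} :=
  'X_(inord (2 * m + m')%N).

Section ClassicalLimit.
Context (K : numFieldType) (Uh : qsu2_env K) (M : M2_space K).
Hypothesis tfM : htorsionfree M.
Local Notation X := {mpoly K[4]}.

Definition h0_linear (V : lmodType K) (f : M -> V) :=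
  forall c x y, f (c *: x + y) = cf c 0 *: f x + f y.

Section H0Linear.
Context (V : lmodType K) (f : M -> V).
Hypothesis Hf : h0_linear f.
Lemma h0lin0 : f 0 = 0.
Proof. by have := Hf (-1) 0 0; rewrite scaler0 addr0 /= scaleN1r addNr. Qed.
Lemma h0linD x y : f (x + y) = f x + f y.
Proof. by rewrite -[x in LHS]scale1r Hf scale1r. Qed.
Lemma h0linZ c x : f (c *: x) = cf c 0 *: f x.
Proof. by rewrite -[_ *: x]addr0 Hf h0lin0 addr0. Qed.
Lemma h0linN x : f (- x) = - f x.
Proof. by have := h0linZ (-1) x; rewrite scaleN1r /= scaleN1r. Qed.
Lemma h0lin_sum I r (P : pred I) F :
  f (\sum_(i <- r | P i) F i) = \sum_(i <- r | P i) f (F i).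
Proof. exact: (big_morph f h0linD h0lin0). Qed.
Lemma h0lin_cong x y : hcong 1 x y -> f x = f y.
Proof.
case=> z E; rewrite -[x](subrK y) E expr1 Hf.
by rewrite (_ : cf (hvar K) 0 = 0) // scale0r add0r.
Qed.
End H0Linear.

Lemma h0lin_comp (V : lmodType K) (f : M -> V) (g : M -> M) :
  h0_linear f -> linear g -> h0_linear (fun x => f (g x)).
Proof. by move=> Hf Hg c x y; rewrite Hg Hf. Qed.

Lemma hclosed_h0lin (V : lmodType K) (f g : M -> V) :
  h0_linear f -> h0_linear g -> hclosed (fun x => f x = g x).
Proof.
move=> Hf Hg; split; first by rewrite (h0lin0 Hf) (h0lin0 Hg).
  by move=> c x y fx fy; rewrite Hf Hg fx fy.
move=> x /(_ 1%N)[y fy xy].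
by rewrite (h0lin_cong Hf xy) (h0lin_cong Hg xy).
Qed.

Definition is_limit (p : M -> X) :=
  [/\ h0_linear p, monoid_morphism p & forall m m', p (MX M m m') = xgen K m m'].

Context (p : M -> X) (Hp : is_limit p).

Lemma limit_lin : h0_linear p. Proof. by case: Hp. Qed.
Lemma limit1 : p 1 = 1. Proof. by case: Hp => _ []. Qed.
Lemma limitM x y : p (x * y) = p x * p y. Proof. by case: Hp => _ []. Qed.
Lemma limit_gen m m' : p (MX M m m') = xgen K m m'. Proof. by case: Hp. Qed.
Lemma limitX x n : p (x ^+ n) = p x ^+ n.
Proof. by elim: n => [|n IH]; rewrite ?expr0 ?limit1 // !exprS limitM IH. Qed.

Context (eps : M -> {series {poly K}}) (Heps : is_eps eps).

Lemma diag_xgen m m' : diag_res (xgen K m m') = if m == m' then 'X else 0.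
Proof.
have two (i : 'I_2) : i = 0 \/ i = 1.
  by case: i => -[|[|//]] ?; [left | right]; apply: val_inj.
rewrite /xgen diag_resX /diag_var -!val_eqE.
by case: (two m) => ->; case: (two m') => ->; rewrite /= ?inordK.
Qed.

Lemma eps_limit x : cf (eps x) 0 = diag_res (p x).
Proof.
move: x; apply: (M2_ind tfM).
- apply: hclosed_h0lin => c x y.
    by rewrite (eps_lin Heps) cfD /= big_ord_recl big_ord0 addr0.
  by rewrite limit_lin diag_resD diag_resZ.
- by rewrite (eps1 Heps) limit1 -(mpolyC1 4 K) diag_resC.
move=> m m' x IH; rewrite (epsM Heps) cfM0 limitM diag_resM IH (epsX Heps).
by rewrite limit_gen diag_xgen /diagX; case: eqP.
Qed.

Context (a : Uh -> M -> M) (w : 'I_2 -> 'I_2 -> K) (os : one_sided a w).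

Definition gen_of (s : sl2_gen) : Uh :=
  match s with GenE => QE Uh | GenF => QF Uh | GenH => QH Uh end.

Context (k : sl2_gen -> K).
Hypothesis k0 : forall s, k s != 0.
Hypothesis genX : forall s m m',
  p (a (gen_of s) (MX M m m')) = k s *: der s (xgen K m m').

(** Modulo h the factors e^(hH) and e^(-hH) become 1, so the twisted Leibniz rules turn into
    ordinary ones. The constants [k s] absorb the spin 1/2 coefficients of E and F. *)
Lemma limit_der s x : p (a (gen_of s) x) = k s *: der s (p x).
Proof.
have ph c y : p (a (hexp c (QH Uh)) y) = p y.
  exact: (h0lin_cong limit_lin (hexp_mod1 os c y)).
move: x; apply: (M2_ind tfM).
- apply: hclosed_h0lin => [|c x y].
    exact: (h0lin_comp limit_lin (os_linr os _)).
  by rewrite limit_lin /der vfieldD vfieldZ scalerDr !scalerA mulrC.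
- have -> : a (gen_of s) 1 = 0.
    by case: s; rewrite /= ?(osE1 os) ?(osF1 os) ?(osH1 os).
  by rewrite (h0lin0 limit_lin) limit1 -(mpolyC1 4 K) /der vfieldC scaler0.
move=> m m' x IH; rewrite limitM /der vfieldM -/(der s _) -/(der s _).
rewrite limit_gen scalerDr [_ *: (_ * der s (p x))]scalerAr scalerAl -IH -genX -limit_gen.
case: s {IH} => /=; rewrite ?(osE os) ?(osF os) ?(osH os) (h0linD limit_lin) !limitM.
- by rewrite ph.
- by rewrite ph.
by [].
Qed.

Definition eps_null x := forall g, eps (a g x) = 0.

(** Up to nonzero constants an iterated sl2 derivative of [p x] is the limit of some [a g x], and
    eps modulo h is restriction to the scalar matrices; so [p x] is flat. *)
Lemma eps_null_limit x : eps_null x -> p x = 0.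
Proof.
move=> Nx; apply: flat_eq0 => ws.
elim: ws x Nx => [|s ws IH] x Nx /=.
  by rewrite -eps_limit -[x](os1 os) Nx.
have -> : der s (p x) = p (series_const (k s)^-1 *: a (gen_of s) x).
  by rewrite (h0linZ limit_lin) limit_der scalerA /= mulVf ?scale1r.
apply: IH => g; rewrite (linZ (os_linr os _)) -(osM os) (linZ (eps_lin Heps)) Nx.
by rewrite scaler0.
Qed.
End ClassicalLimit.

(** * Products of spin matrix elements *)

Section SeriesMap.
Context (R : realType).
Local Notation K := R[i].
Definition to_K : {series R} -> {series K} := series_map (real_complex R).
Lemma to_KD x y : to_K (x + y) = to_K x + to_K y.
Proof. by apply: seriesP => n; rewrite /= rmorphD. Qed.
Lemma to_K0 : to_K 0 = 0.
Proof. by apply: seriesP => n; rewrite /= rmorph0. Qed.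
Lemma to_KM x y : to_K (x * y) = to_K x * to_K y.
Proof.
apply: seriesP => n; rewrite /= rmorph_sum; apply: eq_bigr => i _.
by rewrite rmorphM.
Qed.
Lemma to_K_sum I r (P : pred I) (F : I -> {series R}) :
  to_K (\sum_(i <- r | P i) F i) = \sum_(i <- r | P i) to_K (F i).
Proof. exact: (big_morph _ to_KD to_K0). Qed.
Lemma to_K_bool (b : bool) : to_K b%:R = b%:R.
Proof.
case: b; last exact: to_K0.
by apply: seriesP => -[|n] /=; rewrite ?rmorph1 ?rmorph0.
Qed.
End SeriesMap.

Section ProductFormula.
Context (R : realType).
Local Notation K := R[i].
Context (Uh : qsu2_env K) (UhUh : ctensor Uh Uh) (Uh4 : ctensor UhUh UhUh).
Context (M : M2_space K) (MM : ctensor M M) (actM : UhUh -> M -> M).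
Hypothesis HactM : is_M2_action Uh4 MM actM.
Context (T : forall n, 'I_n.+1 -> 'I_n.+1 -> M).
Hypothesis HT : is_T actM T.
Hypotheses (tfU : htorsionfree Uh) (tfM : htorsionfree M).
Hypothesis rel0 : forall n,
  su2_rel (at_h0 (spinE K n)) (at_h0 (spinH K n)) (at_h0 (spinF K n)).
Context (eps : M -> {series {poly K}}) (Heps : is_eps eps).
Context (Cq : CG_family {series R}).
Hypothesis Cq_int : CG_intertwines (@qspin _ Uh) (qsu2_cop UhUh)
  (fun n1 n2 n i1 i2 i => to_K (@Cq n1 n2 n i1 i2 i)).
Hypothesis Cq_orth : CG_orthogonal Cq.
Local Notation aL := (actL actM).
Local Notation aR := (actR actM).
Let osL := actL_one_sided HactM HT.
Let hM : hadic M := M2_hadic M.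
Let epsL := eps_lin Heps.

Let null x := eps_null eps aL x.

Lemma null0 : null 0.
Proof. by move=> g; rewrite (lin0 (os_linr osL g)) (lin0 epsL). Qed.
Lemma nullD x y : null x -> null y -> null (x + y).
Proof. by move=> Nx Ny g; rewrite (linD (os_linr osL g)) (linD epsL) Nx Ny addr0. Qed.
Lemma nullZ c x : null x -> null (c *: x).
Proof. by move=> Nx g; rewrite (linZ (os_linr osL g)) (linZ epsL) Nx scaler0. Qed.
Lemma null_sum I r (P : pred I) (F : I -> M) :
  (forall i, P i -> null (F i)) -> null (\sum_(i <- r | P i) F i).
Proof. by move=> H; elim/big_ind: _ => //; [exact: null0 | exact: nullD]. Qed.

(** Acting on a covariant family only recombines its members, so the vanishing of eps on the members
    is enough. *)
Lemma null_covariant n (F : 'I_n.+1 -> M) :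
  (forall g i, aL g (F i) = \sum_k qspin n g k i *: F k) ->
  (forall i, eps (F i) = 0) -> forall i, null (F i).
Proof.
move=> cov F0 i g; rewrite cov (lin_sum epsL) big1 // => k _.
by rewrite (linZ epsL) F0 scaler0.
Qed.

Lemma covariant_det n k (F : 'I_n.+1 -> M) :
  (forall g i, aL g (F i) = \sum_k qspin n g k i *: F k) ->
  forall g i, aL g (det_q M ^+ k * F i) = \sum_l qspin n g l i *: (det_q M ^+ k * F l).
Proof.
move=> cov g i; rewrite /actL (actM_det HactM HT tfU) -/(actL _ _ _) cov mulr_sumr.
by apply: eq_bigr => l _; rewrite scalerAr.
Qed.

Lemma covariantB n (F G : 'I_n.+1 -> M) :
  (forall g i, aL g (F i) = \sum_k qspin n g k i *: F k) ->
  (forall g i, aL g (G i) = \sum_k qspin n g k i *: G k) ->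
  forall g i, aL g (F i - G i) = \sum_k qspin n g k i *: (F k - G k).
Proof.
move=> HF HG g i; rewrite (linB (os_linr osL g)) HF HG -sumrB.
by apply: eq_bigr => k _; rewrite scalerBr.
Qed.

Lemma qspin_lin n k i : linear (fun g : Uh => qspin n g k i : {series K}^o).
Proof.
have [[L _] _ _ _] := qspinP HactM HT n.
by move=> c x y; rewrite L !mxE.
Qed.

Section Pair.
Context (n1 n2 : nat).
Local Notation J := ('I_n1.+1 * 'I_n2.+1)%type.

Lemma qtens_coefP (a b : J) :
  linear (tens_coef (AA := UhUh) (@qspin _ Uh) a.1 a.2 b.1 b.2 : UhUh -> {series K}^o) /\
  forall g h, tens_coef (@qspin _ Uh) a.1 a.2 b.1 b.2 (tens UhUh g h) =
    qspin n1 g a.1 b.1 * qspin n2 h a.2 b.2.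
Proof.
apply: (ct_liftP UhUh (hadic_scalar K)); split=> [g|h].
  exact (lin_mull _ (@qspin_lin n2 a.2 b.2)).
exact (lin_mulr _ (@qspin_lin n1 a.1 b.1)).
Qed.

Definition TT (a b : J) : M := T a.1 b.1 * T a.2 b.2.

Lemma actL_TT g (a b : J) : aL g (TT a b) =
  \sum_(c : J) tens_coef (@qspin _ Uh) c.1 c.2 a.1 a.2 (qsu2_cop UhUh g) *: TT c b.
Proof.
rewrite (actL_prod HactM); move: (qsu2_cop UhUh g).
apply: (@ct_ext _ _ _ UhUh M (fun u => ct_mult MM (ct_act actM (leg13 Uh4 u)
    (tens MM (T a.1 b.1) (T a.2 b.2)))) (fun u => \sum_(c : J)
  tens_coef (@qspin _ Uh) c.1 c.2 a.1 a.2 u *: TT c b) hM).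
- exact (leg13_act_lin HactM _ _).
- apply: lin_bigsum => c; apply: (@lin_scalel _ UhUh M) => //.
  exact (proj1 (qtens_coefP c a)).
move=> x y; rewrite (leg13_act HactM) !(actL_T HactM HT) big_distrlr /= pair_bigA.
apply: eq_bigr => c _ /=; rewrite (proj2 (qtens_coefP c a)).
by rewrite -scalerAl -scalerAr scalerA.
Qed.

Definition cq n (a : J) (i : 'I_n.+1) : {series K} := to_K (@Cq n1 n2 n a.1 a.2 i).

Lemma cq_orth n n' (i : 'I_n.+1) (i' : 'I_n'.+1) :
  CG_admissible n1 n2 n -> CG_admissible n1 n2 n' ->
  \sum_a cq a i * cq a i' = ((n == n') && (i == i' :> nat))%:R.
Proof.
move=> An An'; have [H _] := Cq_orth n1 n2.
rewrite -to_K_bool -(H n n' i i' An An') pair_bigA to_K_sum.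
by apply: eq_bigr => a _; rewrite to_KM.
Qed.

Lemma cq_complete (a b : J) :
  \sum_(n < (n1 + n2).+1 | CG_admissible n1 n2 n) \sum_(i < n.+1) cq a i * cq b i
  = (a == b)%:R.
Proof.
have [_ H] := Cq_orth n1 n2; have := congr1 (@to_K R) (H a.1 b.1 a.2 b.2).
rewrite to_K_bool -[(a == b)]/((a.1 == b.1) && (a.2 == b.2)) => <-.
rewrite to_K_sum; apply: eq_bigr => n _; rewrite to_K_sum.
by apply: eq_bigr => i _; rewrite to_KM.
Qed.

Lemma cq_expand (F : J -> M) a :
  F a = \sum_(n < (n1 + n2).+1 | CG_admissible n1 n2 n) \sum_(i < n.+1)
    cq a i *: (\sum_b cq b i *: F b).
Proof.
transitivity (\sum_b (a == b)%:R *: F b).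
  rewrite (bigD1 a) //= eqxx scale1r big1 ?addr0 // => b ne.
  by rewrite eq_sym (negPf ne) scale0r.
under eq_bigr => b _ do rewrite -cq_complete scaler_suml.
rewrite exchange_big /=; apply: eq_bigr => n _.
under eq_bigr => b _ do rewrite scaler_suml.
rewrite exchange_big /=; apply: eq_bigr => i _; rewrite scaler_sumr.
by apply: eq_bigr => b _; rewrite scalerA.
Qed.

(** Products of two matrix elements with the left indices coupled to spin n/2; [WW] couples the
    right indices too. In these terms the product formula says that [WW] is a Kronecker delta times
    a power of det_q times T. *)
Definition VV n (i : 'I_n.+1) (b : J) : M := \sum_a cq a i *: TT a b.
Definition WW n n' (i : 'I_n.+1) (i' : 'I_n'.+1) : M := \sum_b cq b i' *: VV i b.

Lemma VV_covariant n b : CG_admissible n1 n2 n -> forall g (i : 'I_n.+1),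
  aL g (VV i b) = \sum_k qspin n g k i *: VV k b.
Proof.
move=> An g i; rewrite (lin_sum (os_linr osL g)).
under eq_bigr => a _ do rewrite (linZ (os_linr osL g)) actL_TT scaler_sumr.
rewrite exchange_big /=.
under [RHS]eq_bigr => k _ do rewrite scaler_sumr.
rewrite [RHS]exchange_big /=; apply: eq_bigr => c _.
under eq_bigr => a _ do rewrite scalerA.
under [RHS]eq_bigr => k _ do rewrite scalerA.
rewrite -!scaler_suml; congr (_ *: _).
have := Cq_int An g c.1 c.2 i; rewrite pair_bigA => E.
transitivity (\sum_k cq c k * qspin n g k i); last first.
  by apply: eq_bigr => k _; rewrite mulrC.
by rewrite -[RHS]E; apply: eq_bigr => a _; rewrite mulrC.
Qed.

Lemma WW_covariant n n' (i' : 'I_n'.+1) : CG_admissible n1 n2 n ->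
  forall g (i : 'I_n.+1), aL g (WW i i') = \sum_k qspin n g k i *: WW k i'.
Proof.
move=> An g i; rewrite (lin_sum (os_linr osL g)).
under eq_bigr => b _ do rewrite (linZ (os_linr osL g)) VV_covariant // scaler_sumr.
rewrite exchange_big /=; apply: eq_bigr => k _; rewrite scaler_sumr.
by apply: eq_bigr => b _; rewrite !scalerA mulrC.
Qed.

Lemma eps_TT (a b : J) :
  eps (TT a b) = (a == b)%:R *: series_const ('X ^+ (n1 + n2)).
Proof.
rewrite (epsM Heps) !(eps_T HactM HT tfM rel0 Heps).
rewrite -[(a == b)]/((a.1 == b.1) && (a.2 == b.2)).
case: eqP => _; last by rewrite mul0r scale0r.
case: eqP => _; last by rewrite mulr0 scale0r.
by rewrite -series_constM -exprD scale1r.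
Qed.

(** Evaluation contracts the left pair of indices with the right pair, which leaves the scalar
    product of two columns of the orthogonal matrix C_q. *)
Lemma eps_WW n n' (i : 'I_n.+1) (i' : 'I_n'.+1) :
  CG_admissible n1 n2 n -> CG_admissible n1 n2 n' ->
  eps (WW i i') =
  ((n == n') && (i == i' :> nat))%:R *: series_const ('X ^+ (n1 + n2)).
Proof.
move=> An An'; rewrite -cq_orth // scaler_suml (lin_sum epsL).
apply: eq_bigr => b _; rewrite (linZ epsL) (lin_sum epsL).
rewrite (bigD1 b) //= big1 ?addr0 => [|a /negPf ne].
  by rewrite (linZ epsL) eps_TT eqxx scale1r scalerA mulrC.
by rewrite (linZ epsL) eps_TT ne scale0r scaler0.
Qed.

Definition TT_expansion (a b : J) : M :=
  \sum_(n < (n1 + n2).+1 | CG_admissible n1 n2 n) \sum_(i < n.+1) \sum_(i' < n.+1)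
    (cq a i * cq b i') *: (det_q M ^+ (n1 + n2 - n)./2 * T i i').

Lemma null_WW n n' (i : 'I_n.+1) (i' : 'I_n'.+1) :
  CG_admissible n1 n2 n -> CG_admissible n1 n2 n' -> n != n' -> null (WW i i').
Proof.
move=> An An' /negPf ne; move: i; apply: null_covariant.
  exact: WW_covariant.
by move=> i; rewrite eps_WW // ne scale0r.
Qed.

Lemma null_WW_diag n (i i' : 'I_n.+1) : CG_admissible n1 n2 n ->
  null (WW i i' - det_q M ^+ (n1 + n2 - n)./2 * T i i').
Proof.
move=> An; move: i; apply: null_covariant.
  apply: covariantB; first exact: WW_covariant.
  by apply: covariant_det => g i; rewrite (actL_T HactM HT).
move=> i; rewrite (linB epsL) eps_WW // eqxx (eps_detX Heps).
rewrite (eps_T HactM HT tfM rel0 Heps) -(inj_eq val_inj) /=.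
case: eqP => _; last by rewrite scale0r mulr0 subrr.
(* Each det_q contributes X^2, and admissibility makes n1 + n2 - n even, so the halving is exact. *)
rewrite scale1r -series_constM -exprD mul2n even_halfK ?subnK ?subrr //.
  by case/and4P: An.
by case/and4P: An => _ _ le; rewrite oddB // -oddD.
Qed.

Lemma null_product (a b : J) : null (TT a b - TT_expansion a b).
Proof.
have -> : TT a b = \sum_(n < (n1 + n2).+1 | CG_admissible n1 n2 n) \sum_(i < n.+1)
    cq a i *: VV i b by exact: (cq_expand (fun a => TT a b)).
rewrite /TT_expansion -sumrB; apply: null_sum => n An.
rewrite -sumrB; apply: null_sum => i _.
under [X in _ - X]eq_bigr => i' _ do rewrite -scalerA.
rewrite -scaler_sumr -scalerBr; apply: nullZ.
(* The left indices are already coupled; now the right ones are. The summand of the same spin is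
   compared with [TT_expansion], and all others are null. *)
rewrite (cq_expand (VV i) b) (bigD1 n) //= addrAC -sumrB; apply: nullD.
  apply: null_sum => i' _; rewrite -scalerBr; apply: nullZ.
  exact: null_WW_diag.
apply: null_sum => n' /andP[An' ne]; apply: null_sum => i' _; apply: nullZ.
by apply: null_WW; rewrite // eq_sym.
Qed.
End Pair.

(** Identifies spin 1/2 matrix elements with generators in the limit, so that multiplication by a
    generator falls under the product formula. *)
Lemma null_T1 m m' : null (T (n := 1) m m' - MX M m m').
Proof.
move: m; apply: null_covariant.
  apply: covariantB => g m; [exact: (actL_T HactM HT) | exact: (actL_X HactM HT)].
move=> m; rewrite (linB epsL) (eps_T HactM HT tfM rel0 Heps) (epsX Heps) expr1.
exact: subrr.
Qed.
End ProductFormula.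

(** * Spanning and the identification of the modules *)

Section Identification.
Context (R : realType).
Local Notation K := R[i].
Local Notation X := {mpoly K[4]}.
Context (Uh : qsu2_env K) (UhUh : ctensor Uh Uh) (Uh4 : ctensor UhUh UhUh).
Context (M : M2_space K) (MM : ctensor M M) (actM : UhUh -> M -> M).
Hypothesis HactM : is_M2_action Uh4 MM actM.
Context (T : forall n, 'I_n.+1 -> 'I_n.+1 -> M).
Hypothesis HT : is_T actM T.
Context (Phi : {series X} -> M) (HPhi : is_identification T Phi).
Hypothesis tfU : htorsionfree Uh.
Hypothesis rel0 : forall n,
  su2_rel (at_h0 (spinE K n)) (at_h0 (spinH K n)) (at_h0 (spinF K n)).
Context (Cq : CG_family {series R}).
Hypothesis Cq_int : CG_intertwines (@qspin _ Uh) (qsu2_cop UhUh)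
  (fun n1 n2 n i1 i2 i => to_K (@Cq n1 n2 n i1 i2 i)).
Hypothesis Cq_orth : CG_orthogonal Cq.
Local Notation aL := (actL actM).
Local Notation p := (@h_limit R M).
Let osL := actL_one_sided HactM HT.

Lemma Phi_lin : linear Phi. Proof. by case: HPhi. Qed.
Lemma Phi_basis k n (i i' : 'I_n.+1) :
  Phi (series_const (Defs.det0 R ^+ k * p (T i i'))) = det_q M ^+ k * T i i'.
Proof. by case: HPhi => _ _ ->. Qed.

Lemma M_torsionfree : htorsionfree M.
Proof.
have [PL [Psi PsiK PhiK] _] := HPhi.
move=> x E; rewrite -[x]PhiK -(lin0 PL); congr (Phi _).
apply: (@series_torsionfree K X); apply: (can_inj PsiK).
by rewrite (linZ PL) PhiK E (lin0 PL).
Qed.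
Let tfM := M_torsionfree.

(** With the default limit 0, the identification would send 0 to the element T of spin 0, which is
    1. *)
Lemma h_limitP : is_limit p.
Proof.
have [//|E] := the_or (fun=> 0) (fun p : M -> X =>
    [/\ forall c x y, p (c *: x + y) = cf c 0 *: p x + p y,
        monoid_morphism p & forall m m', p (MX M m m') = Xgen R m m']).
have {E} p0 : p = fun=> 0 by [].
have := Phi_basis 0 (ord_max : 'I_1) ord_max.
rewrite p0 mulr0 series_const0 (lin0 Phi_lin) mul1r (T_max HT) expr0 => /eqP.
by rewrite eq_sym oner_eq0.
Qed.

Definition gen_scalar (s : sl2_gen) : K :=
  match s with GenE => cf (spin1E R) 0 | GenF => cf (spin1F R) 0 | GenH => 1 end.

Lemma gen_scalar_neq0 s : gen_scalar s != 0.
Proof.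
have [E F] := @spinEF_unit _ rel0 1 0 1 erefl.
by case: s; rewrite /= ?oner_eq0.
Qed.

Lemma limit_genX s m m' : p (aL (gen_of Uh s) (MX M m m')) =
  gen_scalar s *: der s (xgen K m m').
Proof.
have two (i : 'I_2) : i = 0 \/ i = 1.
  by case: i => -[|[|//]] ?; [left | right]; apply: val_inj.
have pL := limit_lin h_limitP; have pX := limit_gen h_limitP.
rewrite /der /xgen vfieldX.
case: s => /=.
- case: (two m) => ->.
    rewrite (proj1 (actL_EX HactM HT _)) (h0linZ pL) pX /xgen.
    by case: (two m') => ->; rewrite inordK.
  rewrite (proj2 (actL_EX HactM HT _)) (h0lin0 pL).
  by case: (two m') => ->; rewrite inordK // scaler0.
- case: (two m) => ->.
    rewrite (proj2 (actL_FX HactM HT _)) (h0lin0 pL).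
    by case: (two m') => ->; rewrite inordK // scaler0.
  rewrite (proj1 (actL_FX HactM HT _)) (h0linZ pL) pX /xgen.
  by case: (two m') => ->; rewrite inordK.
rewrite (osX osL) (h0linZ pL) pX scale1r /= /xgen.
case: (two m) => ->; rewrite ?wt0 ?wt1 ?scaleN1r ?scale1r;
by case: (two m') => ->; rewrite inordK.
Qed.

Lemma null_limit eps : is_eps eps -> forall x, eps_null eps aL x -> p x = 0.
Proof.
move=> Heps x; apply: (eps_null_limit tfM h_limitP Heps osL gen_scalar_neq0).
exact: limit_genX.
Qed.

Lemma limit_det : p (det_q M) = Defs.det0 R.
Proof.
have pL := limit_lin h_limitP.
rewrite /det_q (h0linD pL) (h0linN pL) (h0linZ pL) !(limitM h_limitP).
rewrite !(limit_gen h_limitP).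
have -> : cf (qpow (1 : K)) 0 = 1 by rewrite /= expr0 divr1.
by rewrite scale1r.
Qed.

Lemma limit_detX k x : p (det_q M ^+ k * x) = Defs.det0 R ^+ k * p x.
Proof. by rewrite (limitM h_limitP) (limitX h_limitP) limit_det. Qed.

Lemma limit_T1 m m' : p (T (n := 1) m m') = xgen K m m'.
Proof.
have [eps Heps] := eps_exists M.
have := null_limit Heps (null_T1 HactM HT tfM rel0 Heps m m').
have pL := limit_lin h_limitP.
by rewrite (h0linD pL) (h0linN pL) (limit_gen h_limitP) => /eqP; rewrite subr_eq0 => /eqP.
Qed.

Lemma limit_product n1 n2 (a b : 'I_n1.+1 * 'I_n2.+1) :
  p (TT T a b) = p (TT_expansion T Cq a b).
Proof.
have [eps Heps] := eps_exists M.
have := null_limit Heps (null_product HactM HT tfU tfM rel0 Heps Cq_int Cq_orth a b).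
have pL := limit_lin h_limitP.
by rewrite (h0linD pL) (h0linN pL) => /eqP; rewrite subr_eq0 => /eqP.
Qed.

(** The span contains 1 and is stable under multiplication by each generator, a spin 1/2 matrix
    element, by the limit of the product formula. *)
Lemma X_span (S : X -> Prop) : S 0 -> (forall c f g, S f -> S g -> S (c *: f + g)) ->
  (forall k n (i i' : 'I_n.+1), S (Defs.det0 R ^+ k * p (T i i'))) -> forall f, S f.
Proof.
(* The span is the intersection of all admissible predicates, so stability under a multiplication
   can be tested on the predicate pulled back along it. *)
pose span f := forall S : X -> Prop, S 0 ->
  (forall c f g, S f -> S g -> S (c *: f + g)) ->
  (forall k n (i i' : 'I_n.+1), S (Defs.det0 R ^+ k * p (T i i'))) -> S f.
move=> S0 SL Sb f; suff : span f by apply.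
have span0 : span 0 by [].
have spanL c f1 g : span f1 -> span g -> span (c *: f1 + g).
  by move=> Hf Hg S' S0' SL' Sb'; apply: (SL'); [apply: Hf | apply: Hg].
have span_mul m m' f1 : span f1 -> span (f1 * xgen K m m').
  move=> Hf S' S0' SL' Sb'; apply: (Hf (fun f => S' (f * xgen K m m'))).
  - by rewrite mul0r.
  - by move=> c f2 g Sf Sg; rewrite mulrDl -scalerAl; apply: SL'.
  move=> k n i i'; rewrite -limit_T1 -mulrA -(limitM h_limitP).
  rewrite -[_ * T m m']/(TT T (i, m) (i', m')) limit_product /TT_expansion.
  have pL := limit_lin h_limitP.
  have SD f2 g : S' f2 -> S' g -> S' (f2 + g).
    by move=> Sf Sg; rewrite -[f2]scale1r; apply: SL'.
  rewrite (h0lin_sum pL) mulr_sumr; elim/big_ind: _ => // n' _.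
  rewrite (h0lin_sum pL) mulr_sumr; elim/big_ind: _ => // j _.
  rewrite (h0lin_sum pL) mulr_sumr; elim/big_ind: _ => // j' _.
  rewrite (h0linZ pL) limit_detX -scalerAr mulrA -exprD -[_ *: _]addr0.
  by apply: SL'.
have span1 : span 1.
  have -> : 1 = Defs.det0 R ^+ 0 * p (T (n := 0) ord_max ord_max).
    by rewrite (T_max HT) !expr0 mul1r (limit1 h_limitP).
  by move=> S' _ _; apply.
have span_mulX i f1 : span f1 -> span (f1 * 'X_i).
  move: i; apply: ord4_ind => Hf.
  - exact: (span_mul 0 0).
  - exact: (span_mul 0 1).
  - exact: (span_mul 1 0).
  exact: (span_mul 1 1).
rewrite (mpolyE f); elim/big_rec: _ => // m g _ Hg; apply: spanL => //.
rewrite mpolyXE_id; elim/big_rec: _ => // i g' _ Hg'; rewrite mulrC.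
by elim: (m i) => [|k IH]; rewrite ?expr0 ?mulr1 // exprSr mulrA; apply: span_mulX.
Qed.

(** Both sides depend only on [s] modulo h and agree on the spanning elements. *)
Lemma limit_Phi s : p (Phi s) = cf s 0.
Proof.
have pL := limit_lin h_limitP; have PL := Phi_lin.
have -> : p (Phi s) = p (Phi (series_const (cf s 0))).
  apply: (h0lin_cong pL); apply: (hcong_lin PL).
  by apply/series_congP => -[|//].
move: (cf s 0); apply: X_span.
- by rewrite series_const0 (lin0 PL) (h0lin0 pL).
- move=> c f g Hf Hg.
  by rewrite series_constD series_const_scale PL pL Hf Hg.
by move=> k n i i'; rewrite Phi_basis limit_detX.
Qed.

(** The limit of x vanishes, so x is h times some [Phi z]. As power series are torsion-free, [Phi z]
    is again null; iterating, x is divisible by every power of h. *)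
Lemma null_eq0 eps : is_eps eps -> forall x, eps_null eps aL x -> x = 0.
Proof.
move=> Heps x Nx; apply: (hadic_sep (M2_hadic M)) => N.
elim: N x Nx => [|N IH] x Nx; first exact: hcong0.
have [PL [Psi PsiK PhiK] _] := HPhi.
have := null_limit Heps Nx; rewrite -[x]PhiK limit_Phi => p0.
have [z Ez] : hcong 1 (Psi x) 0 by apply/series_congP => -[|//] _; rewrite p0.
rewrite subr0 expr1 in Ez.
have xE : x = hvar K *: Phi z by rewrite -(linZ PL) -Ez PhiK.
have /IH[y Ey] : eps_null eps aL (Phi z).
  move=> g; apply: (@series_torsionfree K {poly K}).
  by rewrite -(linZ (eps_lin Heps)) -(linZ (os_linr osL g)) -xE Nx.
exists y; rewrite PhiK subr0 xE; rewrite subr0 in Ey.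
by rewrite Ey scalerA -exprS.
Qed.

Lemma WW_off_diag n1 n2 n n' (i : 'I_n.+1) (i' : 'I_n'.+1) :
  CG_admissible n1 n2 n -> CG_admissible n1 n2 n' -> n != n' ->
  WW T Cq n1 n2 i i' = 0.
Proof.
have [eps Heps] := eps_exists M.
by move=> An An' ne; apply: (null_eq0 Heps); apply: (null_WW HactM HT tfM rel0 Heps).
Qed.

Lemma WW_diag n1 n2 n (i i' : 'I_n.+1) : CG_admissible n1 n2 n ->
  WW T Cq n1 n2 i i' = det_q M ^+ (n1 + n2 - n)./2 * T i i'.
Proof.
have [eps Heps] := eps_exists M.
move=> An; apply/eqP; rewrite -subr_eq0; apply/eqP/(null_eq0 Heps).
exact: (null_WW_diag HactM HT tfU tfM rel0 Heps).
Qed.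

Lemma Phi_ext (W : lmodType {series K}) (f g : {series X} -> W) :
  hadic W -> linear f -> linear g ->
  (forall k n (i i' : 'I_n.+1), f (series_const (Defs.det0 R ^+ k * p (T i i'))) =
     g (series_const (Defs.det0 R ^+ k * p (T i i')))) -> forall x, f x = g x.
Proof.
move=> hW Hf Hg fg; apply: series_lin_ext => //; apply: X_span => //.
- by rewrite series_const0 (lin0 Hf) (lin0 Hg).
- by move=> c x y fx fy; rewrite series_constD series_const_scale Hf Hg fx fy.
Qed.
End Identification.

(** * q-integers and invertibility of the R-matrix *)

Section QuantumIntegers.
Context (K : numFieldType).

Lemma series_hdiv (x : {series K}) : cf x 0 = 0 ->
  exists2 u, x = hvar K * u & cf u 0 = cf x 1.
Proof.
move=> x0; exists (Series (fun n => cf x n.+1)) => //.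
rewrite -[hvar K]expr1 hvar_mulE; apply: seriesP => -[|n] //=.
by rewrite subn1.
Qed.

Lemma series_divP (a b c : {series K}) : c * b = a -> series_div a b * b = a.
Proof. by move=> E; apply: (@theP _ 0 (fun c => c * b = a)); exists c. Qed.

Lemma qpow_diff (r : K) :
  cf (qpow r - qpow (- r)) 0 = 0 /\ cf (qpow r - qpow (- r)) 1 = 2 * r.
Proof. by rewrite /= !divr1 subrr opprK; split=> //; ring. Qed.

(** Numerator and denominator are both divisible by h, and (q - q^-1)/h is a unit with constant term
    2, so the quotient defining [n] exists. *)
Lemma qint_spec n : qint K n * qdiff K = qpow n%:R - qpow (- n%:R).
Proof.
have [d0 d1] := qpow_diff 1; have [u uE u0] := series_hdiv d0.
have [e0 e1] := qpow_diff n%:R; have [v vE v0] := series_hdiv e0.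
have [w wu] : exists w, w * u = 1.
  by apply: series_unit; rewrite u0 d1 mulr1 Num.Theory.pnatr_eq0.
apply: (@series_divP _ _ (v * w)).
by rewrite /qdiff uE vE mulrCA -mulrA wu mulr1.
Qed.

Lemma cfM1 (a b : {series K}) : cf (a * b) 1 = cf a 0 * cf b 1 + cf a 1 * cf b 0.
Proof. by rewrite /GRing.mul /= !big_ord_recl big_ord0 addr0. Qed.

Lemma qint0 n : cf (qint K n) 0 = n%:R.
Proof.
have [e0 e1] := qpow_diff n%:R; have [d0 d1] := qpow_diff 1.
have := congr1 (fun s => cf s 1) (qint_spec n); rewrite e1.
rewrite cfM1 d0 d1 mulr0 addr0 mulr1 mulrC.
by apply: mulfI; rewrite Num.Theory.pnatr_eq0.
Qed.

Lemma qfact_unit n : exists d, d * qfact K n = 1.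
Proof.
apply: series_unit; rewrite /qfact; elim: n => [|n IH].
  by rewrite big_nil oner_eq0.
rewrite big_nat_recr //= -/(GRing.mul _ _) [X in X != 0]cfM0 qint0.
by rewrite mulf_neq0 // Num.Theory.pnatr_eq0.
Qed.

Lemma Rcoef_small n : exists w,
  series_div (qdiff K ^+ n) (qfact K n) = w * hvar K ^+ n.
Proof.
have [d0 d1] := qpow_diff 1; have [u uE _] := series_hdiv d0.
have [d dq] := qfact_unit n.
have := @series_divP (qdiff K ^+ n) (qfact K n) (qdiff K ^+ n * d).
rewrite -mulrA dq mulr1 => /(_ erefl) E; exists (u ^+ n * d).
rewrite -[LHS]mulr1 -dq [d * _]mulrC mulrA E /qdiff uE exprMn.
by rewrite mulrC mulrA mulrAC [X in X * _]mulrC.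
Qed.

(** R is 1 modulo h: the n-th term of its sum contains (q - q^-1)^n, hence is divisible by h^n. *)
Lemma Rmatrix_unit (Uh : qsu2_env K) (UhUh : ctensor Uh Uh) :
  invertible (Rmatrix UhUh).
Proof.
have hUU := @ct_hadic _ _ _ UhUh.
apply: (hadic_unit hUU); rewrite /Rmatrix -[X in hcong _ _ X]mul1r.
apply: hcong_mul; first exact: hexp_mod.
set u := fun n => _.
have small n : hcong n (u n) 0.
  by rewrite /u; have [w ->] := Rcoef_small n; rewrite mulrA; exact: hterm_small.
have u0 : u 0 = 1.
  rewrite /u !expr0 tens_one !mul0r qpow0 mul1r.
  have := @series_divP 1 (qfact K 0) 1; rewrite /qfact big_nil !mulr1 => -> //.
  by rewrite scale1r.
by rewrite -[X in hcong _ _ X]u0; apply: hcong1_sum.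
Qed.
End QuantumIntegers.

Lemma inverseE (A : nzRingType) (x y : A) : y * x = 1 -> x * y = 1 -> inverse x = y.
Proof.
move=> yx xy; apply: the_eq => // z [zx _].
by rewrite -[z]mulr1 -xy mulrA zx mul1r.
Qed.

Lemma inverse_mapK (A : Type) (B : nzRingType) (f : B -> A) x :
  bijective f -> inverse_map f (f x) = x.
Proof. by move=> /bij_inj f_inj; apply: the_eq => // y /f_inj. Qed.

(** * The twist *)

Lemma su2_rel_image (K : comNzRingType) (U : su2_env K) (B : algType K) (rho : U -> B)
    (e h f : B) : alg_hom rho ->
  rho (UE U) = e -> rho (UH U) = h -> rho (UF U) = f -> su2_rel e h f.
Proof.
case=> rL [r1 rM] <- <- <-; have [h1 h2 h3] := su2_relations U.
split.
- by rewrite -(linMn rL) -h1 (linB rL) !rM.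
- by rewrite -(linMn rL) -(linN rL) -h2 (linB rL) !rM.
by rewrite -h3 (linB rL) !rM.
Qed.

Lemma mul_sum4 (A : pzRingType) (I1 I2 J1 J2 : finType) (f : I1 -> J1 -> A)
    (g : I2 -> J2 -> A) : (\sum_i \sum_j f i j) * (\sum_k \sum_l g k l) =
  \sum_(c : I1 * I2) \sum_(d : J1 * J2) f c.1 d.1 * g c.2 d.2.
Proof.
rewrite big_distrlr /= pair_bigA; apply: eq_bigr => c _ /=.
by rewrite big_distrlr /= pair_bigA.
Qed.

Section Assembly.
Context (R : realType).
Local Notation K := R[i].
Local Notation X := {mpoly K[4]}.
Context (U : su2_env K) (UU : ctensor {series U} {series U}) (U4 : ctensor UU UU).
Context (Uh : qsu2_env K) (UhUh : ctensor Uh Uh) (Uh4 : ctensor UhUh UhUh).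
Context (M : M2_space K) (MM : ctensor M M).
Context (XX : ctensor {series X} {series X}).
Context (alpha : Uh -> {series U}) (alphaA : alg_hom alpha) (alphaB : bijective alpha).
Hypothesis alpha_spin : forall n x, qspin n x = spin n (alpha x).
Context (actM : UhUh -> M -> M) (HactM : is_M2_action Uh4 MM actM).
Context (T : forall n, 'I_n.+1 -> 'I_n.+1 -> M) (HT : is_T actM T).
Context (actX : UU -> {series X} -> {series X}) (HactX : is_X_action T actX).
Context (Phi : {series X} -> M) (HPhi : is_identification T Phi).
Context (C : CG_family R) (Cq : CG_family {series R}).
Hypothesis Cq_int : CG_intertwines (@qspin _ Uh) (qsu2_cop UhUh)
  (fun n1 n2 n i1 i2 i => to_K (@Cq n1 n2 n i1 i2 i)).
Hypothesis Cq_orth : CG_orthogonal Cq.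
Hypothesis Cq0 : forall n1 n2 n, CG_admissible n1 n2 n ->
  forall i1 i2 i, cf (@Cq n1 n2 n i1 i2 i) 0 = @C n1 n2 n i1 i2 i.
Local Notation p := (@h_limit R M).

Let hM : hadic M := M2_hadic M.
Let hX : hadic {series X} := @hadic_series _ _.
Let alphaL : linear alpha := proj1 alphaA.
Let alpha1 : alpha 1 = 1 := fst (proj2 alphaA).
Let alphaM : {morph alpha : x y / x * y} := snd (proj2 alphaA).
Let PhiL : linear Phi := Phi_lin HPhi.

Lemma Uh_torsionfree : htorsionfree Uh.
Proof.
move=> x E; apply: (bij_inj alphaB); rewrite (lin0 alphaL).
by apply: (@series_torsionfree K U); rewrite -(linZ alphaL) E (lin0 alphaL).
Qed.

(** Were the undeformed representation its default 0, the compatibility of [alpha] with the spin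
    representations would fail at 1. *)
Lemma spin_rel0 n :
  su2_rel (at_h0 (spinE K n)) (at_h0 (spinH K n)) (at_h0 (spinF K n)).
Proof.
pose spec (rho : U -> 'M[K]_n.+1) := [/\ alg_hom rho,
  rho (UE U) = at_h0 (spinE K n), rho (UH U) = at_h0 (spinH K n)
  & rho (UF U) = at_h0 (spinF K n)].
have [[rA rE rH rF]|E] := the_or (fun=> 0) spec; first exact (su2_rel_image rA rE rH rF).
have rho0 : spin0 (U := U) n = fun=> 0 by exact: E.
have := alpha_spin n 1; rewrite (qspin1 HactM HT).
move/(congr1 (fun A : 'M_n.+1 => cf (A ord0 ord0) 0)).
by rewrite /spin !mxE /= rho0 mxE => /eqP; rewrite oner_eq0.
Qed.

Let tfU := Uh_torsionfree.
Let rel0 := spin_rel0.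
Let tfM : htorsionfree M := M_torsionfree HPhi.

Definition alpha2 : UhUh -> UU := ct_map UhUh UU alpha alpha.
Lemma alpha2_lin : linear alpha2. Proof. exact: ct_map_lin. Qed.
Lemma alpha2E g h : alpha2 (tens UhUh g h) = tens UU (alpha g) (alpha h).
Proof. exact: ct_mapE. Qed.
Lemma alpha2M : {morph alpha2 : x y / x * y}. Proof. exact: ct_mapM. Qed.
Lemma alpha2_1 : alpha2 1 = 1.
Proof. by rewrite -(tens_one UhUh) alpha2E alpha1 tens_one. Qed.

Lemma actX_bilin : bilin actX. Proof. by case: HactX. Qed.
Lemma actX_linl x : linear (fun u => actX u x).
Proof. by have [_] := actX_bilin; apply. Qed.
Lemma actX_linr u : linear (actX u).
Proof. by have [+ _] := actX_bilin; apply. Qed.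

Lemma Phi_act u x : Phi (actX (alpha2 u) x) = actM u (Phi x).
Proof.
move: u; apply: (@ct_ext _ _ _ UhUh M (fun u => Phi (actX (alpha2 u) x))
  (fun u => actM u (Phi x)) hM).
- exact (lin_comp PhiL (lin_comp (actX_linl x) alpha2_lin)).
- exact (actM_linl HactM _).
move=> g h; rewrite alpha2E; move: x.
apply: (@Phi_ext _ _ _ _ _ _ _ HactM _ HT _ HPhi tfU rel0 _ Cq_int Cq_orth M
  (fun x => Phi (actX (tens UU (alpha g) (alpha h)) x))
  (fun x => actM (tens UhUh g h) (Phi x)) hM).
- exact (lin_comp PhiL (actX_linr _)).
- exact (lin_comp (actM_linr HactM _) PhiL).
move=> k n i i'; have [_ ->] := HactX; rewrite (lin_sum PhiL).
rewrite (Phi_basis HPhi) (actM_det HactM HT tfU).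
have [_ ->] := HT n; rewrite mulr_sumr; apply: eq_bigr => l _.
rewrite (lin_sum PhiL) mulr_sumr; apply: eq_bigr => l' _.
by rewrite (linZ PhiL) (Phi_basis HPhi) !alpha_spin scalerAr.
Qed.

(** The action on X[[h]] is specified by values on the spanning elements only. Its multiplicativity
    is inherited from M through [Phi], since [alpha] is onto and every pure tensor lifts along
    [alpha2]. *)
Lemma actXM u v x : actX (u * v) x = actX u (actX v x).
Proof.
have aM g h y : actX (alpha2 (g * h)) y = actX (alpha2 g) (actX (alpha2 h) y).
  have [_ /bij_inj Pinj _] := HPhi; apply: Pinj.
  by rewrite !Phi_act (actMM HactM).
have [beta alphaK betaK] := alphaB.
have tE g h : tens UU g h = alpha2 (tens UhUh (beta g) (beta h)).
  by rewrite alpha2E !betaK.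
move: u; apply: (@ct_ext _ _ _ UU {series X} (fun u => actX (u * v) x)
  (fun u => actX u (actX v x)) hX).
- exact (lin_comp (actX_linl x) (lin_mulr v (@lin_id _ _))).
- exact: actX_linl.
move=> g h; move: v; apply: (@ct_ext _ _ _ UU {series X}
  (fun v => actX (tens UU g h * v) x) (fun v => actX (tens UU g h) (actX v x)) hX).
- exact (lin_comp (actX_linl x) (lin_mull _ (@lin_id _ _))).
- exact (lin_comp (actX_linr _) (actX_linl x)).
by move=> g' h'; rewrite !tE -alpha2M aM.
Qed.

Lemma actX1 x : actX 1 x = x.
Proof.
have [_ /bij_inj Pinj _] := HPhi; apply: Pinj.
by rewrite -alpha2_1 Phi_act (actM1 HactM).
Qed.

Definition PhiPhi : XX -> MM := ct_map XX MM Phi Phi.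
Lemma PhiPhi_lin : linear PhiPhi. Proof. exact: ct_map_lin. Qed.
Lemma PhiPhiE x y : PhiPhi (tens XX x y) = tens MM (Phi x) (Phi y).
Proof. exact: ct_mapE. Qed.

Let hMM : hadic MM := @ct_hadic _ _ _ MM.

Lemma PhiPhi_leg23 (u : UhUh) (z : XX) :
  ct_act actM (leg23 Uh4 u) (PhiPhi z) =
  PhiPhi (ct_act actX (leg23 U4 (alpha2 u)) z).
Proof.
move: u; apply: (@ct_ext _ _ _ UhUh MM
  (fun u => ct_act actM (leg23 Uh4 u) (PhiPhi z))
  (fun u => PhiPhi (ct_act actX (leg23 U4 (alpha2 u)) z)) hMM).
- exact (lin_comp (ct_act_linl (actM_bilin HactM) _) (leg23_lin Uh4)).
- exact (lin_comp PhiPhi_lin (lin_comp (ct_act_linl actX_bilin _)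
    (lin_comp (leg23_lin U4) alpha2_lin))).
move=> g h; rewrite alpha2E !leg23E; move: z.
apply: (@ct_ext _ _ _ XX MM
  (fun z => ct_act actM (tens Uh4 (tens UhUh 1 g) (tens UhUh h 1)) (PhiPhi z))
  (fun z => PhiPhi (ct_act actX
    (tens U4 (tens UU 1 (alpha g)) (tens UU (alpha h) 1)) z)) hMM).
- exact (lin_comp (ct_act_linr (actM_bilin HactM) _) PhiPhi_lin).
- exact (lin_comp PhiPhi_lin (ct_act_linr actX_bilin _)).
move=> x y; rewrite PhiPhiE (ct_actE actX_bilin) PhiPhiE (ct_actE (actM_bilin HactM)).
by rewrite -!Phi_act !alpha2E alpha1.
Qed.

Lemma det_q_centralX k (x : M) : det_q M ^+ k * x = x * det_q M ^+ k.
Proof.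
elim: k => [|k IH]; first by rewrite expr0 mul1r mulr1.
by rewrite exprSr -mulrA (det_q_central tfM) mulrA IH -mulrA.
Qed.

Lemma spin_lin n k i : linear (fun g : {series U} => spin n g k i : {series K}^o).
Proof.
have [beta alphaK betaK] := alphaB; move=> c x y.
rewrite -{1}[x]betaK -{1}[y]betaK -alphaL -!alpha_spin.
by rewrite (qspin_lin HactM HT) !alpha_spin !betaK.
Qed.

Section Pair.
Context (n1 n2 : nat).
Local Notation J := ('I_n1.+1 * 'I_n2.+1)%type.

Definition tc (a b : J) : UU -> {series K}^o :=
  tens_coef (@spin _ U) a.1 a.2 b.1 b.2.

Lemma tcP (a b : J) : linear (tc a b) /\
  forall g h, tc a b (tens UU g h) = spin n1 g a.1 b.1 * spin n2 h a.2 b.2.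
Proof.
apply: (ct_liftP UU (hadic_scalar K)); split=> [g|h].
  exact (lin_mull _ (@spin_lin n2 a.2 b.2)).
exact (lin_mulr _ (@spin_lin n1 a.1 b.1)).
Qed.

(** Legs 1 and 3 act on the left indices of the two factors and legs 2 and 4 on the right ones, so u
    and v enter through separate matrix coefficients; the powers of det_q are central and factor
    out. *)
Lemma leg13_leg24_act k1 k2 (a b : J) (u v : UU) :
  ct_mult MM (PhiPhi (ct_act actX (leg13 U4 u * leg24 U4 v)
    (tens XX (series_const (Defs.det0 R ^+ k1 * p (T a.1 b.1)))
             (series_const (Defs.det0 R ^+ k2 * p (T a.2 b.2)))))) =
  det_q M ^+ (k1 + k2) * \sum_d tc d b v *: \sum_c tc c a u *: TT T c d.
Proof.
set x := series_const _; set y := series_const _.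
pose L (z : U4) := ct_mult MM (PhiPhi (ct_act actX z (tens XX x y))).
have LL : linear L.
  exact (lin_comp (ct_mult_lin MM hM) (lin_comp PhiPhi_lin (ct_act_linl actX_bilin _))).
rewrite -/(L _); move: u; apply: (@ct_ext _ _ _ UU M
  (fun u => L (leg13 U4 u * leg24 U4 v))
  (fun u => det_q M ^+ (k1 + k2) * \sum_d tc d b v *: \sum_c tc c a u *: TT T c d) hM).
- exact (lin_comp LL (lin_mulr _ (leg13_lin U4))).
- apply: (@lin_mull _ UU M); apply: (@lin_bigsum _ UU M) => d.
  apply: (@lin_scale _ UU M); apply: (@lin_bigsum _ UU M) => c.
  exact (@lin_scalel _ UU M _ _ (proj1 (tcP c a))).
move=> g h; move: v; apply: (@ct_ext _ _ _ UU M
  (fun v => L (leg13 U4 (tens UU g h) * leg24 U4 v))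
  (fun v => det_q M ^+ (k1 + k2) *
    \sum_d tc d b v *: \sum_c tc c a (tens UU g h) *: TT T c d) hM).
- exact (lin_comp LL (lin_mull _ (leg24_lin U4))).
- apply: (@lin_mull _ UU M); apply: (@lin_bigsum _ UU M) => d.
  exact (@lin_scalel _ UU M _ _ (proj1 (tcP d b))).
move=> g' h'; rewrite leg13E leg24E !tens_mul !mulr1 !mul1r /L.
rewrite (ct_actE actX_bilin) PhiPhiE ct_multE // /x /y.
have [_ aX] := HactX; rewrite !aX !(lin_sum PhiL).
have PhiT k n (f f' : 'I_n.+1 -> {series K}) :
    \sum_(l < n.+1) Phi (\sum_(l' < n.+1) (f l * f' l') *:
      series_const (Defs.det0 R ^+ k * p (T l l'))) =
    det_q M ^+ k * \sum_(l < n.+1) \sum_(l' < n.+1) (f l * f' l') *: T l l'.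
  rewrite mulr_sumr; apply: eq_bigr => l _; rewrite (lin_sum PhiL) mulr_sumr.
  by apply: eq_bigr => l' _; rewrite (linZ PhiL) (Phi_basis HPhi) scalerAr.
rewrite !PhiT.
rewrite -mulrA [X in _ * X]mulrA -[X in _ * (X * _)]det_q_centralX -mulrA mulrA -exprD.
congr (_ * _).
under [RHS]eq_bigr => d _ do rewrite scaler_sumr.
rewrite [RHS]exchange_big mul_sum4; apply: eq_bigr => c _; apply: eq_bigr => d _.
rewrite (proj2 (tcP d b)) (proj2 (tcP c a)) -scalerAl -scalerAr !scalerA.
exact (congr1 (fun s => s *: _) (etrans (mulrACA _ _ _ _) (mulrC _ _))).
Qed.
End Pair.

Context (F : UU).
Hypothesis F_coef : forall n1 n2 (k1 i1 : 'I_n1.+1) (k2 i2 : 'I_n2.+1),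
  tens_coef (@spin _ U) k1 k2 i1 i2 F =
  \sum_(n < (n1 + n2).+1 | CG_admissible n1 n2 n) \sum_(i < n.+1)
    series_map (real_complex R) (@Cq n1 n2 n k1 k2 i) *
    series_const (real_complex R (@C n1 n2 n i1 i2 i)).

Definition cc n1 n2 n (a : 'I_n1.+1 * 'I_n2.+1) (i : 'I_n.+1) : {series K} :=
  series_const (real_complex R (@C n1 n2 n a.1 a.2 i)).

(** The matrix of the twist is C_q times the transpose of C: it decouples with the classical
    coefficients and couples again with the deformed ones. *)
Lemma tc_twist n1 n2 (a : 'I_n1.+1 * 'I_n2.+1) (G : 'I_n1.+1 * 'I_n2.+1 -> M) :
  \sum_c tc c a F *: G c =
  \sum_(n < (n1 + n2).+1 | CG_admissible n1 n2 n) \sum_(i < n.+1)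
    cc a i *: \sum_c cq Cq c i *: G c.
Proof.
under eq_bigr => c _ do rewrite /tc F_coef scaler_suml.
rewrite exchange_big /=; apply: eq_bigr => n _.
under eq_bigr => c _ do rewrite scaler_suml.
rewrite exchange_big /=; apply: eq_bigr => i _; rewrite scaler_sumr.
by apply: eq_bigr => c _; rewrite scalerA mulrC.
Qed.

Lemma cq_cf0 n1 n2 n (a : 'I_n1.+1 * 'I_n2.+1) (i : 'I_n.+1) :
  CG_admissible n1 n2 n -> cf (cq Cq a i) 0 = cf (cc a i) 0.
Proof. by move=> An; rewrite /= Cq0. Qed.

(** On spanning elements both sides have the same expansion. On the left, the twist yields classical
    coefficients C C times the fully q-coupled products [WW], which are det_q^k T. On the right, the
    undeformed product is the limit of the product formula, with coefficients C C and terms det^k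
    T', and [Phi] sends these to det_q^k T. *)
Lemma twist_product (z : XX) :
  ct_mult MM (PhiPhi (ct_act actX (leg13 U4 F * leg24 U4 F) z)) =
  Phi (ct_mult XX z).
Proof.
have mX := ct_mult_lin XX hX.
pose L (z : XX) := ct_mult MM (PhiPhi (ct_act actX (leg13 U4 F * leg24 U4 F) z)).
have LL : linear L.
  exact (lin_comp (ct_mult_lin MM hM) (lin_comp PhiPhi_lin (ct_act_linr actX_bilin _))).
have pL := limit_lin (h_limitP HT HPhi).
rewrite -/(L z); move: z; apply: (@ct_ext _ _ _ XX M L (fun z => Phi (ct_mult XX z)) hM).
- exact: LL.
- exact (lin_comp PhiL mX).
move=> x y; move: x; apply: (@Phi_ext _ _ _ _ _ _ _ HactM _ HT _ HPhi tfU rel0 _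
  Cq_int Cq_orth M (fun x => L (tens XX x y)) (fun x => Phi (ct_mult XX (tens XX x y))) hM).
- exact (lin_comp LL (tens_linl XX y)).
- exact (lin_comp PhiL (lin_comp mX (tens_linl XX y))).
move=> k1 n1 i1 i1'; set x := series_const _.
move: y; apply: (@Phi_ext _ _ _ _ _ _ _ HactM _ HT _ HPhi tfU rel0 _
  Cq_int Cq_orth M (fun y => L (tens XX x y)) (fun y => Phi (ct_mult XX (tens XX x y))) hM).
- exact (lin_comp LL (tens_linr XX x)).
- exact (lin_comp PhiL (lin_comp mX (tens_linr XX x))).
move=> k2 n2 i2 i2'; rewrite /L /x.
rewrite (@leg13_leg24_act n1 n2 k1 k2 (i1, i2) (i1', i2')) ct_multE // -series_constM.
have -> : Defs.det0 R ^+ k1 * p (T i1 i1') * (Defs.det0 R ^+ k2 * p (T i2 i2')) =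
    Defs.det0 R ^+ (k1 + k2) * p (TT T (i1, i2) (i1', i2')).
  by rewrite /TT (limitM (h_limitP HT HPhi)) exprD; ring.
rewrite (limit_product HactM HT HPhi tfU rel0 Cq_int Cq_orth).
rewrite (h0lin_sum pL) [X in series_const X]mulr_sumr series_const_sum (lin_sum PhiL).
under eq_bigr => d _ do rewrite tc_twist.
(* The twist is evaluated on the left indices first, which produces [VV]; the twist in legs 2 and 4
   still acts on the right indices. *)
transitivity (det_q M ^+ (k1 + k2) *
  \sum_(n < (n1 + n2).+1 | CG_admissible n1 n2 n) \sum_(i < n.+1)
    cc (i1, i2) i *: \sum_d tc d (i1', i2') F *: VV T Cq i d).
  congr (_ * _); under eq_bigr => d _ do rewrite scaler_sumr.
  rewrite exchange_big /=; apply: eq_bigr => n _.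
  under eq_bigr => d _ do rewrite scaler_sumr.
  rewrite exchange_big /=; apply: eq_bigr => i _; rewrite scaler_sumr.
  by apply: eq_bigr => d _; rewrite !scalerA mulrC.
rewrite mulr_sumr; apply: eq_bigr => n An.
rewrite (h0lin_sum pL) [X in series_const X]mulr_sumr series_const_sum (lin_sum PhiL) mulr_sumr.
(* On the right indices the twist produces [WW]; only equal spins n' = n survive, which collapses
   the two sums over spins to one. *)
apply: eq_bigr => i _; rewrite tc_twist (bigD1 n) //= [X in _ + X]big1 ?addr0; last first.
  move=> n' /andP[An' ne]; rewrite big1 // => i' _.
  rewrite -/(WW T Cq n1 n2 i i') (WW_off_diag HactM HT HPhi tfU rel0 Cq_int Cq_orth) //.
    by rewrite scaler0.
  by rewrite eq_sym.
rewrite (h0lin_sum pL) [X in series_const X]mulr_sumr series_const_sum (lin_sum PhiL) scaler_sumr mulr_sumr.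
apply: eq_bigr => i' _; rewrite -/(WW T Cq n1 n2 i i').
rewrite (WW_diag HactM HT HPhi tfU rel0 Cq_int Cq_orth) // (h0linZ pL).
rewrite (limit_detX HT HPhi) -[X in series_const X]scalerAr series_const_scale.
rewrite (linZ PhiL) [Defs.det0 R ^+ _ * (_ * _)]mulrA -exprD (Phi_basis HPhi) exprD.
rewrite -!scalerAr scalerA -mulrA; congr (_ *: _).
  (* The limit retains the constant coefficients of C_q C_q, and these are the classical C C that
     the twist supplies on the other side. *)
  by rewrite cfM0 !cq_cf0 // series_constM.
by rewrite !exprD -!mulrA.
Qed.
End Assembly.

Theorem proposition10 (R : realType)
  (U : su2_env R[i])
  (UU : ctensor {series U} {series U}) (U4 : ctensor UU UU)
  (Uh : qsu2_env R[i]) (UhUh : ctensor Uh Uh) (Uh4 : ctensor UhUh UhUh)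
  (M : M2_space R[i]) (MM : ctensor M M)
  (XX : ctensor {series {mpoly R[i][4]}} {series {mpoly R[i][4]}})
  (alpha : Uh -> {series U}) (Halpha : is_alpha alpha)
  (C : CG_family R) (HC : is_CG UU C)
  (Cq : CG_family {series R}) (HCq : is_qCG UhUh C Cq)
  (Fs : UU) (HFs : is_standard_twist UhUh alpha C Cq Fs)
  (actM : UhUh -> M -> M) (HactM : is_M2_action Uh4 MM actM)
  (T : forall n, 'I_n.+1 -> 'I_n.+1 -> M) (HT : is_T actM T)
  (actX : UU -> {series {mpoly R[i][4]}} -> {series {mpoly R[i][4]}})
  (HactX : is_X_action T actX)
  (Phi : {series {mpoly R[i][4]}} -> M) (HPhi : is_identification T Phi) :
  forall x y : {series {mpoly R[i][4]}},
    mu_h Uh4 MM actM Phi (tens XX x y) =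
    ct_mult XX (ct_act actX (inverse (F_sl2 UhUh U4 alpha Fs)) (tens XX x y)).
Proof.
move=> x y; have [[alphaA alphaB] _ _ _ alpha_spin] := Halpha.
have [Cq_int Cq_orth Cq0] := HCq.
have [[[G [GF FG]] _ _ _] F_coef] := HFs.
have [Rinv [RinvR RRinv]] := Rmatrix_unit UhUh.
pose A : UhUh -> UU := alpha2 UU alpha.
have A1 : A 1 = 1 by exact: alpha2_1.
have AM : {morph A : u v / u * v} by exact: alpha2M.
pose RU := A (Rmatrix UhUh); pose RV := A Rinv.
have VU : RV * RU = 1 by rewrite -AM RinvR.
have UV : RU * RV = 1 by rewrite -AM RRinv.
have RVE : inverse (Rmatrix_U UU UhUh alpha) = RV by exact: inverseE VU UV.
(* Each leg embedding is multiplicative, so the factors are inverted in reverse order; G is the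
   inverse of the twist, and R_23 is inverse to R_23^-1. *)
have FE : inverse (F_sl2 UhUh U4 alpha Fs) = leg24 U4 G * leg13 U4 G * leg23 U4 RU.
  rewrite /F_sl2 RVE; apply: inverseE; rewrite !mulrA.
    rewrite -[_ * leg23 U4 RU * _]mulrA -leg23M UV leg23_1 mulr1.
    rewrite -[_ * leg13 U4 G * _]mulrA -leg13M GF leg13_1 mulr1.
    by rewrite -leg24M GF leg24_1.
  rewrite -[_ * leg24 U4 Fs * _]mulrA -leg24M FG leg24_1 mulr1.
  rewrite -[_ * leg13 U4 Fs * _]mulrA -leg13M FG leg13_1 mulr1.
  by rewrite -leg23M VU leg23_1.
have aX := actX_bilin HactX.
have aXM := actXM alphaA alphaB alpha_spin HactM HT HactX HPhi Cq_int Cq_orth.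
have aX1 := actX1 alphaA alphaB alpha_spin HactM HT HactX HPhi Cq_int Cq_orth.
rewrite FE (ct_actM aX) // /mu_h /Minkowski_mult.
rewrite -/(@PhiPhi R M MM XX Phi).
rewrite (PhiPhi_leg23 U4 alphaA alphaB alpha_spin HactM HT HactX HPhi Cq_int Cq_orth).
set Z := ct_act actX (leg23 U4 _) _.
(* [Z'] is the argument of the undeformed product. Writing R_23 applied to x (x) y as F_13 F_24
   applied to [Z'] brings the deformed product into the form of [twist_product]. *)
pose Z' := ct_act actX (leg24 U4 G * leg13 U4 G) Z.
rewrite -/Z'.
have -> : Z = ct_act actX (leg13 U4 Fs * leg24 U4 Fs) Z'.
  rewrite /Z' -(ct_actM aX) // !mulrA -[_ * leg24 U4 Fs * _]mulrA -leg24M FG.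
  by rewrite leg24_1 mulr1 -leg13M FG leg13_1 (ct_act1 _ aX).
rewrite (twist_product U4 alphaA alphaB alpha_spin HactM HT HactX HPhi Cq_int
  Cq_orth Cq0 F_coef).
have [_ PB _] := HPhi; exact (inverse_mapK _ PB).
Qed.
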